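(* Let $(\vec{\varepsilon}_0,\vec{\theta}_0)\in\Omega_1\times\Omega_2$ and assume all of the following. (a) All entries of $\Pi^{\vec{\varepsilon}_0}$ are strictly positive. (b) For all $y\in\mathcal{Y}$, $q^{\vec{\theta}_0}(z|y)>0$ for all $z\in\mathcal{Z}$. (c) There exists $r_2>0$ such that: for any $(y,z)\in\mathcal{Y}\times\mathcal{Z}$, $\vec{\theta}\mapsto q^{\vec{\theta}}(z|y)$ is (complex) analytic on $\mathbb{C}^{m_2}_{\vec{\theta}_0}(r_2)$; for any $y\in\mathcal{Y}$, $q^{\vec{\theta}}(z|y)$ is jointly continuous in $(z,\vec{\theta})$ on $\mathcal{Z}\times\mathbb{C}^{m_2}_{\vec{\theta}_0}(r_2)$; and the three integrals $$\int_{\mathcal{Z}}\breve{q}(z,r_2)\,dz,\qquad \int_{\mathcal{Z}}\breve{q}(z,r_2)\log\hat{q}(z,r_2)\,dz,\qquad \int_{\mathcal{Z}}\breve{q}(z,r_2)\log\breve{q}(z,r_2)\,dz$$ are all finite, where $\breve{q}(z,r_2)=\sup_{(y,\vec{\theta})\in\mathcal{Y}\times\mathbb{C}^{m_2}_{\vec{\theta}_0}(r_2)}|q^{\vec{\theta}}(z|y)|$ and $\hat{q}(z,r_2)=\inf_{(y,\vec{\theta})\in\mathcal{Y}\times\mathbb{C}^{m_2}_{\vec{\theta}_0}(r_2)}|q^{\vec{\theta}}(z|y)|$. If, in addition, for any $\delta>0$ there exists $r_2>0$ such that for all $(y,z)\in\mathcal{Y}\times\mathcal{Z}$ and all $\vec{\theta}\in\mathbb{C}^{m_2}_{\vec{\theta}_0}(r_2)$,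 $$|\Im(q^{\vec{\theta}}(z|y))|<\delta\,|\Re(q^{\vec{\theta}}(z|y))|\qquad\text{and}\qquad\left|\log\frac{q^{\vec{\theta}}(z|y)}{q^{\vec{\theta}_0}(z|y)}\right|\le\delta,$$ then the entropy rate $H(Z)$, as a function of $(\vec{\varepsilon},\vec{\theta})$, is analytic around $(\vec{\varepsilon}_0,\vec{\theta}_0)$.
   Context: Let $\mathcal{Y}=\{1,2,\dots,l\}$ and $\mathcal{Z}=\mathbb{R}$. Let $\Omega_1\subset\mathbb{R}^{m_1}$ and $\Omega_2\subset\mathbb{R}^{m_2}$ be bounded domains (open connected sets). For $\vec{\varepsilon}\in\Omega_1$, $\Pi^{\vec{\varepsilon}}=(\pi^{\vec{\varepsilon}}_{ij})_{l\times l}$ is a stochastic matrix depending real-analytically on $\vec{\varepsilon}$, and $Y=(Y_n)$ is the $\mathcal{Y}$-valued stationary first-order Markov chain with transition matrix $\Pi^{\vec{\varepsilon}}$ and stationary vector $\pi^{\vec{\varepsilon}}$. For $\vec{\theta}\in\Omega_2$ and $y\in\mathcal{Y}$, $q^{\vec{\theta}}(\cdot|y)$ is a probability density on $\mathcal{Z}$, and for each $(y,z)$ the map $\vec{\theta}\mapsto q^{\vec{\theta}}(z|y)$ is real analytic on $\Omega_2$; the same notation denotes its complex analytic extension to a complex neighborhood of a given point. $\mathbb{C}^{m}_{x}(r)$ denotes the (open) $r$-neighborhood of $x$ in $\mathbb{C}^m$. $\Re$, $\Im$ are real and imaginary parts, and $\log$ of a complex number is the principal branch (branch cut along the negative real axis).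 The hidden Markov chain $Z$ is the output of the memoryless channel with input $Y$: conditionally on $Y$, the $Z_n$ are independent and $Z_n$ has density $q^{\vec{\theta}}(\cdot|Y_n)$. Let $p=p^{\vec{\varepsilon},\vec{\theta}}$ denote the resulting (joint) densities, with $z_{-n}^0=(z_{-n},\dots,z_0)$. The entropy rate is $$H(Z)=\lim_{n\to\infty}\frac{1}{n+1}H(Z_{-n}^0),\qquad H(Z_{-n}^0)=-\int_{\mathcal{Z}^{n+1}}p(z_{-n}^0)\log p(z_{-n}^0)\,dz_{-n}^0.$$ ''Analytic around $(\vec{\varepsilon}_0,\vec{\theta}_0)$'' means real analytic, jointly in $(\vec{\varepsilon},\vec{\theta})$, on a neighborhood of $(\vec{\varepsilon}_0,\vec{\theta}_0)$ in $\Omega_1\times\Omega_2$. *)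

(* Defs.v *)
From HB Require Import structures.
From mathcomp Require Import all_boot all_order all_algebra.
From mathcomp Require Import all_classical all_reals all_analysis.
From mathcomp Require Import complex.

Set Implicit Arguments.
Unset Strict Implicit.
Unset Printing Implicit Defensive.

Import Order.TTheory GRing.Theory Num.Theory.
Import numFieldNormedType.Exports.
Import ComplexField.Normc.

Local Open Scope classical_set_scope.
Local Open Scope ring_scope.
Local Open Scope complex_scope.

Definition power_term (K : numFieldType) (m : nat)
    (a : {ffun 'I_m -> nat} -> K) (h : 'rV[K]_m) (N : nat)
    (al : {ffun 'I_m -> 'I_N}) : K :=
  a [ffun i => nat_of_ord (al i)] * \prod_(i < m) h 0 i ^+ al i.

(* [f] is, near [x0], the sum of an absolutely convergent power series in
   [m] variables; this is real analyticity for K = R and complex analyticity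
   for K = R[i].  Partial sums run over the boxes {0, ..., N-1}^m of
   multi-indices; by absolute convergence the order of summation is
   irrelevant. *)
Definition analytic_at (K : numFieldType) (m : nat) (f : 'rV[K]_m -> K)
    (x0 : 'rV[K]_m) : Prop :=
  exists a : {ffun 'I_m -> nat} -> K, \forall x \near x0,
    cvgn (fun N => \sum_(al : {ffun 'I_m -> 'I_N}) `|power_term a (x - x0) al|)
    /\ (fun N => \sum_(al : {ffun 'I_m -> 'I_N}) power_term a (x - x0) al)
         @ \oo --> f x.

Definition analytic_on (K : numFieldType) (m : nat) (A : set 'rV[K]_m)
    (f : 'rV[K]_m -> K) : Prop :=
  forall x, A x -> analytic_at f x.

Definition bounded_domain (R : realType) (m : nat) (Omega : set 'rV[R]_m) :
    Prop :=
  [/\ open Omega, connected Omega & bounded_set Omega].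

Section complex_numbers.
Variable R : realType.

Definition to_complex (m : nat) (x : 'rV[R]_m) : 'rV[R[i]]_m :=
  map_mx (real_complex R) x.

Definition complex_ball (m : nat) (x : 'rV[R]_m) (r : R) : set 'rV[R[i]]_m :=
  [set w | Num.sqrt (\sum_(j < m) normc (w 0 j - (x 0 j)%:C) ^+ 2) < r].

(* Principal argument, in ]-pi, pi], and principal logarithm of w != 0; the
   values at w = 0 are meaningless. *)
Definition carg (w : R[i]) : R :=
  let t := acos (complex.Re w / normc w) in
  if 0 <= complex.Im w then t else - t.

Definition clog (w : R[i]) : R[i] := ln (normc w) +i* carg w.

End complex_numbers.

(* The n-fold product, on n-tuples, of a sigma-finite measure with itself. *)
Section tuple_measure.
Context d (T : measurableType d) (R : realType).
Local Open Scope ereal_scope.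

Definition tuple_consp n (p : T * n.-tuple T) : n.+1.-tuple T :=
  [tuple of p.1 :: p.2].

Lemma measurable_tuple_consp n : measurable_fun setT (@tuple_consp n).
Proof. exact: measurable_cons. Qed.

Section cons_measure.
Variables (m1 : {sigma_finite_measure set T -> \bar R}) (n : nat).
Variable m2 : {sigma_finite_measure set (n.-tuple T) -> \bar R}.

Definition cons_measure : set (n.+1.-tuple T) -> \bar R :=
  pushforward (m1 \x m2) (@tuple_consp n).

Let mpre A : measurable A -> measurable (@tuple_consp n @^-1` A).
Proof.
by move=> mA; rewrite -[X in measurable X]setTI; exact: measurable_tuple_consp.
Qed.

Let cons_measure0 : cons_measure set0 = 0.
Proof. by rewrite /cons_measure /pushforward preimage_set0 measure0. Qed.

Let cons_measure_ge0 A : 0 <= cons_measure A.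
Proof. by rewrite /cons_measure /pushforward measure_ge0. Qed.

Let cons_measure_sigma_additive : semi_sigma_additive cons_measure.
Proof.
move=> F mF tF mUF; rewrite /cons_measure /pushforward preimage_bigcup.
apply: measure_semi_sigma_additive; first by move=> k; exact: mpre.
  apply/trivIsetP => /= i j _ _ ij; rewrite -preimage_setI.
  by move/trivIsetP : tF => /(_ _ _ _ _ ij) ->//; rewrite preimage_set0.
by rewrite -preimage_bigcup; exact: mpre.
Qed.

HB.instance Definition _ := isMeasure.Build _ _ _ cons_measure
  cons_measure0 cons_measure_ge0 cons_measure_sigma_additive.

Let cons_measure_sigma_finite : sigma_finite setT cons_measure.
Proof.
have /sigma_finiteP[F [FT ndF Foo]] := sigma_finiteT m1.
have /sigma_finiteP[G [GT ndG Goo]] := sigma_finiteT m2.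
pose uncons (t : n.+1.-tuple T) : T * n.-tuple T :=
  (thead t, [tuple of behead t]).
have consK : cancel (@tuple_consp n) uncons.
  move=> -[x t]; rewrite /uncons /tuple_consp theadE; congr pair.
  exact: val_inj.
have munc : measurable_fun setT uncons.
  by apply: measurable_fun_pair => /=;
    [exact: measurable_tnth|exact: measurable_behead].
exists (fun k => uncons @^-1` (F k `*` G k)).
  apply/seteqP; split => // t _.
  have [n1 _ Fn1] : (\bigcup_k F k) (uncons t).1 by rewrite -FT.
  have [n2 _ Gn2] : (\bigcup_k G k) (uncons t).2 by rewrite -GT.
  exists (maxn n1 n2) => //; split.
    by move: Fn1; apply/subsetPset/ndF/leq_maxl.
  by move: Gn2; apply/subsetPset/ndG/leq_maxr.
move=> k; have [mF Fk] := Foo k; have [mG Gk] := Goo k; split.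
  by rewrite -[X in measurable X]setTI; apply: munc => //; exact: measurableX.
rewrite /cons_measure /pushforward -comp_preimage (_ : _ \o _ = id).
  by rewrite preimage_id product_measure1E// lte_mul_pinfty// ge0_fin_numE.
by apply/funext => p; exact: consK.
Qed.

HB.instance Definition _ := Measure_isSigmaFinite.Build _ _ _ cons_measure
  cons_measure_sigma_finite.

End cons_measure.

Fixpoint tuple_measure (m : {sigma_finite_measure set T -> \bar R}) (n : nat) :
    {sigma_finite_measure set (n.-tuple T) -> \bar R} :=
  match n with
  | 0 => \d_([tuple] : 0.-tuple T)
  | n.+1 => cons_measure m (tuple_measure m n)
  end.

Lemma tuple_measure_box (m : {sigma_finite_measure set T -> \bar R}) (n : nat)
    (A : 'I_n -> set T) : (forall i, measurable (A i)) ->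
  tuple_measure m n [set t | forall i, A i (tnth t i)] = \prod_(i < n) m (A i).
Proof.
elim: n A => [|n IH] A mA.
  by rewrite big_ord0 /= diracE mem_set//; case.
rewrite big_ord_recl -IH// /= /cons_measure /pushforward /=.
rewrite -product_measure1E//.
  congr (_ _); apply/seteqP; split => -[x t] /=.
    move=> h; split; first by have := h ord0.
    by move=> i; have := h (lift ord0 i); rewrite tnthS.
  by move=> [h1 h2] i; case: (unliftP ord0 i) => [j ->|->]; rewrite ?tnthS.
rewrite (_ : [set t | _] =
    \bigcap_(i in setT) ((@tnth n T ^~ i) @^-1` A (lift ord0 i))).
  apply: fin_bigcap_measurable => // i _; rewrite -[X in measurable X]setTI.
  exact: measurable_tnth.
by apply/seteqP; split => t h i; [move=> _; exact: h|exact: h].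
Qed.

End tuple_measure.

Section hidden_markov_chain.
Variables (R : realType) (l : nat).

Definition stochastic_matrix (P : 'M[R]_l) : Prop :=
  (forall i j, 0 <= P i j) /\ (forall i, \sum_j P i j = 1).

Definition stationary_vector (P : 'M[R]_l) (pi : 'rV[R]_l) : Prop :=
  [/\ forall j, 0 <= pi 0 j, \sum_j pi 0 j = 1 & pi *m P = pi].

Definition probability_density (f : R -> R) : Prop :=
  [/\ measurable_fun setT f, forall z, 0 <= f z &
      (\int[@lebesgue_measure R]_z (f z)%:E = 1)%E].

Variables (P : 'M[R]_l) (pi : 'rV[R]_l) (q : 'I_l -> R -> R).

(* A window of n+1 consecutive times -n, ..., 0 is indexed by 0, ..., n. *)
Definition path_probability (n : nat) (y : {ffun 'I_n.+1 -> 'I_l}) : R :=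
  pi 0 (y ord0) * \prod_(k < n) P (y (widen_ord (leqnSn n) k)) (y (lift ord0 k)).

Definition channel_density (n : nat) (y : {ffun 'I_n.+1 -> 'I_l})
    (z : n.+1.-tuple R) : R :=
  \prod_(k < n.+1) q (y k) (tnth z k).

Definition hmc_density (n : nat) (z : n.+1.-tuple R) : R :=
  \sum_(y : {ffun 'I_n.+1 -> 'I_l}) path_probability y * channel_density y z.

(* [ln 0 = 0], so the integrand is 0 where the density vanishes. *)
Definition block_entropy (n : nat) : \bar R :=
  (- \int[tuple_measure (@lebesgue_measure R) n.+1]_z
       (hmc_density z * ln (hmc_density z))%:E)%E.

Definition normalized_block_entropy (n : nat) : \bar R :=
  ((n.+1%:R^-1)%:E * block_entropy n)%E.

Definition entropy_rate : \bar R := limn normalized_block_entropy.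

End hidden_markov_chain.

Section envelopes.
Variables (R : realType) (l m : nat).
Variables (q : 'rV[R[i]]_m -> 'I_l -> R -> R[i]) (x : 'rV[R]_m) (r : R).

Definition envelope_values (z : R) : set (\bar R) :=
  [set (normc (q yt.2 yt.1 z))%:E | yt in [set: 'I_l] `*` complex_ball x r].

Definition q_breve (z : R) : \bar R := ereal_sup (envelope_values z).

Definition q_hat (z : R) : \bar R := ereal_inf (envelope_values z).

End envelopes.

(* Main.v *)
(* Everything is expanded in absolutely convergent power series in the
   displacement h of the parameters, with coefficients depending measurably on
   the observations; in the resulting weighted Wiener algebra, sums, products,
   1 / (1 + F), ln (1 + F), series and integrals over the observations are
   controlled by norms alone, without complexification of the entropies.

   By Cauchy's estimates, obtained from averages over roots of unity, the
   bound |q^theta| <= e q^theta0 makes q / q^theta0 such a series, with relative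
   error small uniformly in z on small boxes; the stationary vector is one by a
   Neumann series.  For strictly positive transition matrices the backward
   density vectors contract projectively, which the Wiener norm inherits for
   small relative errors.  Hence r(t), the logarithm of the conditional density
   of the first of the observations t given the others, varies with the last
   observation by a series of norm O(lambda^n), lambda < 1, n the number of
   observations.

   If G_n is the mean of r over n + 1 observations then the block entropies are
   - (G_0 + ... + G_n), and consistency of the marginals turns G_(n+1) - G_n into
   the mean of such a variation; since the Wiener norm of the density has mass
   at most (1 + delta)^(2n+1), with delta the relative error of the data and
   (1 + delta)^2 lambda < 1, the series of differences converges in the Wiener
   algebra, and Cesaro's theorem identifies its sum with minus the entropy rate. *)
Require Import Defs.
From HB Require Import structures.
From mathcomp Require Import all_boot all_order all_algebra.
From mathcomp Require cyclic separable cyclotomic.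
From mathcomp Require finmap.
From mathcomp Require Import all_classical all_reals all_analysis measurable_realfun.
From mathcomp Require Import complex ring lra.

Set Implicit Arguments.
Unset Strict Implicit.
Unset Printing Implicit Defensive.

Import Order.TTheory GRing.Theory Num.Theory.
Import numFieldNormedType.Exports.

Local Open Scope classical_set_scope.
Local Open Scope ring_scope.

(** A projective metric is not an algebra norm, so the contraction is brought into additive form by
    a Doeblin splitting: all rows of the unperturbed conditional kernel dominate [kap] times one and
    the same law [sw]. The average under [sw] does not see the starting state and is moved into a
    common factor or a common term; what is left has mass 1 - kap, a statement about sums of
    absolute values that the l^1 norm inherits. The common factors are never estimated: they occur
    only in quotients where they cancel, such as normalised weights, ratios of backward vectors and
    conditional densities. The density itself offers no such cancellation; its norm is allowed to
    grow exponentially, and the decay of the increments pays for it. Inverses and logarithms need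
    errors well below 1, which forgetting provides only after some steps. Hence real inequalities at
    h = 0 first bring the oscillation down during [n0] steps, and the induction in the algebra
    starts there. The admissible relative error [del] depends on [kap] alone, neither on [n0] nor on
    the number of observations, so one box serves all block lengths. *)

Definition multi_index (m : nat) := {ffun 'I_m -> nat}.
HB.instance Definition _ m := Countable.on (multi_index m).
HB.instance Definition _ m := isPointed.Build (multi_index m) [ffun=> 0%N].
HB.instance Definition _ m := @isMeasurable.Build default_measure_display
  (multi_index m) discrete_measurable discrete_measurable0
  discrete_measurableC discrete_measurableU.

(** * Sums over countable sets as integrals for a counting measure *)

Section counting_sums.
Context d (T : measurableType d) (R : realType).
Hypothesis mT : forall A : set T, measurable A.
Variable count : {measure set T -> \bar R}.
Hypothesis count1 : forall x, (count [set x] = 1)%E.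

Lemma counting_point (r : R) (x : T) :
  (\int[count]_t (r * (t == x)%:R)%:E = r%:E)%E.
Proof.
under eq_integral => t _ do rewrite EFinM.
have E : (fun t : T => (t == x)%:R) = \1_[set x] :> (T -> R).
  by apply/funext => t; rewrite indicE in_set1.
have I1 : (\int[count]_t ((t == x)%:R%:E) = 1%:E)%E.
  under eq_integral => t _ do rewrite -[_%:R]/((fun t => (t == x)%:R) t) E.
  by rewrite integral_indic ?setIT // count1.
rewrite integralZl //; first by rewrite I1 mule1.
apply/integrableP; split; first by move=> ? ? ?; exact: mT.
by under eq_integral => t _ do rewrite abse_EFin ger0_norm //; rewrite I1 ltry.
Qed.

Lemma integrable_point (r : R) (x : T) :
  count.-integrable setT (fun t => (r * (t == x)%:R)%:E).
Proof.
apply/integrableP; split; first by move=> ? ? ?; exact: mT.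
under eq_integral => t _ do rewrite abse_EFin normrM normr_nat.
by rewrite counting_point ltry.
Qed.

Lemma counting_finite (f : T -> R) (s : seq T) : uniq s ->
  (\int[count]_t (f t * (t \in s)%:R)%:E = (\sum_(x <- s) f x)%:E)%E.
Proof.
move=> us.
have E t : (f t * (t \in s)%:R)%:E = (\sum_(x <- s) (f x * (t == x)%:R)%:E)%E.
  rewrite sumEFin; congr EFin; case: (boolP (t \in s)) => [ts|ts].
    rewrite (big_rem t) //= eqxx big1_seq ?addr0 // => y /andP[_].
    by rewrite mem_rem_uniq // inE eq_sym => /andP[/negbTE ->]; rewrite mulr0.
  rewrite big1_seq ?mulr0 // => y /andP[_ ys].
  case: eqP => [e|_]; last by rewrite mulr0.
  by move: ts; rewrite e ys.
under eq_integral => t _ do rewrite E.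
rewrite integral_sum //; last by move=> x; exact: integrable_point.
by rewrite -sumEFin; apply: eq_bigr => x _; exact: counting_point.
Qed.

(** Dominated convergence: along every exhausting sequence of finite lists the partial sums of an
    integrable family tend to its integral. One statement thus serves boxes of multi-indices,
    truncations by degree and initial segments of [nat]. *)
Lemma counting_exhaust (f : T -> R) (s : nat -> seq T) :
  (forall n, uniq (s n)) -> (forall t, \forall n \near \oo, t \in s n) ->
  count.-integrable setT (EFin \o f) ->
  (fun n => \sum_(x <- s n) f x) @ \oo --> fine (\int[count]_t (f t)%:E)%E.
Proof.
move=> us cs fi.
have fin : (\int[count]_t (f t)%:E)%E \is a fin_num.
  exact: (integrable_fin_num measurableT fi).
apply: (@cvg_trans _ ((fun n => fine (\int[count]_t (f t * (t \in s n)%:R)%:E)%E) @ \oo)).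
  by apply: near_eq_cvg; apply: nearW => n /=; rewrite counting_finite.
apply: fine_cvg; rewrite fineK //.
have := @dominated_convergence _ _ _ count setT measurableT
  (fun n t => (f t * (t \in s n)%:R)%:E) (EFin \o f) (fun t => (`|f t|)%:E).
case.
- by move=> n ? ? ?; exact: mT.
- by move=> ? ? ?; exact: mT.
- apply: aeW => t _; apply/cvg_EFin; first by apply: nearW.
  apply: cvg_near_cst.
  near=> n; rewrite /= (_ : t \in s n) ?mulr1 //; near: n; exact: cs.
- exact: (integrable_abse fi).
- apply: aeW => t n _; rewrite abse_EFin lee_fin normrM normr_nat.
  by rewrite ler_piMr // lern1 leq_b1.
- by [].
Unshelve. all: by end_near. Qed.

Lemma counting_ge0_fin (f : T -> R) (s : seq T) (M : \bar R) :
  (forall t, 0 <= f t) -> uniq s -> (\int[count]_t (f t)%:E <= M)%E ->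
  ((\sum_(x <- s) f x)%:E <= M)%E.
Proof.
move=> f0 us; apply: le_trans; rewrite -counting_finite //.
apply: ge0_le_integral => //.
- by move=> t _; rewrite lee_fin mulr_ge0.
- by move=> t _; rewrite lee_fin ler_piMr // lern1 leq_b1.
Qed.

(** Fatou's lemma: a bound on the finite partial sums is enough, before anything is known to be
    integrable. *)
Lemma counting_ge0_le (f : T -> R) (s : nat -> seq T) (M : R) :
  (forall t, 0 <= f t) -> (forall n, uniq (s n)) ->
  (forall t, \forall n \near \oo, t \in s n) ->
  (forall n, \sum_(x <- s n) f x <= M) ->
  (\int[count]_t (f t)%:E <= M%:E)%E.
Proof.
move=> f0 us cs sM.
have := @fatou _ _ _ count setT measurableT
  (fun n t => (f t * (t \in s n)%:R)%:E).
have -> : (fun t => limn_einf (fun n => (f t * (t \in s n)%:R)%:E)) =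
   (fun t => (f t)%:E).
  apply/funext => t.
  suff H : (fun n => (f t * (t \in s n)%:R)%:E) @ \oo --> (f t)%:E.
    by rewrite is_cvg_limn_einfE; [exact: (cvg_lim _ H)|apply/cvg_ex; exists (f t)%:E].
  apply/cvg_EFin; first by apply: nearW.
  apply: cvg_near_cst.
  near=> n; rewrite /= (_ : t \in s n) ?mulr1 //; near: n; exact: cs.
move=> H; apply: le_trans (H _ _) _.
- by move=> n ? ? ?; exact: mT.
- by move=> n t _; rewrite lee_fin mulr_ge0.
- under [X in limn_einf X]eq_fun => n do rewrite (counting_finite _ (us n)).
  rewrite limn_einf_lim; apply: lime_le; first exact: is_cvg_einfs.
  apply: nearW => n; apply: (@le_trans _ _ (\sum_(x <- s n) f x)%:E).
    by apply: ereal_inf_lbound; exists n => /=.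
  by rewrite lee_fin.
Unshelve. all: by end_near. Qed.

End counting_sums.

Section index_measure.
Variables (m : nat) (R : realType).

(* A fresh name for the counting measure: the library attaches the canonical
   sigma-finiteness of [counting] to the type [nat] only. *)
Definition index_measure : set (multi_index m) -> \bar R := counting.

HB.instance Definition _ := Measure.on index_measure.

Lemma multi_index_measurable (A : set (multi_index m)) : measurable A.
Proof. by []. Qed.

Lemma index_measure1 (x : multi_index m) : (index_measure [set x] = 1)%E.
Proof. by rewrite /index_measure /counting asboolT // fset_set1 finmap.cardfs1. Qed.

Lemma sigma_finite_index_measure : sigma_finite setT index_measure.
Proof.
exists (fun n => [set a : multi_index m | (pickle a <= n)%N]).
  by apply/seteqP; split => // a _; exists (pickle a) => /=.
move=> n; split=> //.
rewrite /index_measure /counting asboolT ?ltry //.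
apply: (sub_finite_set (B := [set` pmap unpickle (iota 0 n.+1)])).
  move=> a an; suff : a \in pmap unpickle (iota 0 n.+1) by [].
  rewrite mem_pmap; apply/mapP; exists (pickle a); last by rewrite pickleK.
  by rewrite mem_iota.
exact: finite_seq.
Qed.

HB.instance Definition _ := @Measure_isSigmaFinite.Build _ _ _ index_measure
  sigma_finite_index_measure.

End index_measure.

Section nat_measure.
Variable R : realType.

Definition nat_measure : set nat -> \bar R := counting.

HB.instance Definition _ := Measure.on nat_measure.

Lemma nat_measure1 (x : nat) : (nat_measure [set x] = 1)%E.
Proof. by rewrite /nat_measure /counting asboolT // fset_set1 finmap.cardfs1. Qed.

HB.instance Definition _ := @Measure_isSigmaFinite.Build _ _ _ nat_measure
  (sigma_finite_counting R).

End nat_measure.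

(** * Measurability in the presence of a countable factor or of a parameter *)

Section countable_pair.
Context d1 d2 d3 (T : measurableType d1) (Z : measurableType d2)
  (V : measurableType d3).

(** A preimage is a countable union of products of a point with a section, [c] enumerating the
    points; joint measurability is thereby checked one index at a time. *)
Lemma measurable_fun_countable_fst (c : T -> nat) (f : T * Z -> V) :
  (forall A : set T, measurable A) -> injective c ->
  (forall t, measurable_fun setT (fun z => f (t, z))) ->
  measurable_fun setT f.
Proof.
move=> mT ci mf _ B mB; rewrite setTI.
rewrite (_ : f @^-1` B = \bigcup_k
    \bigcup_(t in [set t | c t = k]) ([set t] `*` ((fun z => f (t, z)) @^-1` B))).
  apply: bigcupT_measurable => k.
  have [[t ctk]|nt] := pselect (exists t, c t = k).
    rewrite (_ : [set t | c t = k] = [set t]).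
      rewrite bigcup_set1; apply: measurableX => //.
      by rewrite -[X in measurable X]setTI; exact: mf.
    apply/seteqP; split => [u /= cu|u /= -> //]; apply: ci; by rewrite cu ctk.
  rewrite (_ : [set t | c t = k] = set0) ?bigcup_set0 //.
  by apply/seteqP; split => // t /= ct; case: nt; exists t.
apply/seteqP; split => [[t z] /= Bf|[t z] [k _] [u /= _] [/= -> Bf] //].
by exists (c t) => //; exists t.
Qed.

End countable_pair.

Section measurable_parameter.
Context d1 d2 (Z : measurableType d1) (S : measurableType d2) (R : realType).
Variable mu : {sigma_finite_measure set S -> \bar R}.

(** Tonelli applies to the positive and to the negative part separately, so no integrability is
    assumed; infinite values are sent to 0 by [fine]. *)
Lemma measurable_fine_integral (f : (Z * S)%type -> \bar R) :
  measurable_fun [set: (Z * S)%type] f ->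
  measurable_fun setT (fun z => fine (\int[mu]_s f (z, s))%E).
Proof.
move=> mf; apply: measurableT_comp; first exact: fine_measurable.
under eq_fun => z do rewrite integralE.
apply: emeasurable_funB.
  have mp : measurable_fun setT (f^\+)%E by exact: measurable_funepos.
  have H := measurable_fun_fubini_tonelli_F (m2 := mu) _ mp (fun x => funepos_ge0 f x).
  rewrite (_ : (fun x => _) = fubini_F mu f^\+%E) //.
  by apply/funext => z; apply: eq_integral => s _; rewrite !funeposE.
have mn : measurable_fun setT (f^\-)%E by exact: measurable_funeneg.
have H := @measurable_fun_fubini_tonelli_F _ _ Z S R mu (f^\-)%E mn (fun x => funeneg_ge0 f x).
rewrite (_ : (fun x => _) = fubini_F mu f^\-%E) //.
by apply/funext => z; apply: eq_integral => s _; rewrite !funenegE.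
Qed.

End measurable_parameter.

(** * The weighted Wiener algebra with a measurable parameter *)

Section wiener_def.
Variables (R : realType) (m : nat).
Local Notation MI := (multi_index m).
Local Notation count := (@index_measure m R).

Definition mon (h : 'rV[R]_m) (g : MI) : R := \prod_(i < m) h 0 i ^+ g i.

Definition weight (rho : R) (g : MI) : R := \prod_(i < m) rho ^+ g i.

Definition box (rho : R) : set 'rV[R]_m := [set h | forall i, `|h 0 i| <= rho].

(* [F z] is on [box rho] the sum of a power series whose coefficients depend
   measurably on [z] and whose norm in the weighted Wiener algebra l^1(rho) is
   at most [c z].  Sums over multi-indices are integrals for the counting
   measure, so that exchanging them with integrals over [z] is Fubini. *)
Definition wiener (rho : R) d (Z : measurableType d) (c : Z -> R)
    (F : Z -> 'rV[R]_m -> R) : Prop :=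
  exists a : MI -> Z -> R,
  [/\ forall g, measurable_fun setT (a g),
      forall z, (\int[count]_g (`|a g z| * weight rho g)%:E <= (c z)%:E)%E &
      forall z h, box rho h ->
        ((F z h)%:E = \int[count]_g (a g z * mon h g)%:E)%E].

Lemma weight_gt0 rho g : 0 < rho -> 0 < weight rho g.
Proof. by move=> r0; apply: prodr_gt0 => i _; rewrite exprn_gt0. Qed.

Lemma weight_ge0 rho g : 0 <= rho -> 0 <= weight rho g.
Proof. by move=> r0; apply: prodr_ge0 => i _; rewrite exprn_ge0. Qed.

Lemma norm_mon rho h g : box rho h -> `|mon h g| <= weight rho g.
Proof.
move=> hb; rewrite /mon normr_prod; apply: ler_prod => i _.
have h0 := hb i; rewrite normr_ge0 normrX /=.
by apply: lerXn2r => //; rewrite nnegrE // (le_trans _ h0).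
Qed.

Section basics.
Context d (Z : measurableType d).
Implicit Types (c : Z -> R) (F : Z -> 'rV[R]_m -> R).
Variable rho : R.
Hypothesis rho0 : 0 < rho.

Lemma coefficient_integrable (a : MI -> R) (M : R) h :
  (\int[count]_g (`|a g| * weight rho g)%:E <= M%:E)%E -> box rho h ->
  count.-integrable setT (fun g => (a g * mon h g)%:E).
Proof.
move=> aM bh; apply/integrableP; split; first by move=> ? ? ?.
apply: le_lt_trans (ltry M); apply: le_trans aM.
apply: ge0_le_integral => // g _.
by rewrite abse_EFin lee_fin normrM ler_wpM2l // norm_mon.
Qed.

Lemma wiener_ext c F F' : wiener rho c F ->
  (forall z h, box rho h -> F' z h = F z h) -> wiener rho c F'.
Proof.
move=> [a [ma ca Fa]] FF'; exists a; split => // z h hb.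
by rewrite FF' // Fa.
Qed.

Lemma wiener_le c c' F : wiener rho c F -> (forall z, c z <= c' z) ->
  wiener rho c' F.
Proof.
move=> [a [ma ca Fa]] cc; exists a; split => // z.
by apply: le_trans (ca z) _; rewrite lee_fin.
Qed.

Lemma wiener_comp d' (Z' : measurableType d') (f : Z' -> Z) c F :
  measurable_fun setT f -> wiener rho c F ->
  wiener rho (c \o f) (fun z => F (f z)).
Proof.
move=> mf [a [ma ca Fa]]; exists (fun g => a g \o f); split => /=.
- by move=> g; apply: measurableT_comp.
- by move=> z; exact: ca.
- by move=> z h hb; exact: Fa.
Qed.

Lemma wiener_norm c F z h : wiener rho c F -> box rho h -> `|F z h| <= c z.
Proof.
move=> [a [ma ca Fa]] hb; rewrite -lee_fin -abse_EFin Fa //.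
apply: le_trans (ca z).
apply: le_trans; first by apply: le_abse_integral => // ? ? ?.
apply: ge0_le_integral => // g _.
by rewrite abse_EFin lee_fin normrM ler_wpM2l // norm_mon.
Qed.

Lemma wiener_ge0 c F z : wiener rho c F -> 0 <= c z.
Proof.
move=> [a [ma ca Fa]]; rewrite -lee_fin; apply: le_trans (ca z).
by apply: integral_ge0 => g _; rewrite lee_fin mulr_ge0 // weight_ge0 // ltW.
Qed.

Lemma measurable_uncurry_index (a : MI -> Z -> R) :
  (forall g, measurable_fun setT (a g)) ->
  measurable_fun [set: (Z * MI)%type] (fun zg => a zg.2 zg.1).
Proof.
move=> ma; apply: (@measurable_comp _ _ _ _ _ _ setT
  (fun gz : MI * Z => a gz.1 gz.2) setT (fun zg : Z * MI => (zg.2, zg.1))) => //.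
  by apply: (@measurable_fun_countable_fst _ _ _ _ _ _ (@pickle MI) _ _ (pcan_inj (@pickleK MI))).
exact: measurable_swap.
Qed.

Lemma wiener_measurable c F h : wiener rho c F -> box rho h ->
  measurable_fun setT (F ^~ h).
Proof.
move=> [a [ma ca Fa]] hb.
rewrite (_ : F ^~ h = fun z => fine (\int[count]_g (a g z * mon h g)%:E)%E).
  have H : measurable_fun [set: (Z * MI)%type] (fun zg => (a zg.2 zg.1 * mon h zg.2)%:E).
    apply/measurable_EFinP.
    apply: (@measurable_uncurry_index (fun g z => a g z * mon h g)) => g.
    by apply: measurable_funM.
  exact: (measurable_fine_integral count H).
by apply/funext => z; rewrite -Fa.
Qed.

Lemma wiener_add c1 c2 F1 F2 : wiener rho c1 F1 -> wiener rho c2 F2 ->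
  wiener rho (fun z => c1 z + c2 z) (fun z h => F1 z h + F2 z h).
Proof.
move=> [a [ma ca Fa]] [b [mb cb Fb]].
exists (fun g z => a g z + b g z); split.
- by move=> g; apply: measurable_funD.
- move=> z; rewrite EFinD; apply: le_trans (leeD (ca z) (cb z)).
  rewrite -ge0_integralD //; try by move=> g _; rewrite lee_fin mulr_ge0 // weight_ge0 // ltW.
  apply: ge0_le_integral => //.
  + by move=> g _; rewrite lee_fin mulr_ge0 // weight_ge0 // ltW.
  + move=> g _; rewrite -EFinD lee_fin -mulrDl ler_wpM2r //.
        exact: weight_ge0 (ltW rho0).
    exact: ler_normD.
- move=> z h hb; rewrite EFinD Fa // Fb // -integralD //.
  + by apply: eq_integral => g _; rewrite -EFinD mulrDl.
  + exact: coefficient_integrable (ca z) hb.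
  + exact: coefficient_integrable (cb z) hb.
Qed.

Lemma wiener_scale (f : Z -> R) c F : measurable_fun setT f ->
  wiener rho c F ->
  wiener rho (fun z => `|f z| * c z) (fun z h => f z * F z h).
Proof.
move=> mf [a [ma ca Fa]]; exists (fun g z => f z * a g z); split.
- by move=> g; apply: measurable_funM.
- move=> z; rewrite EFinM; apply: le_trans (lee_wpmul2l _ (ca z)).
    rewrite -ge0_integralZl //.
    * by rewrite le_eqVlt; apply/orP; left; apply/eqP; apply: eq_integral => g _; rewrite -EFinM normrM mulrA.
    * by move=> g _; rewrite lee_fin mulr_ge0 // weight_ge0 // ltW.
  by rewrite lee_fin.
- move=> z h hb; rewrite EFinM Fa // -integralZl //.
    by apply: eq_integral => g _; rewrite -EFinM mulrA.
  exact: coefficient_integrable (ca z) hb.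
Qed.

(** The exponent may itself depend on the parameter. Once the parameter is extended by an index, a
    whole series becomes one family of monomials, ready for [wiener_integral]. *)
Lemma wiener_mon (b : Z -> R) (g : Z -> MI) :
  measurable_fun setT b -> measurable_fun setT g ->
  wiener rho (fun z => `|b z| * weight rho (g z))
    (fun z h => b z * mon h (g z)).
Proof.
move=> mb mg; exists (fun k z => b z * (k == g z)%:R); split.
- move=> k; apply: measurable_funM => //.
  rewrite (_ : (fun z => _) = \1_(g @^-1` [set k])); last first.
    apply/funext => z; rewrite indicE; congr (_%:R).
    case: eqP => [->|kg]; first by rewrite mem_set.
    by rewrite memNset // => /= gk; apply: kg.
  apply: measurable_indic; rewrite -[X in measurable X]setTI.
  exact: mg.
- move=> z.
  rewrite -[leRHS](@counting_point _ MI R (@multi_index_measurable m) count (@index_measure1 m R) _ (g z)).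
  apply: ge0_le_integral => //.
  + by move=> k _; rewrite lee_fin mulr_ge0 // weight_ge0 // ltW.
  + move=> k _; rewrite lee_fin normrM normr_nat.
    by case: eqP => [->|_]; rewrite ?mulr1 ?mulr0 ?mul0r.
- move=> z h hb.
  rewrite -[LHS](@counting_point _ MI R (@multi_index_measurable m) count (@index_measure1 m R) _ (g z)).
  apply: eq_integral => k _; congr EFin.
  by case: eqP => [->|_]; rewrite ?mulr1 ?mulr0 ?mul0r.
Qed.

End basics.

Section superposition.
Context d d' (Z : measurableType d) (S : measurableType d').
Variable mu : {sigma_finite_measure set S -> \bar R}.
Variable rho : R.
Hypothesis rho0 : 0 < rho.

(** Tonelli on indices times [S] bounds the norm and Fubini identifies the sum. With a set of
    indices for [S], the same statement yields products, infinite series, recentring and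
    substitutions. *)
Lemma wiener_integral (c : Z * S -> R) (C : Z -> R)
    (F : Z * S -> 'rV[R]_m -> R) (G : Z -> 'rV[R]_m -> R) :
  wiener rho c F ->
  (forall z, measurable_fun setT (fun s => c (z, s))) ->
  (forall z, (\int[mu]_s (c (z, s))%:E <= (C z)%:E)%E) ->
  (forall z h, box rho h -> ((G z h)%:E = \int[mu]_s (F (z, s) h)%:E)%E) ->
  wiener rho C G.
Proof.
move=> W mc cC GF; have [a [ma ca Fa]] := W.
have c0 z s : 0 <= c (z, s) by exact: (wiener_ge0 rho0 (z, s) W).
have mas g z : measurable_fun setT (fun s => a g (z, s)).
  by apply: measurableT_comp (ma g) _.
(* One term of the norm series is at most [c], so each coefficient is integrable in [s] by
   itself. *)
have wa g z s : `|a g (z, s)| * weight rho g <= c (z, s).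
  rewrite -lee_fin.
  have := @counting_ge0_fin _ MI R (@multi_index_measurable m) count (@index_measure1 m R)
    (fun g => `|a g (z, s)| * weight rho g) [:: g] (c (z, s))%:E _ isT (ca (z, s)).
  by rewrite big_seq1; apply => t; rewrite mulr_ge0 // weight_ge0 // ltW.
have ia g z : mu.-integrable setT (fun s => (a g (z, s))%:E).
  apply/integrableP; split; first exact/measurable_EFinP.
  apply: (@le_lt_trans _ _ (((weight rho g)^-1)%:E * (C z)%:E)%E); last first.
    by rewrite -EFinM ltry.
  apply: le_trans (lee_wpmul2l _ (cC z)); last first.
    by rewrite lee_fin invr_ge0 weight_ge0 // ltW.
  rewrite -ge0_integralZl //; last 3 first.
  - exact/measurable_EFinP.
  - by move=> s _; rewrite lee_fin.
  - by rewrite lee_fin invr_ge0 weight_ge0 // ltW.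
  apply: ge0_le_integral => //.
  - by apply: measurableT_comp => //; exact/measurable_EFinP.
  - by apply: emeasurable_funM => //; exact/measurable_EFinP.
  - move=> s _; rewrite -EFinM abse_EFin lee_fin mulrC ler_pdivlMr ?weight_gt0 //.
have mgs (k : MI -> R) z :
    measurable_fun setT (fun gs : MI * S => a gs.1 (z, gs.2) * k gs.1).
  apply: (@measurable_fun_countable_fst _ _ _ _ _ _ (@pickle MI) _ _ (pcan_inj (@pickleK MI))) => //.
  by move=> g /=; apply: measurable_funM.
have mgs' (k : MI -> R) z :
    measurable_fun setT (fun gs : MI * S => `|a gs.1 (z, gs.2)| * k gs.1).
  apply: (@measurable_fun_countable_fst _ _ _ _ _ _ (@pickle MI) _ _ (pcan_inj (@pickleK MI))) => //.
  by move=> g /=; apply: measurable_funM => //; apply: measurableT_comp.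
have norms z : (\int[count]_g \int[mu]_s (`|a g (z, s)| * weight rho g)%:E
    <= (C z)%:E)%E.
  rewrite (fubini_tonelli (fun gs : MI * S =>
    (`|a gs.1 (z, gs.2)| * weight rho gs.1)%:E)) /=; last 2 first.
  - exact/measurable_EFinP.
  - by move=> [g s]; rewrite lee_fin mulr_ge0 // weight_ge0 // ltW.
  apply: le_trans (cC z); apply: ge0_le_integral => //.
  - by move=> s _; apply: integral_ge0 => g _; rewrite lee_fin mulr_ge0 // weight_ge0 // ltW.
  - apply: (measurable_fun_fubini_tonelli_G (fun gs : MI * S =>
      (`|a gs.1 (z, gs.2)| * weight rho gs.1)%:E)).
      exact/measurable_EFinP.
    by move=> [g s]; rewrite lee_fin mulr_ge0 // weight_ge0 // ltW.
  - exact/measurable_EFinP.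
exists (fun g z => fine (\int[mu]_s (a g (z, s))%:E)%E); split.
- move=> g; apply: (@measurable_fine_integral _ _ _ _ _ mu (fun zs => (a g zs)%:E)).
  exact/measurable_EFinP.
- move=> z; apply: le_trans (norms z).
  apply: ge0_le_integral => //.
  + by move=> g _; rewrite lee_fin mulr_ge0 // weight_ge0 // ltW.
  + move=> g _; rewrite EFinM -abse_EFin fineK; last exact: integrable_fin_num (ia g z).
    apply: le_trans.
      apply: lee_wpmul2r; first by rewrite lee_fin weight_ge0 // ltW.
      by apply: le_abse_integral => //; exact/measurable_EFinP.
    rewrite -ge0_integralZr //; last 2 first.
      by apply: measurableT_comp => //; exact/measurable_EFinP.
      by rewrite lee_fin weight_ge0 // ltW.
- move=> z h hb; rewrite GF //.
  under eq_integral => s _ do rewrite Fa //.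
  rewrite -(Fubini (f := fun gs : MI * S => (a gs.1 (z, gs.2) * mon h gs.1)%:E)) /=.
    apply: eq_integral => g _; under eq_integral => s _ do rewrite EFinM.
    rewrite integralZr // EFinM fineK //; exact: integrable_fin_num (ia g z).
  apply/integrable12ltyP; first exact/measurable_EFinP.
  apply: le_lt_trans (ltry (C z)); apply: le_trans (norms z).
  apply: ge0_le_integral => //.
  + by move=> g _; apply: integral_ge0.
  + move=> g _; apply: ge0_le_integral => //.
    * apply: measurableT_comp => //=; apply/measurable_EFinP.
      by apply: measurable_funM.
    * by apply/measurable_EFinP; apply: measurable_funM => //; apply: measurableT_comp.
    * by move=> s _; rewrite abse_EFin lee_fin normrM ler_wpM2l // norm_mon.
Qed.

End superposition.

End wiener_def.

(** * Products, series, inverses and logarithms *)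

Section wiener_algebra.
Variables (R : realType) (m : nat) (rho : R).
Hypothesis rho0 : 0 < rho.
Local Notation MI := (multi_index m).
Local Notation count := (@index_measure m R).

Lemma geometric_sum (e : R) n : (\sum_(k < n) e ^+ k) * (1 - e) = 1 - e ^+ n.
Proof.
elim: n => [|n IH]; first by rewrite big_ord0 mul0r expr0 subrr.
by rewrite big_ord_recr /= mulrDl IH exprS; ring.
Qed.

(** Mean value theorem for the remainder [f], whose derivative is the remainder (-t)^n / (1 + t) of
    the geometric series. *)
Lemma ln1p_series (y : R) n : `|y| < 1 ->
  `|ln (1 + y) - \sum_(k < n) (- 1) ^+ k * y ^+ k.+1 / k.+1%:R| <=
     `|y| ^+ n.+1 / (1 - `|y|).
Proof.
move=> y1.
pose f := fun t : R => ln (1 + t) - \sum_(k < n) (- 1) ^+ k * t ^+ k.+1 / k.+1%:R.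
have df (t : R) : `|t| < 1 -> is_derive t 1 f ((- t) ^+ n / (1 + t)).
  move=> t1.
  have t10 : 0 < 1 + t by move: t1; rewrite ltr_norml => /andP[? ?]; lra.
  have dl : is_derive t 1 (fun u : R => ln (1 + u)) (1 + t)^-1.
    have := @is_derive1_comp R (@ln R) (fun u => 1 + u) t (1 + t)^-1 1
      (is_derive1_ln t10).
    rewrite mulr1; apply; rewrite -[X in is_derive _ _ _ X]add0r.
    exact: is_deriveD.
  have ds : is_derive t 1 (fun u : R => \sum_(k < n) (- 1) ^+ k * u ^+ k.+1 / k.+1%:R)
     (\sum_(k < n) (- t) ^+ k).
    pose g := fun (k : 'I_n) (u : R) => (- 1) ^+ k * u ^+ k.+1 / k.+1%:R.
    rewrite (_ : (fun u => _) = \sum_(k < n) g k); last first.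
      by apply/funext => u; rewrite fct_sumE.
    apply: is_derive_sum => k.
    have -> : g k = ((- 1) ^+ k / k.+1%:R) \*: (@idfun R ^+ k.+1).
      by apply/funext => u; rewrite /g /= exprfctE /GRing.scale /= mulrAC.
    apply: is_derive_eq.
    rewrite scalerA; change ((- 1) ^+ k / k.+1%:R * (k.+1%:R * t ^+ k) * 1 = (- t) ^+ k).
    have k0 : k.+1%:R != 0 :> R by rewrite pnatr_eq0.
    by rewrite mulr1 [RHS]exprNn mulrA divfK.
  apply: is_derive_eq.
  have t2 : 1 + t != 0 by rewrite gt_eqF.
  have := geometric_sum (- t) n; rewrite opprK => e.
  by apply: (mulIf t2); rewrite mulrBl mulVf // divfK // e; ring.
have f0 : f 0 = 0.
  by rewrite /f addr0 ln1 big1 ?subrr // => k _; rewrite expr0n /= mulr0 mul0r.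
have bnd (c : R) : `|c| <= `|y| -> `|(- c) ^+ n / (1 + c)| <= `|y| ^+ n / (1 - `|y|).
  move=> cy; rewrite normrM normrX normrN normrV ?unitfE; last first.
    rewrite gt_eqF //; have : `|c| < 1 by exact: le_lt_trans cy _.
    by rewrite ltr_norml => /andP[? ?]; lra.
  apply: ler_pM => //; first by rewrite lerXn2r // nnegrE.
  rewrite lef_pV2 ?posrE ?subr_gt0 //.
    have := ler_normB 1 (- c); rewrite opprK normrN normr1.
    have := lerB_normD 1 c; rewrite normr1; lra.
  have := lerB_normD 1 c; rewrite normr1; lra.
rewrite exprSr -mulrA (mulrC `|y|) mulrA -[X in `|X|]/(f y).
have [y0|y0|<-] := ltgtP 0 y; last by rewrite f0 normr0 mulr0.
- have [||c] := @MVT R f (fun t => (- t) ^+ n / (1 + t)) 0 y y0.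
  + move=> t; rewrite in_itv /= => /andP[t0 ty]; apply: df.
    by rewrite gtr0_norm // (lt_trans ty) // -(gtr0_norm y0).
  + apply: derivable_within_continuous => t; rewrite in_itv /= => /andP[t0 ty].
    have t1 : `|t| < 1 by rewrite ger0_norm // (le_lt_trans ty) // -(gtr0_norm y0).
    by case: (df t t1).
  + rewrite in_itv /= => /andP[c0 cy]; rewrite f0 !subr0 => ->.
    rewrite normrM; apply: ler_wpM2r => //; apply: bnd.
    by rewrite !gtr0_norm // ltW.
- have [||c] := @MVT R f (fun t => (- t) ^+ n / (1 + t)) y 0 y0.
  + move=> t; rewrite in_itv /= => /andP[ty t0]; apply: df.
    rewrite ltr0_norm //; rewrite ltr0_norm // in y1; apply: lt_trans y1.
    by rewrite ltrN2.
  + apply: derivable_within_continuous => t; rewrite in_itv /= => /andP[ty t0].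
    have t1 : `|t| < 1.
      rewrite ler0_norm //; rewrite ltr0_norm // in y1; apply: le_lt_trans y1.
      by rewrite lerN2.
    by case: (df t t1).
  + rewrite in_itv /= => /andP[yc c0]; rewrite f0 !sub0r => /eqP.
    rewrite eqr_oppLR => /eqP ->.
    rewrite normrN normrM normrN; apply: ler_wpM2r => //; apply: bnd.
    by rewrite !ltr0_norm // lerN2 ltW.
Qed.

Section algebra.
Context d (Z : measurableType d).
Implicit Types (c : Z -> R) (F : Z -> 'rV[R]_m -> R).

Definition index_add (g1 g2 : MI) : MI := [ffun i => (g1 i + g2 i)%N].

Lemma mon_add (h : 'rV[R]_m) g1 g2 : mon h (index_add g1 g2) = mon h g1 * mon h g2.
Proof.
by rewrite /mon -big_split /=; apply: eq_bigr => i _; rewrite ffunE exprD.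
Qed.

Lemma weight_add (r : R) g1 g2 :
  weight r (index_add g1 g2) = weight r g1 * weight r g2.
Proof.
by rewrite /weight -big_split /=; apply: eq_bigr => i _; rewrite ffunE exprD.
Qed.

(** The Cauchy product without rearrangement: the monomials a_g b_s h^(g+s) are integrated over [s]
    with (z, g) as parameter, and then over [g]. *)
Lemma wiener_mul c1 c2 F1 F2 : wiener rho c1 F1 -> wiener rho c2 F2 ->
  wiener rho (fun z => c1 z * c2 z) (fun z h => F1 z h * F2 z h).
Proof.
move=> W1 W2; have [a [ma ca Fa]] := W1; have [b [mb cb Fb]] := W2.
have c20 z : 0 <= c2 z by exact: wiener_ge0 W2.
have mua := measurable_uncurry_index ma.
have mub := measurable_uncurry_index mb.
have madd : measurable_fun [set: (MI * MI)%type] (fun g => index_add g.1 g.2).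
  by apply: (@measurable_fun_countable_fst _ _ _ _ _ _ (@pickle MI) _ _ (pcan_inj (@pickleK MI))).
have W : wiener rho (fun zg : Z * MI => `|a zg.2 zg.1| * weight rho zg.2 * c2 zg.1)
    (fun (zg : Z * MI) h => a zg.2 zg.1 * mon h zg.2 * F2 zg.1 h).
  apply: (@wiener_integral _ _ _ _ (Z * MI)%type MI count rho rho0
    (fun w => `|a w.1.2 w.1.1 * b w.2 w.1.1| * weight rho (index_add w.1.2 w.2))
    _ (fun w h => a w.1.2 w.1.1 * b w.2 w.1.1 * mon h (index_add w.1.2 w.2))).
  - apply: (@wiener_mon _ _ _ ((Z * MI) * MI)%type rho rho0
      (fun w => a w.1.2 w.1.1 * b w.2 w.1.1) (fun w => index_add w.1.2 w.2)).
      apply: measurable_funM.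
        by apply: (measurableT_comp mua).
      apply: (@measurable_comp _ _ _ _ _ _ setT (fun zg : Z * MI => b zg.2 zg.1) setT
        (fun w : (Z * MI) * MI => (w.1.1, w.2))) => //.
      by apply: measurable_fun_pair => //; apply: measurableT_comp.
    apply: (@measurable_comp _ _ _ _ _ _ setT (fun g : MI * MI => index_add g.1 g.2) setT
        (fun w : (Z * MI) * MI => (w.1.2, w.2))) => //.
    by apply: measurable_fun_pair => //; apply: measurableT_comp.
  - by move=> z ? ? ?.
  - move=> [z g] /=.
    have -> : (\int[count]_s (`|a g z * b s z| * weight rho (index_add g s))%:E =
        (`|a g z| * weight rho g)%:E * \int[count]_s (`|b s z| * weight rho s)%:E)%E.
      rewrite -ge0_integralZl //.
      + by apply: eq_integral => s _; rewrite -EFinM weight_add normrM; congr EFin; ring.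
      + by move=> s _; rewrite lee_fin mulr_ge0 // weight_ge0 // ltW.
      + by rewrite lee_fin mulr_ge0 // weight_ge0 // ltW.
    rewrite [X in (_ <= X)%E]EFinM; apply: lee_wpmul2l => //.
    by rewrite lee_fin mulr_ge0 // weight_ge0 // ltW.
  - move=> [z g] h hb /=; rewrite EFinM Fb // -integralZl //.
      by apply: eq_integral => s _; rewrite -EFinM mon_add; congr EFin; ring.
    exact: coefficient_integrable (cb z) hb.
apply: (@wiener_integral _ _ _ _ Z MI count rho rho0 _ _ _ _ W).
- by move=> z ? ? ?.
- move=> z /=; under eq_integral => g _ do rewrite EFinM.
  rewrite ge0_integralZr // ?EFinM ?lee_wpmul2r ?lee_fin //.
  by move=> g _; rewrite lee_fin mulr_ge0 // weight_ge0 // ltW.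
- move=> z h hb /=; rewrite EFinM Fa // -integralZr //.
  exact: coefficient_integrable (ca z) hb.
Qed.

Lemma wiener_cst (f : Z -> R) : measurable_fun setT f ->
  wiener rho (fun z => `|f z|) (fun z (h : 'rV[R]_m) => f z).
Proof.
move=> mf; pose g0 : MI := [ffun=> 0%N].
have m0 (h : 'rV[R]_m) : mon h g0 = 1 by rewrite /mon big1 // => i _; rewrite ffunE.
have w0 : weight rho g0 = 1 by rewrite /weight big1 // => i _; rewrite ffunE.
have := wiener_mon rho0 mf (@measurable_cst _ _ Z MI setT g0).
move=> H; apply: (wiener_ext (wiener_le H _)) => [z|z h hb]; first by rewrite w0 mulr1.
by rewrite m0 mulr1.
Qed.

Lemma wiener_sum (I : Type) (r : seq I) (P : pred I) (c : I -> Z -> R)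
    (F : I -> Z -> 'rV[R]_m -> R) : (forall i, P i -> wiener rho (c i) (F i)) ->
  wiener rho (fun z => \sum_(i <- r | P i) c i z)
    (fun z h => \sum_(i <- r | P i) F i z h).
Proof.
move=> W; elim: r => [|i r IH].
  have := wiener_cst (@measurable_cst _ _ Z R setT 0) => H.
  apply: (wiener_ext (wiener_le H _)) => [z|z h hb]; rewrite big_nil //.
  by rewrite /cst normr0.
have [Pi|nPi] := boolP (P i).
  apply: (wiener_ext (wiener_le (wiener_add rho0 (W i Pi) IH) _)) => [z|z h hb];
    by rewrite big_cons Pi.
by apply: (wiener_ext (wiener_le IH _)) => [z|z h hb]; rewrite big_cons (negbTE nPi).
Qed.

Lemma wiener_opp c F : wiener rho c F -> wiener rho c (fun z h => - F z h).
Proof.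
move=> W; have := wiener_scale rho0 (@measurable_cst _ _ Z R setT (-1)) W.
move=> H; apply: (wiener_ext (wiener_le H _)) => [z|z h hb] /=.
  by rewrite normrN normr1 mul1r.
by rewrite mulN1r.
Qed.

Lemma wiener_sub c1 c2 F1 F2 : wiener rho c1 F1 -> wiener rho c2 F2 ->
  wiener rho (fun z => c1 z + c2 z) (fun z h => F1 z h - F2 z h).
Proof. by move=> W1 /wiener_opp W2; exact: wiener_add. Qed.

Lemma wiener_exp c F n : wiener rho c F ->
  wiener rho (fun z => c z ^+ n) (fun z h => F z h ^+ n).
Proof.
move=> W; elim: n => [|n IH].
  apply: (wiener_le (wiener_cst (@measurable_cst _ _ Z R setT 1))) => z.
  by rewrite normr1 expr0.
apply: (wiener_ext (wiener_le (wiener_mul W IH) _)) => [z|z h hb]; by rewrite exprS.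
Qed.

(** Superposition over [nat] with counting measure; bounded partial sums of the norms give
    integrability, hence the limit along initial segments is the integral. *)
Lemma wiener_series (c : nat -> Z -> R) (C : Z -> R)
    (F : nat -> Z -> 'rV[R]_m -> R) (G : Z -> 'rV[R]_m -> R) :
  (forall k, wiener rho (c k) (F k)) ->
  (forall z n, \sum_(k < n) c k z <= C z) ->
  (forall z h, box rho h -> (fun n => \sum_(k < n) F k z h) @ \oo --> G z h) ->
  wiener rho C G.
Proof.
move=> W cC FG.
have c0 k z : 0 <= c k z by exact: wiener_ge0 (W k).
have mN (A : set nat) : measurable A by [].
have c1 x : ((nat_measure R) [set x] = 1)%E.
  exact: nat_measure1.
have us n : uniq (iota 0 n) by exact: iota_uniq.
have cs t : \forall n \near \oo, t \in iota 0 n.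
  by exists t.+1 => // n /= tn; rewrite mem_iota.
have ci z : (\int[(nat_measure R)]_k (c k z)%:E <= (C z)%:E)%E.
  apply: (counting_ge0_le mN c1 _ us cs) => // n.
  by rewrite -[iota 0 n](congr1 (iota 0) (subn0 n)) -/(index_iota 0 n) big_mkord.
have [a Ha] := choice W.
apply: (@wiener_integral _ _ _ _ Z nat (nat_measure R) rho rho0
   (fun w => c w.2 w.1) C (fun w h => F w.2 w.1 h)) => //.
- exists (fun g w => a w.2 g w.1); split.
  + move=> g; apply: (@measurable_comp _ _ _ _ _ _ setT
      (fun gz : nat * Z => a gz.1 g gz.2) setT (fun zg : Z * nat => (zg.2, zg.1))) => //.
      apply: (@measurable_fun_countable_fst _ _ _ _ _ _ id) => // k /=.
      by have [] := Ha k.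
    exact: measurable_swap.
  + by move=> [z k] /=; have [] := Ha k.
  + by move=> [z k] h hb /=; have [_ _] := Ha k; apply.
- move=> z h hb.
  have fi : (nat_measure R).-integrable setT (EFin \o (fun k => F k z h)).
    apply/integrableP; split=> //.
    apply: le_lt_trans (ltry (C z)); apply: le_trans (ci z).
    apply: ge0_le_integral => //; move=> k _; rewrite ?lee_fin //.
    by apply: wiener_norm (W k) hb.
  have H := counting_exhaust mN c1 us cs fi.
  rewrite -[RHS]fineK; last exact: integrable_fin_num fi.
  congr EFin; apply: (cvg_unique _ (FG z h hb)) => //.
  apply: cvg_trans H; apply: near_eq_cvg; apply: nearW => n /=.
  by rewrite -[iota 0 n](congr1 (iota 0) (subn0 n)) -/(index_iota 0 n) big_mkord.
Qed.

Lemma wiener_inv (e : R) F : e < 1 -> wiener rho (cst e) F ->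
  wiener rho (cst (1 - e)^-1) (fun z h => (1 + F z h)^-1).
Proof.
move=> e1 W.
apply: (@wiener_series (fun k _ => e ^+ k) _ (fun k z h => (- F z h) ^+ k)).
- by move=> k; apply: wiener_exp; exact: wiener_opp.
- move=> z n /=; have e0 : 0 <= e by exact: (wiener_ge0 rho0 z W).
  rewrite -[leRHS]mul1r ler_pdivlMr ?subr_gt0 //.
  by rewrite geometric_sum gerBl exprn_ge0.
- move=> z h hb.
  have Fe : `|- F z h| < 1.
    by rewrite normrN; apply: le_lt_trans e1; exact: wiener_norm W hb.
  have := @cvg_geometric_series R 1 (- F z h) Fe.
  rewrite mul1r opprK; apply: cvg_trans; apply: near_eq_cvg; apply: nearW => n.
  rewrite /series /geometric /= big_mkord; apply: eq_bigr => k _.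
  by rewrite mul1r.
Qed.

Lemma wiener_ln (e : R) F : e < 1 -> wiener rho (cst e) F ->
  wiener rho (cst (e / (1 - e))) (fun z h => ln (1 + F z h)).
Proof.
move=> e1 W.
apply: (@wiener_series (fun k _ => e ^+ k.+1) _
  (fun k z h => (- 1) ^+ k * F z h ^+ k.+1 / k.+1%:R)).
- move=> k; have W1 := wiener_exp k.+1 W.
  have := wiener_scale rho0 (@measurable_cst _ _ Z R setT ((-1) ^+ k / k.+1%:R)) W1.
  move=> H; apply: (wiener_ext (wiener_le H _)) => [z|z h hb] /=; last by rewrite mulrAC.
  rewrite normrM normrX normrN normr1 expr1n mul1r normfV normr_nat.
  have e0 : 0 <= e by exact: (wiener_ge0 rho0 z W).
  rewrite ler_piMl ?exprn_ge0 // invf_le1 ?ltr0n // ler1n //.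
- move=> z n /=; have e0 : 0 <= e by exact: (wiener_ge0 rho0 z W).
  rewrite ler_pdivlMr ?subr_gt0 //.
  under eq_bigr => k _ do rewrite exprS.
  by rewrite -mulr_sumr -mulrA geometric_sum ler_piMr // gerBl exprn_ge0.
- move=> z h hb.
  have Fe : `|F z h| < 1 by apply: le_lt_trans e1; exact: wiener_norm W hb.
  have C0 : (fun n => `|F z h| ^+ n.+1 / (1 - `|F z h|)) @ \oo --> (0 : R).
    rewrite -(mul0r (1 - `|F z h|)^-1); apply: cvgMr_tmp.
    by rewrite (cvg_shiftS (fun n => `|F z h| ^+ n)); apply: cvg_expr; rewrite normr_id.
  apply/subr_cvg0.
  apply: (@squeeze_cvgr _ _ _ _ (fun n => - (`|F z h| ^+ n.+1 / (1 - `|F z h|)))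
     (fun n => `|F z h| ^+ n.+1 / (1 - `|F z h|))).
  + by apply: nearW => n; rewrite -ler_norml distrC; exact: ln1p_series.
  + by rewrite -[X in _ --> X]oppr0; apply: cvgN.
  + by [].
Qed.

End algebra.
End wiener_algebra.

Section wiener_more.
Variables (R : realType) (m : nat) (rho : R).
Hypothesis rho0 : 0 < rho.
Local Notation MI := (multi_index m).
Local Notation count := (@index_measure m R).

Section param.
Context d (Z : measurableType d).
Implicit Types (c : Z -> R) (F : Z -> 'rV[R]_m -> R).

Lemma box_le (r : R) (h : 'rV[R]_m) : r <= rho -> box r h -> box rho h.
Proof. by move=> rr hb i; apply: le_trans (hb i) rr. Qed.

Lemma mon0 (g : MI) : mon (0 : 'rV[R]_m) g = (g == [ffun=> 0%N])%:R.
Proof.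
case: eqP => [->|gN]; first by rewrite /mon big1 // => i _; rewrite ffunE.
have [i gi] : exists i, g i != 0%N.
  apply: contrapT => /forallNP H; apply: gN; apply/ffunP => i; rewrite ffunE.
  by apply/eqP; move/negP: (H i); rewrite negbK.
by rewrite /mon (bigD1 i) //= mxE expr0n (negbTE gi) mul0r.
Qed.

Lemma weight_shrink (r : R) (g : MI) : 0 < r <= rho -> g != [ffun=> 0%N] ->
  weight r g <= r / rho * weight rho g.
Proof.
move=> /andP[r0 rr] gN.
have [i gi] : exists i, g i != 0%N.
  apply: contrapT => /forallNP H; move/eqP: gN; apply; apply/ffunP => i.
  by rewrite ffunE; apply/eqP; move/negP: (H i); rewrite negbK.
have E (x : R) : weight x g = x ^+ g i * \prod_(j < m | j != i) x ^+ g j.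
  by rewrite /weight (bigD1 i).
rewrite !E mulrA.
apply: ler_pM.
- by rewrite exprn_ge0 // ltW.
- by apply: prodr_ge0 => j _; rewrite exprn_ge0 // ltW.
- case: (g i) gi => [//|n] _; rewrite !exprS mulrA divfK ?gt_eqF //.
  apply: ler_wpM2l; first exact: ltW.
  by apply: lerXn2r => //; rewrite nnegrE ltW.
- apply: ler_prod => j _; rewrite exprn_ge0 /=; last exact: ltW.
  by apply: lerXn2r; rewrite ?nnegrE // ltW.
Qed.

(** Every nonconstant monomial gains at least one factor r / rho on the smaller box. This is the
    source of all smallness of relative errors. *)
Lemma wiener_shrink r c F : 0 < r <= rho -> wiener rho c F ->
  wiener r (fun z => r / rho * c z) (fun z h => F z h - F z 0).
Proof.
move=> rr; have /andP[r0 rrho] := rr; move=> [a [ma ca Fa]].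
pose g0 : MI := [ffun=> 0%N].
exists (fun g z => a g z * (g != g0)%:R); split.
- by move=> g; apply: measurable_funM.
- move=> z; rewrite EFinM; apply: le_trans (lee_wpmul2l _ (ca z)); last first.
    by rewrite lee_fin divr_ge0 // ltW.
  rewrite -ge0_integralZl //.
  + apply: ge0_le_integral => //.
    * by move=> g _; rewrite lee_fin mulr_ge0 // weight_ge0 // ltW.
    * move=> g _; rewrite -EFinM lee_fin normrM normr_nat.
      have [->|gN] := eqVneq g g0.
        by rewrite mulr0 mul0r !mulr_ge0 ?invr_ge0 ?weight_ge0 // ltW.
      by rewrite mulr1 mulrCA ler_wpM2l // weight_shrink.
  + by move=> g _; rewrite lee_fin mulr_ge0 // weight_ge0 // ltW.
  + by rewrite lee_fin divr_ge0 // ltW.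
- move=> z h hb; have hb' := box_le rrho hb.
  have b0 : box rho (0 : 'rV[R]_m) by move=> i; rewrite mxE normr0 ltW.
  have F0 : F z 0 = a g0 z.
    apply: EFin_inj; rewrite Fa //.
    rewrite -[RHS](@counting_point _ MI R (@multi_index_measurable m) count (@index_measure1 m R) _ g0).
    apply: eq_integral => g _; rewrite mon0; congr EFin.
    by case: eqP => [->|]; rewrite ?mulr0.
  have m0 : mon h g0 = 1 by rewrite /mon big1 // => i _; rewrite ffunE.
  rewrite EFinB F0 Fa //.
  rewrite -[X in (_ - X)%E](@counting_point _ MI R (@multi_index_measurable m) count
    (@index_measure1 m R) _ g0).
  rewrite -integralB //.
  + apply: eq_integral => g _; rewrite -EFinB; congr EFin.
    by have [->|gN] := eqVneq g g0; rewrite /= ?m0 ?mulr1 ?mulr0 ?mul0r ?subrr ?subr0.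
  + exact: coefficient_integrable (ca z) hb'.
  + exact: (integrable_point (@multi_index_measurable m) (@index_measure1 m R)).
Qed.

Lemma wiener_coord (i : 'I_m) : wiener rho (fun _ : Z => rho) (fun _ h => h 0 i).
Proof.
pose g : MI := [ffun j => (j == i : nat)].
have mg h : mon h g = h 0 i :> R.
  rewrite /mon (bigD1 i) //= ffunE eqxx expr1 big1 ?mulr1 // => j ji.
  by rewrite ffunE (negbTE ji) expr0.
have wg : weight rho g = rho.
  rewrite /weight (bigD1 i) //= ffunE eqxx expr1 big1 ?mulr1 // => j ji.
  by rewrite ffunE (negbTE ji) expr0.
have H := wiener_mon rho0 (@measurable_cst _ _ Z R setT 1) (@measurable_cst _ _ Z MI setT g).
apply: (wiener_ext (wiener_le H _)) => [z|z h hb] /=.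
  by rewrite normr1 mul1r wg.
by rewrite mul1r mg.
Qed.

Lemma wiener_prod (I : Type) (r : seq I) (c : I -> Z -> R)
    (F : I -> Z -> 'rV[R]_m -> R) : (forall i, wiener rho (c i) (F i)) ->
  wiener rho (fun z => \prod_(i <- r) c i z)
    (fun z h => \prod_(i <- r) F i z h).
Proof.
move=> W; elim: r => [|i r IH].
  have H := wiener_cst m rho0 (@measurable_cst _ _ Z R setT 1).
  apply: (wiener_ext (wiener_le H _)) => [z|z h hb]; rewrite big_nil //.
  by rewrite /cst normr1.
by apply: (wiener_ext (wiener_le (wiener_mul rho0 (W i) IH) _)) => [z|z h hb];
  rewrite big_cons.
Qed.

(** Turns a countable family into one function on a product, the form that [wiener_integral]
    accepts. *)
Lemma wiener_glue d' (T : measurableType d') (k : T -> nat)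
    (c : T -> Z -> R) (F : T -> Z -> 'rV[R]_m -> R) :
  (forall A : set T, measurable A) -> injective k ->
  (forall t, wiener rho (c t) (F t)) ->
  wiener rho (fun w : Z * T => c w.2 w.1) (fun w h => F w.2 w.1 h).
Proof.
move=> mT ki W; have [a Ha] := choice W.
exists (fun g w => a w.2 g w.1); split.
- move=> g; apply: (@measurable_comp _ _ _ _ _ _ setT
    (fun gz : T * Z => a gz.1 g gz.2) setT (fun zg : Z * T => (zg.2, zg.1))) => //.
    apply: (@measurable_fun_countable_fst _ _ _ _ _ _ k) => // t /=.
    by have [] := Ha t.
  exact: measurable_swap.
- by move=> [z t] /=; have [] := Ha t.
- by move=> [z t] h hb /=; have [_ _] := Ha t; apply.
Qed.

End param.
End wiener_more.

(** * Recentring and substitution of coordinates *)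

Section recenter.
Variables (R : realType) (m : nat).
Local Notation MI := (multi_index m).
Local Notation count := (@index_measure m R).
Context d (Z : measurableType d).

(** As a function of k on the box of radius r, the monomial (h0 + k)^g has norm at most the product
    of the (|h0_i| + r)^(g_i), hence at most its weight for rho; superposition over [g]
    concludes. *)
Lemma wiener_recenter (rho r : R) (c : Z -> R) (F : Z -> 'rV[R]_m -> R)
    (h0 : 'rV[R]_m) :
  0 < rho -> 0 < r -> (forall i, `|h0 0 i| + r <= rho) ->
  wiener rho c F -> wiener r c (fun z k => F z (h0 + k)).
Proof.
move=> rho0 r0 hr W; have [a [ma ca Fa]] := W.
have W1 (g : MI) : wiener r (fun _ : Z => weight rho g) (fun _ k => mon (h0 + k) g).
  have H i := wiener_exp r0 (g i) (wiener_add r0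
    (wiener_cst m r0 (@measurable_cst _ _ Z R setT (h0 0 i))) (wiener_coord r0 Z i)).
  apply: (wiener_ext (wiener_le (wiener_prod r0 (index_enum 'I_m) H) _)) => [z|z k kb].
    have ge0 i : 0 <= `|h0 0 i| + r by rewrite addr_ge0 // ltW.
    apply: ler_prod => i _; rewrite exprn_ge0 //=.
    by apply: lerXn2r; rewrite ?nnegrE // ltW.
  by rewrite /mon; apply: eq_bigr => i _; rewrite mxE.
have W2 := wiener_glue (@multi_index_measurable m) (pcan_inj (@pickleK MI)) W1.
have W3 := wiener_scale r0 (measurable_uncurry_index ma) W2.
apply: (@wiener_integral _ _ _ _ Z MI count r r0 _ _ _ _ W3) => //.
by move=> z k kb /=; apply: Fa => i; rewrite mxE (le_trans (ler_normD _ _)) //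
  (le_trans _ (hr i)) // lerD2l.
Qed.

(** [push] collects the exponents of the variables that [s] identifies, which leaves weights
    unchanged. This lets functions of one of the two parameters be viewed as functions of both. *)
Lemma wiener_subvars (m' : nat) (s : 'I_m -> 'I_m') (rho : R) (c : Z -> R)
    (F : Z -> 'rV[R]_m -> R) : 0 < rho -> wiener rho c F ->
  wiener rho c (fun z (h : 'rV[R]_m') => F z (\row_i h 0 (s i))).
Proof.
move=> rho0 W; have [a [ma ca Fa]] := W.
pose push (g : MI) : multi_index m' := [ffun j => \sum_(i | s i == j) g i]%N.
have E (f : 'I_m' -> R) (g : MI) : \prod_j f j ^+ push g j = \prod_i f (s i) ^+ g i.
  rewrite [RHS](partition_big s predT) //=; apply: eq_bigr => j _.
  by rewrite ffunE -prodrXr; apply: eq_bigr => i /eqP <-.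
have mp : measurable_fun [set: (Z * MI)%type] (fun w => push w.2).
  by apply: (@measurable_comp _ _ _ _ _ _ setT push setT snd).
have H := wiener_mon rho0 (measurable_uncurry_index ma) mp.
apply: (@wiener_integral _ _ _ _ Z MI count rho rho0 _ _ _ _ H) => //.
- move=> z; apply: le_trans (ca z) => /=.
  by under eq_integral => g _ do rewrite /weight (E (fun=> rho)).
- move=> z h hb /=; rewrite Fa; last by move=> i; rewrite mxE; exact: hb.
  apply: eq_integral => g _; rewrite /mon E; congr (_ * _)%:E.
  by apply: eq_bigr => i _; rewrite mxE.
Qed.

End recenter.

(** * Analyticity at a point and Wiener series *)

Section analytic.
Variables (R : realType) (m : nat).
Local Notation MI := (multi_index m).
Local Notation count := (@index_measure m R).

Definition box_seq (N : nat) : seq MI :=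
  [seq [ffun i => nat_of_ord (al i)] |
    al : {ffun 'I_m -> 'I_N} <- enum {ffun 'I_m -> 'I_N}].

Lemma box_seq_uniq N : uniq (box_seq N).
Proof.
rewrite map_inj_uniq ?enum_uniq // => x y /ffunP e.
by apply/ffunP => i; have := e i; rewrite !ffunE => /val_inj.
Qed.

Lemma box_seq_cover (g : MI) : \forall N \near \oo, g \in box_seq N.
Proof.
exists (\max_i g i).+1 => // N /= gN.
have gi i : (g i < N)%N.
  by apply: leq_ltn_trans gN; exact: leq_bigmax.
apply/mapP; exists [ffun i => Ordinal (gi i)]; first by rewrite mem_enum.
by apply/ffunP => i; rewrite !ffunE.
Qed.

Lemma power_term_sum (K : numFieldType) (a : MI -> K) (h : 'rV[K]_m) (G : K -> K) N :
  \sum_(al : {ffun 'I_m -> 'I_N}) G (power_term a h al) =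
  \sum_(g <- box_seq N) G (a g * \prod_i h 0 i ^+ g i).
Proof.
rewrite big_map big_enum /=; apply: eq_bigr => al _; rewrite /power_term.
congr (G (_ * _)); apply: eq_bigr => i _; by rewrite ffunE.
Qed.

Lemma near_box (x0 : 'rV[R]_m) (r : R) : 0 < r ->
  \forall x \near x0, box r (x - x0).
Proof.
move=> r0; apply/nbhs_ballP; exists r => //= x xb i.
have [_ xb'] := xb; have := xb' 0 i; rewrite /ball /= => /ltW.
by rewrite distrC !mxE.
Qed.

Lemma wiener_analytic_at (r C : R) (f : 'rV[R]_m -> R) (x0 : 'rV[R]_m) :
  0 < r -> wiener r (fun _ : unit => C) (fun _ h => f (x0 + h)) ->
  analytic_at f x0.
Proof.
move=> r0 [a [ma ca Fa]]; exists (fun g => a g tt).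
near=> x; have hb : box r (x - x0) by near: x; exact: near_box.
have fi : count.-integrable setT (EFin \o (fun g => a g tt * mon (x - x0) g)).
  exact: (coefficient_integrable (ca tt) hb).
split.
- apply/cvg_ex; eexists.
  have := counting_exhaust (@multi_index_measurable m) (@index_measure1 m R)
    box_seq_uniq box_seq_cover (integrable_abse fi).
  move=> H; apply: cvg_trans H; apply: near_eq_cvg; apply: nearW => N.
  by rewrite (power_term_sum _ _ Num.norm).
- have := counting_exhaust (@multi_index_measurable m) (@index_measure1 m R)
    box_seq_uniq box_seq_cover fi.
  have E := Fa tt _ hb; rewrite addrC subrK in E; rewrite -E => H.
  apply: cvg_trans H; apply: near_eq_cvg; apply: nearW => N.
  by rewrite (power_term_sum _ _ id).
Unshelve. all: by end_near. Qed.

Lemma analytic_at_wiener (f : 'rV[R]_m -> R) (x0 : 'rV[R]_m) :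
  analytic_at f x0 -> exists r C : R, 0 < r /\
    wiener r (fun _ : unit => C) (fun _ h => f (x0 + h)).
Proof.
move=> [a /nbhs_ballP[e /= e0 H]].
pose r := e / 2; have r0 : 0 < r by rewrite divr_gt0.
have inb h : box r h -> ball x0 e (x0 + h).
  move=> hb; split=> // i j; rewrite (ord1 i) /ball /= !mxE opprD addrA subrr sub0r normrN.
  by apply: le_lt_trans (hb j) _; rewrite /r ltr_pdivrMr // ltr_pMr // ltr1n.
(* At this corner of the box the monomials equal their weights, so absolute convergence at this one
   point bounds the whole norm. *)
have rb : box r (const_mx r : 'rV[R]_m) by move=> i; rewrite mxE ger0_norm // ltW.
have [cv _] := H _ (inb _ rb).
have addK h : x0 + h - x0 = h by rewrite addrC addKr.
rewrite addK in cv.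
have [M HM] : exists M, forall N, \sum_(g <- box_seq N) `|a g| * weight r g <= M.
  have [M [_ HM]] := cvg_seq_bounded cv.
  exists (M + 1) => N.
  have M1 : M < M + 1 by rewrite ltrDl.
  have := HM (M + 1) M1 N I => /=.
  rewrite (power_term_sum _ _ Num.norm) ger0_norm; last by apply: sumr_ge0.
  apply: le_trans; apply: ler_sum => g _; rewrite normrM ler_wpM2l //.
  apply: le_trans (ler_norm _); rewrite /weight le_eqVlt; apply/orP; left; apply/eqP.
  by apply: eq_bigr => i _; rewrite mxE.
have ca : (\int[count]_g (`|a g| * weight r g)%:E <= M%:E)%E.
  apply: (counting_ge0_le (@multi_index_measurable m) (@index_measure1 m R) _
    box_seq_uniq box_seq_cover) => // g.
  by rewrite mulr_ge0 // weight_ge0 // ltW.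
exists r, M; split => //; exists (fun g _ => a g); split => // _ h hb.
have fi : count.-integrable setT (EFin \o (fun g => a g * mon h g)).
  exact: (coefficient_integrable ca hb).
have C1 := counting_exhaust (@multi_index_measurable m) (@index_measure1 m R)
  box_seq_uniq box_seq_cover fi.
have [_] := H _ (inb _ hb); rewrite addK => C2.
rewrite -[RHS]fineK; last exact: integrable_fin_num fi.
congr EFin; apply: (cvg_unique _ C2) => //.
apply: cvg_trans C1; apply: near_eq_cvg; apply: nearW => N /=.
by rewrite (power_term_sum _ _ id).
Qed.

End analytic.

Import ComplexField.Normc.

(** * Complex modulus, averages over roots of unity and Cauchy's estimates *)

Section complex_norm.
Variable R : realType.
Local Notation C := R[i].
Implicit Types x y : C.

Lemma ncD x y : normc (x + y) <= normc x + normc y.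
Proof. exact: (@le_normcD R x y). Qed.

Lemma ncN x : normc (- x) = normc x.
Proof. exact: (@normcN R x). Qed.

Lemma ncB x y : normc (x - y) <= normc x + normc y.
Proof. by rewrite (le_trans (ncD _ _)) // ncN. Qed.

Lemma nc_ge0 x : 0 <= normc x.
Proof. by case: x => a b /=; exact: sqrtr_ge0. Qed.

Lemma ncX x n : normc (x ^+ n) = normc x ^+ n.
Proof.
elim: n => [|n IH]; first by rewrite !expr0 normc1.
by rewrite !exprS normcM IH.
Qed.

Lemma nc_sum (I : Type) (r : seq I) (P : pred I) (F : I -> C) :
  normc (\sum_(i <- r | P i) F i) <= \sum_(i <- r | P i) normc (F i).
Proof.
elim/big_ind2: _ => [|x1 x2 y1 y2 h1 h2|i _] //; first by rewrite normc0.
by rewrite (le_trans (ncD _ _)) // lerD.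
Qed.

Lemma nc_real (a : R) : normc (real_complex R a) = `|a|.
Proof. by rewrite /normc /= expr0n /= addr0 sqrtr_sqr. Qed.

Lemma nc_nat n : normc (n%:R : C) = n%:R.
Proof.
have -> : (n%:R : C) = real_complex R n%:R by rewrite rmorph_nat.
by rewrite nc_real normr_nat.
Qed.

Lemma nc_Re x : `|complex.Re x| <= normc x.
Proof.
case: x => a b /=; rewrite -sqrtr_sqr ler_sqrt ?addr_ge0 ?sqr_ge0 //.
by rewrite lerDl sqr_ge0.
Qed.

Lemma nc_Im x : `|complex.Im x| <= normc x.
Proof.
case: x => a b /=; rewrite -sqrtr_sqr ler_sqrt ?addr_ge0 ?sqr_ge0 //.
by rewrite lerDr sqr_ge0.
Qed.

Lemma nc_le_ReIm (a b : R) : normc (Complex a b) <= `|a| + `|b|.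
Proof.
rewrite /= -[leRHS]ger0_norm ?addr_ge0 // -sqrtr_sqr ler_wsqrtr //.
by rewrite sqrrD !real_normK ?num_real // lerD2r lerDl mulrn_wge0 // mulr_ge0.
Qed.

End complex_norm.

Section circle_average.
Variable R : realType.
Local Notation C := R[i].

(** X^n - 1 splits and is separable in characteristic 0, so it has n distinct roots, among them a
    primitive one. *)
Lemma prim_root_exists n : (0 < n)%N -> exists z : C, n.-primitive_root z.
Proof.
move=> n0; pose p : {poly C} := 'X^n - 1; have [r Dp] := closed_field_poly_normal p.
rewrite (monicP _) ?monicXnsubC // scale1r in Dp.
have rn1 : all n.-unity_root r by apply/allP => z; rewrite -root_prod_XsubC -Dp.
have sz_r : (n < (size r).+1)%N.
  by rewrite -(size_prod_XsubC r id) -Dp size_XnsubC.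
have [|z] := hasP (cyclic.has_prim_root n0 rn1 _ sz_r); last by exists z.
by rewrite -separable.separable_prod_XsubC -Dp cyclotomic.separable_Xn_sub_1 // pnatr_eq0 -lt0n.
Qed.

Definition unity (n : nat) : C := projT1 (cid (prim_root_exists (ltn0Sn n))).

Lemma unityP n : n.+1.-primitive_root (unity n).
Proof. by rewrite /unity; case: cid. Qed.

Lemma nc_unity n : normc (unity n) = 1.
Proof.
have := congr1 (@normc R) (prim_expr_order (unityP n)).
rewrite ncX normc1 => /eqP; rewrite pexpr_eq1 ?nc_ge0 //.
by move/eqP.
Qed.

Lemma unity_neq0 n : unity n != 0.
Proof.
apply/eqP => h; have := nc_unity n; rewrite h normc0 => /eqP.
by rewrite eq_sym oner_eq0.
Qed.

Lemma unity_sum n (k l : nat) : (k <= n)%N -> (l <= n)%N ->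
  \sum_(j < n.+1) unity n ^+ (j * k) / unity n ^+ (j * l) = (n.+1%:R) *+ (k == l).
Proof.
move=> kn ln; have u0 := unity_neq0 n.
pose q := unity n ^+ k / unity n ^+ l.
have -> : \sum_(j < n.+1) unity n ^+ (j * k) / unity n ^+ (j * l) = \sum_(j < n.+1) q ^+ j.
  by apply: eq_bigr => j _; rewrite /q expr_div_n -!exprM !(mulnC _ j).
have [e|kl] := eqVneq k l.
  have -> : q = 1 by rewrite /q e divff // expf_neq0.
  under eq_bigr => j _ do rewrite expr1n.
  by rewrite sumr_const card_ord mulr1n.
have q1 : q != 1.
  apply: contra kl => /eqP q1; have : unity n ^+ k = unity n ^+ l.
    by apply: (divIf (expf_neq0 l u0)); rewrite -/q q1 divff // expf_neq0.
  move/eqP; rewrite (eq_prim_root_expr (unityP n)) => /eqP.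
  by rewrite !modn_small ?ltnS // => ->.
have qn : q ^+ n.+1 = 1.
  rewrite /q expr_div_n -!exprM mulnC exprM (prim_expr_order (unityP n)) expr1n.
  by rewrite mulnC exprM (prim_expr_order (unityP n)) expr1n divr1.
have := subrX1 q n.+1; rewrite qn subrr mulr0n => /esym/eqP.
by rewrite mulf_eq0 subr_eq0 (negbTE q1) /= => /eqP.
Qed.

(** A discrete Cauchy integral over the circle through [s], normalised so as to return the term of
    degree [k] at [s] rather than the coefficient; it is exact on polynomials of degree at most [n]
    when k <= n. *)
Definition circle_average (n k : nat) (g : C -> C) (s : C) : C :=
  n.+1%:R^-1 * \sum_(j < n.+1) g (s * unity n ^+ j) / unity n ^+ (j * k).

Lemma circle_average_poly n k (p : {poly C}) s :
  (size p <= n.+1)%N -> (k <= n)%N ->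
  circle_average n k (horner p) s = p`_k * s ^+ k.
Proof.
move=> pn kn; rewrite /circle_average.
have E j : p.[s * unity n ^+ j] / unity n ^+ (j * k) =
    \sum_(i < n.+1) p`_i * s ^+ i * (unity n ^+ (j * i) / unity n ^+ (j * k)).
  rewrite (horner_coef_wide _ pn) mulr_suml; apply: eq_bigr => i _.
  by rewrite exprMn -exprM -!mulrA.
under eq_bigr => j _ do rewrite E.
rewrite exchange_big /=.
under eq_bigr => i _ do rewrite -mulr_sumr (unity_sum (leq_ord i) kn).
have n0 : (n.+1%:R : C) != 0 by rewrite pnatr_eq0.
have kn' : (k < n.+1)%N by rewrite ltnS.
rewrite (bigD1 (Ordinal kn')) //= eqxx mulr1n big1 ?addr0.
  by rewrite mulrC mulfK.
move=> i ik; rewrite (_ : (i == k :> nat) = false) ?mulr0n ?mulr0 //.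
by apply/negbTE; apply: contra ik => /eqP ik; apply/eqP/val_inj.
Qed.

Lemma circle_average_bound n k (g : C -> C) s (M : R) :
  (forall t, normc t = normc s -> normc (g t) <= M) ->
  normc (circle_average n k g s) <= M.
Proof.
move=> gM; rewrite /circle_average normcM normcV nc_nat.
rewrite mulrC ler_pdivrMr ?ltr0n // (le_trans (nc_sum _ _ _)) //.
rewrite (le_trans (ler_sum _ (G := fun=> M) _)) //.
  move=> j _; rewrite normcM normcV ncX nc_unity expr1n invr1 mulr1.
  by apply: gM; rewrite normcM ncX nc_unity expr1n mulr1.
by rewrite sumr_const card_ord mulr_natr.
Qed.

Lemma circle_averageB n k (f g : C -> C) s :
  circle_average n k (fun t => f t - g t) s =
  circle_average n k f s - circle_average n k g s.
Proof.
rewrite /circle_average -mulrBr -sumrB; congr (_ * _); apply: eq_bigr => j _.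
by rewrite mulrBl.
Qed.

Lemma poly_cauchy (p : {poly C}) (s M : R) k : 0 <= s ->
  (forall t, normc t = s -> normc p.[t] <= M) -> normc p`_k * s ^+ k <= M.
Proof.
move=> s0 pM; pose n := maxn (size p) k.
have pn : (size p <= n.+1)%N by rewrite (leq_trans (leq_maxl _ k)).
have kn : (k <= n)%N by exact: leq_maxr.
have := @circle_average_bound n k (horner p) (real_complex R s) M.
rewrite circle_average_poly // normcM ncX nc_real ger0_norm //.
by apply.
Qed.

(** An identity principle with [eps] independent of the polynomial. Coefficients of index below [n1]
    obey Cauchy's estimate on the radius sigma / 2, all of them obey the one on 3/4 eta; comparing
    the latter with eta / 2 gives the ratio q = 2/3. *)
Lemma poly_small (eta sigma M e : R) : 0 < sigma -> 0 < eta -> 0 <= M -> 0 < e ->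
  exists eps : R, 0 < eps /\ forall p : {poly C},
    (forall t, normc t < eta -> normc p.[t] <= M) ->
    (forall t, normc t < sigma -> normc p.[t] <= eps) ->
    forall t, normc t <= eta / 2 -> normc p.[t] <= e.
Proof.
move=> s0 eta0 M0 e0.
pose q : R := 2 / 3.
have q01 : 0 <= q < 1 by apply/andP; split; rewrite /q; lra.
have /andP[q0 q1] := q01.
(* The factor 3 is 1 / (1 - q), the sum of the geometric series. *)
have [n1 Hn1] : exists n1, M * 3 * q ^+ n1 <= e / 2.
  have : (fun n => M * 3 * q ^+ n) @ \oo --> (M * 3 * 0).
    by apply: cvgMl_tmp; apply: cvg_expr; rewrite ger0_norm.
  rewrite mulr0 => /cvgrPdist_le /(_ (e / 2)) []; first by lra.
  move=> n _ /(_ n (leqnn n)); rewrite sub0r normrN ger0_norm; first by exists n.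
  by rewrite !mulr_ge0 // exprn_ge0.
pose Q : R := eta / sigma.
have Q0 : 0 <= Q by rewrite divr_ge0 // ltW.
pose B : R := \sum_(k < n1) Q ^+ k.
have B0 : 0 <= B by apply: sumr_ge0 => k _; exact: exprn_ge0.
exists (e / (2 * (B + 1))); split; first by rewrite divr_gt0 // mulr_gt0 // ltr_wpDl.
move=> p pM pe t te.
have c1 k : normc p`_k * (eta / 2) ^+ k <= M * q ^+ k.
  have h : normc p`_k * (3 / 4 * eta) ^+ k <= M.
    apply: poly_cauchy => [|u uE]; first by rewrite mulr_ge0 //; lra.
    by apply: pM; rewrite uE; lra.
  have -> : eta / 2 = 3 / 4 * eta * q by rewrite /q; field.
  by rewrite exprMn mulrA ler_wpM2r // exprn_ge0.
have c2 k : normc p`_k * (eta / 2) ^+ k <= e / (2 * (B + 1)) * Q ^+ k.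
  have h : normc p`_k * (sigma / 2) ^+ k <= e / (2 * (B + 1)).
    apply: poly_cauchy => [|u uE]; first by lra.
    by apply: pe; rewrite uE; lra.
  have -> : eta / 2 = sigma / 2 * Q by rewrite /Q; field; rewrite gt_eqF.
  by rewrite exprMn mulrA ler_wpM2r // exprn_ge0.
have tk k : normc p`_k * normc t ^+ k <= normc p`_k * (eta / 2) ^+ k.
  by rewrite ler_wpM2l ?nc_ge0 // lerXn2r // nnegrE ?nc_ge0 //; lra.
have pn : (size p <= n1 + size p)%N by rewrite leq_addl.
rewrite (horner_coef_wide _ pn) big_split_ord /=.
rewrite (le_trans (ncD _ _)) // [leRHS](_ : e = e / 2 + e / 2); last by field.
apply: lerD.
- rewrite (le_trans (nc_sum _ _ _)) //.
  apply: (@le_trans _ _ (\sum_(k < n1) e / (2 * (B + 1)) * Q ^+ k)).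
    apply: ler_sum => k _; rewrite normcM ncX.
    exact: le_trans (tk k) (c2 k).
  rewrite -mulr_sumr -/B invfM mulrA -mulrA ler_piMr //; first by lra.
  by rewrite ler_pdivrMl ?mulr1 ?lerDl // ltr_wpDl.
- rewrite (le_trans (nc_sum _ _ _)) // (le_trans _ Hn1) //.
  apply: (@le_trans _ _ (\sum_(k < size p) M * q ^+ (n1 + k))).
    apply: ler_sum => k _; rewrite normcM ncX /=.
    exact: le_trans (tk _) (c1 _).
  under eq_bigr => k _ do rewrite exprD mulrA.
  rewrite -mulr_sumr -[leRHS]mulrA [leRHS]mulrCA [leRHS]mulrC.
  rewrite [X in X <= _](_ : _ = M * q ^+ n1 * (\sum_(i < size p) q ^+ i)) //.
  rewrite [leRHS](_ : _ = M * q ^+ n1 * 3); last by ring.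
  rewrite ler_wpM2l ?mulr_ge0 ?exprn_ge0 //.
  have := geometric_sum q (size p).
  have := exprn_ge0 (size p) q0.
  set S := \sum_(i < _) _; set T := q ^+ _; rewrite /q => T0 h; lra.
Qed.

End circle_average.

(** * Taylor series on the full disc without contour integrals *)

Section uniform_polynomial_approximation.
Variable R : realType.
Local Notation C := R[i].
Implicit Types (g f : C -> C) (w t : C).

(** A stand-in for analyticity on a disc, stable under sums, rotations and circle averages, and for
    which compactness gives one radius for all centres. *)
Definition poly_approx g w (eta : R) : Prop := forall e : R, 0 < e ->
  exists p : {poly C}, forall t, normc t < eta -> normc (g (w + t) - p.[t]) <= e.

Lemma poly_approx_poly (p : {poly C}) w eta : poly_approx (horner p) w eta.
Proof.
move=> e e0; exists (p \Po ('X + w%:P)) => t _.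
by rewrite horner_comp hornerD hornerX hornerC (addrC t) subrr normc0 ltW.
Qed.

Lemma poly_approxB f g w eta : poly_approx f w eta -> poly_approx g w eta ->
  poly_approx (fun t => f t - g t) w eta.
Proof.
move=> hf hg e e0; have e20 : 0 < e / 2 by lra.
have [p hp] := hf _ e20; have [q hq] := hg _ e20.
exists (p - q) => t te; rewrite hornerD hornerN.
have -> : f (w + t) - g (w + t) - (p.[t] - q.[t]) =
  (f (w + t) - p.[t]) - (g (w + t) - q.[t]) by ring.
rewrite (le_trans (ncB _ _)) // (_ : e = e / 2 + e / 2); last by field.
by rewrite lerD // ?hp ?hq.
Qed.

Lemma poly_approxZ f (a : C) w eta : poly_approx f w eta ->
  poly_approx (fun t => a * f t) w eta.
Proof.
move=> hf e e0; have a1 : 0 < normc a + 1 by rewrite ltr_wpDl // nc_ge0.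
have [p hp] := hf _ (divr_gt0 e0 a1).
exists (a *: p) => t te; rewrite hornerZ -mulrBr normcM.
apply: le_trans (ler_wpM2l (nc_ge0 _) (hp t te)) _.
by rewrite mulrCA ler_piMr ?(ltW e0) // ler_pdivrMr // mul1r lerDl.
Qed.

Lemma poly_approx_sum n (F : 'I_n -> C -> C) w eta :
  (forall j, poly_approx (F j) w eta) ->
  poly_approx (fun t => \sum_(j < n) F j t) w eta.
Proof.
elim: n F => [|n IH] F hF e e0.
  by exists 0 => t _; rewrite big_ord0 horner0 subr0 normc0 ltW.
have e20 : 0 < e / 2 by lra.
have [p hp] := IH _ (fun j => hF (widen_ord (leqnSn n) j)) _ e20.
have [q hq] := hF ord_max _ e20.
exists (p + q) => t te; rewrite big_ord_recr /= hornerD.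
rewrite opprD addrACA (le_trans (ncD _ _)) //.
by rewrite (_ : e = e / 2 + e / 2) ?lerD ?hp ?hq //; field.
Qed.

Lemma poly_approx_rot g (u : C) w eta : normc u = 1 ->
  poly_approx g (w * u) eta -> poly_approx (fun t => g (t * u)) w eta.
Proof.
move=> u1 hg e e0; have [p hp] := hg _ e0.
exists (p \Po (u *: 'X)) => t te.
rewrite horner_comp hornerZ hornerX mulrDl (mulrC u).
by apply: hp; rewrite normcM u1 mulr1.
Qed.

Lemma poly_approx_sub g w w' eta eta' : poly_approx g w eta ->
  normc (w' - w) + eta' <= eta -> poly_approx g w' eta'.
Proof.
move=> hg le e e0; have [p hp] := hg _ e0.
exists (p \Po ('X + (w' - w)%:P)) => t te.
rewrite horner_comp hornerD hornerX hornerC.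
have -> : w' + t = w + (t + (w' - w)) by ring.
apply: hp; apply: le_lt_trans (ncD _ _) _; lra.
Qed.

Lemma poly_approx_small (eta sigma M e : R) :
  0 < sigma -> sigma <= eta -> 0 <= M -> 0 < e ->
  exists eps : R, 0 < eps /\ forall g w, poly_approx g w eta ->
    (forall t, normc t < eta -> normc (g (w + t)) <= M) ->
    (forall t, normc t < sigma -> normc (g (w + t)) <= eps) ->
    forall t, normc t <= eta / 2 -> normc (g (w + t)) <= e.
Proof.
move=> s0 se M0 e0; have eta0 : 0 < eta by exact: lt_le_trans se.
have M10 : 0 <= M + 1 by rewrite addr_ge0.
have e20 : 0 < e / 2 by lra.
have [eps [eps0 H]] := poly_small s0 eta0 M10 e20.
exists (eps / 2); split; first by lra.
move=> g w hg gM ge t te.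
pose d := Num.min 1 (Num.min (eps / 2) (e / 2)).
have d0 : 0 < d by rewrite /d !lt_min ltr01 /=; apply/andP; split; lra.
have d1 : d <= 1 by rewrite /d ge_min lexx.
have d2 : d <= eps / 2 by rewrite /d ge_min ge_min lexx orbT.
have d3 : d <= e / 2 by rewrite /d ge_min ge_min lexx !orbT.
have [p hp] := hg _ d0.
have E u : p.[u] = g (w + u) - (g (w + u) - p.[u]) by ring.
have pe : normc p.[t] <= e / 2.
  apply: H te => u ue; rewrite E (le_trans (ncB _ _)) //.
    by have := gM u ue; have := hp u ue; lra.
  have ue' : normc u < eta by exact: lt_le_trans ue se.
  by have := ge u ue; have := hp u ue'; lra.
have te' : normc t < eta by lra.
have -> : g (w + t) = p.[t] + (g (w + t) - p.[t]) by ring.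
by rewrite (le_trans (ncD _ _)) //; have := hp t te'; lra.
Qed.

Lemma poly_approx_circle n k g w eta :
  (forall w', normc w' = normc w -> poly_approx g w' eta) ->
  poly_approx (circle_average n k g) w eta.
Proof.
move=> hg; apply: poly_approxZ.
have H : forall j : 'I_n.+1,
    poly_approx (fun t => g (t * unity R n ^+ j) / unity R n ^+ (j * k)) w eta.
  move=> j.
  rewrite (_ : (fun t => _) =
    (fun t => (unity R n ^+ (j * k))^-1 * g (t * unity R n ^+ j))).
    have W : poly_approx (fun t => g (t * unity R n ^+ j)) w eta.
      apply: poly_approx_rot; first by rewrite ncX nc_unity expr1n.
      by apply: hg; rewrite normcM ncX nc_unity expr1n mulr1.
    exact: (poly_approxZ _ W).
  by apply/funext => t; rewrite mulrC.
exact: poly_approx_sum H.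
Qed.

Lemma disc_compact (r : R) :
  compact [set xy : R * R | normc (Complex xy.1 xy.2) <= r].
Proof.
apply: (@subclosed_compact _ _ (`[- `|r|, `|r|]%classic `*` `[- `|r|, `|r|]%classic)).
- rewrite (_ : [set _ | _] = [set xy : R * R | 0 <= r] `&`
      ((fun xy : R * R => xy.1 * xy.1 + xy.2 * xy.2) @^-1` [set x | x <= r ^+ 2])).
    apply: closedI.
      have [r0|r0] := boolP (0 <= r).
        rewrite (_ : [set _ | _] = setT); first exact: closedT.
        by apply/seteqP; split.
      rewrite (_ : [set _ | _] = set0); first exact: closed0.
      by apply/seteqP; split => // x /= h; rewrite h in r0.
    apply: closed_comp; last exact: closed_le.
    by move=> xy _; apply: cvgD; apply: cvgM; first [exact: cvg_fst|exact: cvg_snd].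
  apply/seteqP; split => [[x y]|[x y]] /=.
    move=> h; have r0 : 0 <= r by apply: le_trans h; exact: sqrtr_ge0.
    split => //; rewrite -!expr2.
    have := h; rewrite -(ler_pXn2r (n := 2)) ?nnegrE ?sqrtr_ge0 // sqr_sqrtr //.
    by rewrite addr_ge0 ?sqr_ge0.
  move=> [r0]; rewrite -!expr2 => h.
  by rewrite -(ler_pXn2r (n := 2)) ?nnegrE ?sqrtr_ge0 // sqr_sqrtr // addr_ge0 ?sqr_ge0.
- by apply: compact_setX; exact: segment_compact.
- move=> [x y] /= h; have r0 : 0 <= r by apply: le_trans h; exact: sqrtr_ge0.
  rewrite /= !in_itv /= -!ler_norml (ger0_norm r0); split.
    exact: le_trans (nc_Re (Complex x y)) h.
  exact: le_trans (nc_Im (Complex x y)) h.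
Qed.

(** A Lebesgue number for the compact disc of radius [r1]: an approximation on a disc of radius eta
    serves all centres that differ by less than eta / 4 in each coordinate, with half the radius. *)
Lemma poly_approx_uniform g (r r1 : R) : r1 < r ->
  (forall w, normc w < r -> exists eta, 0 < eta /\ poly_approx g w eta) ->
  exists eta, 0 < eta /\ forall w, normc w <= r1 -> poly_approx g w eta.
Proof.
move=> r1r loc.
have /compact_near_coveringP cK := @disc_compact r1.
have := cK R (0 : R)^'+ (fun e xy => poly_approx g (Complex xy.1 xy.2) e) _.
case.
  move=> [x y] /= xy.
  have [eta [eta0 H]] := loc (Complex x y) (le_lt_trans xy r1r).
  have e4 : 0 < eta / 4 by lra.
  exists ([set xy' : R * R | ball x (eta / 4) xy'.1 /\ ball y (eta / 4) xy'.2],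
    [set e : R | e < eta / 2]) => /=.
    split.
      exists (ball x (eta / 4), ball y (eta / 4)) => /=.
        by split; exact: nbhsx_ballx.
      by move=> [a b] [].
    by apply: nbhs_right_lt; lra.
  move=> [[x' y'] e'] /= [[bx by'] e'lt].
  apply: poly_approx_sub H _.
  have -> : Complex x' y' - Complex x y = Complex (x' - x) (y' - y) by [].
  have := nc_le_ReIm (x' - x) (y' - y).
  by move: bx by'; rewrite /ball /= distrC (distrC y); lra.
move=> e /= e0 H; exists (e / 2); split; first by lra.
move=> [a b] wr; apply: (H (e / 2) _ _ (a, b)) => //=; last by lra.
by rewrite sub0r normrN ger0_norm; lra.
Qed.

Definition power_sum (c : nat -> C) n : {poly C} := \poly_(k < n) c k.

Definition disc_sum (c : nat -> C) g (rho : R) : Prop := forall e : R, 0 < e ->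
  exists n0, forall n, (n0 <= n)%N -> forall t, normc t <= rho ->
    normc (g t - (power_sum c n).[t]) <= e.

Lemma disc_sum_le c g rho rho' : rho' <= rho -> disc_sum c g rho ->
  disc_sum c g rho'.
Proof.
move=> rr h e e0; have [n0 H] := h e e0; exists n0 => n nn t tr.
by apply: H => //; exact: le_trans rr.
Qed.

(** Averages are exact on partial sums and do not exceed the supremum over a circle, so uniform
    convergence of the series passes to them. *)
Lemma disc_sum_average c g rho k e : disc_sum c g rho -> 0 < e ->
  exists n0, forall n, (n0 <= n)%N -> forall s, normc s <= rho ->
    normc (circle_average n k g s - c k * s ^+ k) <= e.
Proof.
move=> h e0; have [n0 H] := h e e0.
exists (maxn n0 k) => n; rewrite geq_max => /andP[nn kn] s sr.
have pn : (size (power_sum c n.+1) <= n.+1)%N by exact: size_poly.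
have <- : circle_average n k (horner (power_sum c n.+1)) s = c k * s ^+ k.
  by rewrite circle_average_poly // coef_poly ltnS kn.
rewrite -circle_averageB; apply: circle_average_bound => t ts.
by apply: H; rewrite ?ts // (leq_trans nn).
Qed.

Lemma disc_sum_cauchy c g rho k (M : R) : 0 <= rho -> disc_sum c g rho ->
  (forall t, normc t <= rho -> normc (g t) <= M) -> normc (c k) * rho ^+ k <= M.
Proof.
move=> rho0 h gM; apply/ler_addgt0Pr => e e0.
have [n H] := disc_sum_average k h e0.
have s0 : normc (real_complex R rho) = rho by rewrite nc_real ger0_norm.
have := H n (leqnn n) (real_complex R rho); rewrite s0 => /(_ (lexx _)) H1.
have -> : normc (c k) * rho ^+ k = normc (c k * real_complex R rho ^+ k).
  by rewrite normcM ncX s0.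
set A := circle_average _ _ _ _ in H1.
have -> : c k * real_complex R rho ^+ k = A - (A - c k * real_complex R rho ^+ k) by ring.
rewrite (le_trans (ncB _ _)) // lerD //.
by apply: circle_average_bound => t ts; apply: gM; rewrite ts s0.
Qed.

Lemma power_sum_bound c n (s q M : R) t : 0 < s -> 0 <= q < 1 ->
  (forall k, normc (c k) * s ^+ k <= M) -> normc t <= q * s ->
  normc (power_sum c n).[t] <= M / (1 - q).
Proof.
move=> s0 /andP[q0 q1] cM ts.
rewrite horner_poly (le_trans (nc_sum _ _ _)) //.
apply: (@le_trans _ _ (\sum_(k < n) M * q ^+ k)).
  apply: ler_sum => k _; rewrite normcM ncX.
  apply: (@le_trans _ _ (normc (c k) * (q * s) ^+ k)).
    by rewrite ler_wpM2l ?nc_ge0 // lerXn2r // nnegrE ?nc_ge0 // mulr_ge0 // ltW.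
  by rewrite exprMn mulrCA mulrC ler_wpM2r // exprn_ge0.
rewrite -mulr_sumr ler_pdivlMr ?subr_gt0 // -mulrA geometric_sum.
have M0 : 0 <= M.
  by apply: le_trans (cM 0); rewrite expr0 mulr1 nc_ge0.
by rewrite ler_piMr // gerBl exprn_ge0.
Qed.

Lemma scale_point (s : C) (a : R) : 0 < a -> a <= normc s -> exists w : C,
  normc w = a /\ normc (s - w) = normc s - a.
Proof.
move=> a0 as_; have s0 : 0 < normc s by exact: lt_le_trans as_.
exists (real_complex R (a / normc s) * s); split.
  by rewrite normcM nc_real ger0_norm ?divfK ?gt_eqF // divr_ge0 ?nc_ge0 // ltW.
have -> : s - real_complex R (a / normc s) * s = real_complex R (1 - a / normc s) * s.
  by rewrite rmorphB rmorph1 mulrBl mul1r.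
rewrite normcM nc_real ger0_norm; last by rewrite subr_ge0 ler_pdivrMr // mul1r.
by rewrite mulrBl mul1r divfK ?gt_eqF.
Qed.

(** The difference [D] of a circle average and its limit is small within radius rho. By
    [poly_approx_small], applied around a point just inside, it remains small at radius rho + eta /
    4; the bound on [g] then gives Cauchy's estimate at that radius. Hence the partial sums are
    bounded up to rho + eta / 8, and the same device, applied to [g] minus a partial sum, extends
    the uniform convergence. *)
Lemma disc_sum_step c g (r r1 rho eta M : R) :
  0 < eta -> eta <= rho -> rho <= r1 -> r1 + eta <= r ->
  (forall t, normc t < r -> normc (g t) <= M) ->
  (forall w, normc w <= r1 -> poly_approx g w eta) ->
  disc_sum c g rho -> disc_sum c g (rho + eta / 32).
Proof.
move=> eta0 er rr1 r1r gM ga hs.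
have rho0 : 0 < rho by exact: lt_le_trans er.
have M0 : 0 <= M.
  by apply: le_trans (gM 0 _); rewrite ?nc_ge0 // normc0; lra.
(* The disc of radius [sg] about a point of modulus rho - sg stays within radius rho, where
   smallness is known. *)
pose sg := eta / 64; have sg0 : 0 < sg by rewrite /sg; lra.
have sge : sg <= eta by rewrite /sg; lra.
have cM k : normc (c k) * (rho + eta / 4) ^+ k <= M.
  pose M' := M + normc (c k) * r ^+ k.
  have r0 : 0 <= r by lra.
  have M'0 : 0 <= M' by rewrite addr_ge0 // mulr_ge0 ?nc_ge0 // exprn_ge0.
  apply/ler_addgt0Pr => e e0.
  have [eps [eps0 H]] := poly_approx_small sg0 sge M'0 e0.
  have [n H1] := disc_sum_average k hs eps0.
  pose s := real_complex R (rho + eta / 4).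
  have ns : normc s = rho + eta / 4 by rewrite nc_real ger0_norm //; lra.
  have [w [nw sw]] : exists w : C, normc w = rho - sg /\
      normc (s - w) = normc s - (rho - sg).
    by apply: scale_point; rewrite ?ns /sg; lra.
  pose D t := circle_average n k g t - c k * t ^+ k.
  have De : normc (D s) <= e.
    have -> : s = w + (s - w) by ring.
    apply: (H D w); last by rewrite sw ns /sg; lra.
    - apply: poly_approxB; last first.
        have -> : (fun t : C => c k * t ^+ k) = horner (c k *: 'X^k).
          by apply/funext => t; rewrite hornerZ hornerXn.
        exact: poly_approx_poly.
      by apply: poly_approx_circle => w' ww'; apply: ga; rewrite ww' nw /sg; lra.
    - move=> t te; have wt : normc (w + t) < r.
        by apply: le_lt_trans (ncD _ _) _; rewrite nw /sg; lra.
      rewrite /D (le_trans (ncB _ _)) // lerD //.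
        by apply: circle_average_bound => u uE; apply: gM; rewrite uE.
      rewrite normcM ncX ler_wpM2l ?nc_ge0 // lerXn2r // ?nnegrE ?nc_ge0 //.
      exact: ltW.
    - move=> t te; apply: H1 => //.
      by apply: le_trans (ncD _ _) _; rewrite nw; lra.
  have -> : normc (c k) * (rho + eta / 4) ^+ k = normc (c k * s ^+ k).
    by rewrite normcM ncX ns.
  have -> : c k * s ^+ k = circle_average n k g s - D s by rewrite /D; ring.
  rewrite (le_trans (ncB _ _)) // lerD //.
  by apply: circle_average_bound => u uE; apply: gM; rewrite uE ns; lra.
pose q := (rho + eta / 8) / (rho + eta / 4).
have re4 : 0 < rho + eta / 4 by lra.
have q01 : 0 <= q < 1.
  by rewrite /q divr_ge0 ?ltr_pdivrMr ?mul1r //=; lra.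
have pM n t : normc t <= rho + eta / 8 -> normc (power_sum c n).[t] <= M / (1 - q).
  move=> tr; apply: (power_sum_bound n re4 q01 cM).
  by rewrite /q divfK // gt_eqF.
pose M' := M + M / (1 - q).
have M'0 : 0 <= M'.
  by rewrite addr_ge0 // divr_ge0 // subr_ge0; case/andP: q01 => _ /ltW.
move=> e e0.
have sge8 : sg <= eta / 8 by rewrite /sg; lra.
have [eps [eps0 H]] := poly_approx_small sg0 sge8 M'0 e0.
have [n1 H1] := hs _ eps0; have [n2 H2] := hs _ e0.
exists (maxn n1 n2) => n; rewrite geq_max => /andP[nn1 nn2] s sr.
have [sle|slt] := leP (normc s) rho; first exact: H2.
have [w [nw sw]] : exists w : C, normc w = rho - sg /\
    normc (s - w) = normc s - (rho - sg).
  by apply: scale_point; rewrite /sg; lra.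
pose D t := g t - (power_sum c n).[t].
rewrite -/(D s) (_ : s = w + (s - w)); last by ring.
apply: (H D w); last by rewrite sw /sg; lra.
- apply: poly_approxB; last exact: poly_approx_poly.
  apply: (@poly_approx_sub g w w eta); last by rewrite subrr normc0; lra.
  by apply: ga; rewrite nw /sg; lra.
- move=> t te; have wt : normc (w + t) <= rho + eta / 8.
    by apply: le_trans (ncD _ _) _; rewrite nw /sg; lra.
  by rewrite /D (le_trans (ncB _ _)) // lerD ?pM // gM //; lra.
- move=> t te; apply: H1 => //.
  by apply: le_trans (ncD _ _) _; rewrite nw; lra.
Qed.

(** Compactness makes the gain of [disc_sum_step] the same at every step, so finitely many steps
    reach [r1]. *)
Lemma disc_sum_extend c g (r rho0 M : R) : 0 < rho0 ->
  (forall t, normc t < r -> normc (g t) <= M) ->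
  (forall w, normc w < r -> exists eta, 0 < eta /\ poly_approx g w eta) ->
  disc_sum c g rho0 -> forall r1, r1 < r -> disc_sum c g r1.
Proof.
move=> rho00 gM loc h0 r1 r1r.
have [le|lt] := leP r1 rho0; first exact: disc_sum_le h0.
have [eta [eta0 ga]] := poly_approx_uniform r1r loc.
pose et := Num.min eta (Num.min rho0 (r - r1)).
have et0 : 0 < et by rewrite /et !lt_min eta0 rho00 subr_gt0.
have et1 : et <= eta by rewrite /et ge_min lexx.
have et2 : et <= rho0 by rewrite /et !ge_min lexx orbT.
have et3 : et <= r - r1 by rewrite /et !ge_min lexx !orbT.
have ga' w : normc w <= r1 -> poly_approx g w et.
  by move=> wr; apply: poly_approx_sub (ga w wr) _; rewrite subrr normc0 add0r.
have step n : disc_sum c g (Num.min r1 (rho0 + et / 32 * n%:R)).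
  elim: n => [|n IH]; first by rewrite mulr0 addr0; apply: disc_sum_le h0; rewrite ge_min lexx orbT.
  have [le|lt'] := leP r1 (rho0 + et / 32 * n%:R).
    by rewrite (min_idPl le) in IH; apply: disc_sum_le IH; rewrite ge_min lexx.
  rewrite (min_idPr (ltW lt')) in IH.
  apply: (@disc_sum_le _ _ (rho0 + et / 32 * n%:R + et / 32)).
    by rewrite ge_min -[n.+1%:R]natr1 mulrDr mulr1 addrA lexx orbT.
  apply: (@disc_sum_step c g r r1 _ et M) => //; last 2 first.
  - by rewrite ltW.
  - by lra.
  have : 0 <= et / 32 * n%:R by rewrite mulr_ge0 //; lra.
  lra.
pose n := Num.Def.archi_bound ((r1 - rho0) / (et / 32)).
have hn : r1 <= rho0 + et / 32 * n%:R.
  have := @archi_boundP R ((r1 - rho0) / (et / 32)) _.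
  rewrite -/n => H; rewrite -lerBlDl mulrC -ler_pdivrMr; last by lra.
  by apply/ltW/H; rewrite divr_ge0 //; lra.
by have := step n; rewrite (min_idPl hn).
Qed.

End uniform_polynomial_approximation.

(** * Homogeneous components and restriction to complex lines *)

Section degree.
Variable m : nat.
Local Notation MI := (multi_index m).

Definition degree (g : MI) : nat := \sum_i g i.

Definition degree_seq (k : nat) : seq MI := [seq g <- box_seq m k.+1 | degree g == k].

Lemma mem_box_seq N (g : MI) : (g \in box_seq m N) = [forall i, (g i < N)%N].
Proof.
apply/idP/forallP => [/mapP[al _ -> i]|gi]; first by rewrite ffunE.
apply/mapP; exists [ffun i => Ordinal (gi i)]; first by rewrite mem_enum.
by apply/ffunP => i; rewrite !ffunE.
Qed.

Lemma leq_degree (g : MI) i : (g i <= degree g)%N.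
Proof. by rewrite /degree (bigD1 i) //= leq_addr. Qed.

Lemma degree_box N (g : MI) : g \in box_seq m N -> (degree g <= m * N)%N.
Proof.
rewrite mem_box_seq => /forallP gN; rewrite /degree.
apply: leq_trans (_ : \sum_(i < m) N <= _)%N; last by rewrite sum_nat_const card_ord.
by apply: leq_sum => i _; apply: ltnW.
Qed.

Lemma box_degree N (g : MI) : (degree g < N)%N -> g \in box_seq m N.
Proof.
move=> gN; rewrite mem_box_seq; apply/forallP => i.
exact: leq_ltn_trans (leq_degree g i) gN.
Qed.

Lemma mem_degree_seq k (g : MI) : (g \in degree_seq k) = (degree g == k).
Proof.
rewrite mem_filter; case: eqP => //= <-.
by rewrite box_degree.
Qed.

Lemma degree_seq_uniq k : uniq (degree_seq k).
Proof. by rewrite filter_uniq // box_seq_uniq. Qed.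

Lemma sum_degree (V : nmodType) (F : MI -> V) n N : (n <= N)%N ->
  \sum_(k < n) \sum_(g <- degree_seq k) F g =
  \sum_(g <- box_seq m N | (degree g < n)%N) F g.
Proof.
move=> nN.
have E (k : 'I_n) : \sum_(g <- degree_seq k) F g =
    \sum_(g <- box_seq m N | degree g == k) F g.
  rewrite -[RHS]big_filter; apply: perm_big; apply: uniq_perm.
  - exact: degree_seq_uniq.
  - by rewrite filter_uniq // box_seq_uniq.
  - move=> g; rewrite mem_degree_seq mem_filter.
    case: eqP => //= gk; rewrite box_degree // gk.
    by apply: leq_trans nN; exact: ltn_ord.
under eq_bigr => k _ do rewrite E big_mkcond.
rewrite exchange_big /= [RHS]big_mkcond /=; apply: eq_bigr => g _.
case: ltnP => gn.
  rewrite (bigD1 (Ordinal gn)) //= eqxx big1 ?addr0 // => k kg.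
  case: eqP => // gk; case/eqP: kg; exact: val_inj.
by rewrite big1 // => k _; case: eqP => // gk; move: (ltn_ord k); rewrite -gk ltnNge gn.
Qed.

End degree.

Section lines.
Variables (R : realType) (m : nat).
Local Notation C := R[i].
Local Notation K := (R[i] : numFieldType).
Local Notation MI := (multi_index m).

Definition cmon (h : 'rV[C]_m) (g : MI) : C := \prod_i h 0 i ^+ g i.

(** The homogeneous component of degree [k] at [h], which is also the Taylor coefficient of degree
    [k] along the line t -> t *: h. *)
Definition line_coef (a : MI -> C) (h : 'rV[C]_m) (k : nat) : C :=
  \sum_(g <- degree_seq m k) a g * cmon h g.

Lemma cmonZ (t : C) (h : 'rV[C]_m) g : cmon (t *: h) g = t ^+ degree g * cmon h g.
Proof.
rewrite /cmon /degree -prodrXr -big_split /=; apply: eq_bigr => i _.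
by rewrite mxE exprMn.
Qed.

Lemma line_sum (a : MI -> C) (h : 'rV[C]_m) n N (t : C) : (n <= N)%N ->
  (power_sum (line_coef a h) n).[t] =
  \sum_(g <- box_seq m N | (degree g < n)%N) a g * cmon (t *: h) g.
Proof.
move=> nN; rewrite horner_poly -(sum_degree _ nN); apply: eq_bigr => k _.
rewrite mulr_suml; apply: eq_big_seq => g; rewrite mem_degree_seq => /eqP gk.
by rewrite cmonZ gk -mulrA (mulrC _ (t ^+ k)).
Qed.

Lemma complex_normE (z : C) : `|z| = real_complex R (normc z).
Proof. by []. Qed.

Lemma cvg_complexP (u : nat -> K) (l : K) : u @ \oo --> l ->
  forall e : R, 0 < e -> exists n0, forall n, (n0 <= n)%N -> normc (l - u n) <= e.
Proof.
move=> /cvgrPdist_le H e e0.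
have e0' : 0 < real_complex R e by rewrite ltcR.
have [n0 _ Hn] := H _ e0'.
by exists n0 => n nn; have := Hn n nn; rewrite /= complex_normE lecR.
Qed.

(** Absolute convergence at the single point tau *: h dominates the whole disc and permits the
    passage from boxes to degrees. The coefficients serve all directions [h], whereas [tau] depends
    on [h]. *)
Lemma analytic_line (f : 'rV[C]_m -> C) (x : 'rV[C]_m) : analytic_at f x ->
  exists a : MI -> C, forall h, exists tau : R, 0 < tau /\
    disc_sum (line_coef a h) (fun t => f (x + t *: h)) tau.
Proof.
move=> [a /nbhs_ballP[e /= e0 H]]; exists a => h.
have [e' e'0 ee'] : exists2 e' : R, 0 < e' & e = real_complex R e'.
  exists (complex.Re e); first by move: e0; rewrite ltcE => /andP[_].
  move: e0; rewrite ltcE => /andP[/eqP /= ie _]; case: (e) ie => a' b' /= -> //.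
pose B : R := 1 + \sum_i normc (h 0 i).
have B1 : 1 <= B by rewrite lerDl sumr_ge0 // => i _; exact: nc_ge0.
have hB i : normc (h 0 i) < B.
  rewrite /B (bigD1 i) //= addrCA ltrDl ltr_pwDl // sumr_ge0 // => j _.
  exact: nc_ge0.
have B0 : 0 < B by exact: lt_le_trans B1.
pose tau := e' / B; have tau0 : 0 < tau by rewrite divr_gt0.
exists tau; split=> //.
have inb (t : C) : normc t <= tau -> ball (x : 'rV[K]_m) e (x + t *: h).
  move=> tt; split=> // i j; rewrite (ord1 i) /ball /= !mxE opprD addrA subrr sub0r normrN.
  rewrite complex_normE ee' ltcR normcM.
  apply: (@le_lt_trans _ _ (tau * normc (h 0 j))).
    by rewrite ler_wpM2r ?nc_ge0.
  rewrite /tau mulrAC ltr_pdivrMr // ltr_pM2l //; exact: hB.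
have addK (u : 'rV[C]_m) : x + u - x = u by rewrite addrC addKr.
pose b (g : MI) : R := normc (a g * cmon (real_complex R tau *: h) g).
have b0 g : 0 <= b g by exact: nc_ge0.
have ntau : normc (real_complex R tau) = tau by rewrite nc_real gtr0_norm.
have ntau' : normc (real_complex R tau) <= tau by rewrite ntau.
have [cv _] := H _ (inb (real_complex R tau) ntau').
pose u N := \sum_(g <- box_seq m N) b g.
have uE N : \sum_(al : {ffun 'I_m -> 'I_N}) `|power_term a (real_complex R tau *: h) al| =
   real_complex R (u N).
  rewrite (power_term_sum _ _ Num.norm) /u rmorph_sum; apply: eq_bigr => g _ //.
have umono N1 N2 : (N1 <= N2)%N -> u N1 <= u N2 /\
    forall P : pred MI, (forall g, g \in box_seq m N1 -> ~~ P g) ->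
    \sum_(g <- box_seq m N2 | P g) b g <= u N2 - u N1.
  move=> NN.
  have sub g : g \in box_seq m N1 -> g \in box_seq m N2.
    rewrite !mem_box_seq => /forallP gi; apply/forallP => i.
    exact: leq_trans (gi i) NN.
  have E : u N1 = \sum_(g <- box_seq m N2 | g \in box_seq m N1) b g.
    rewrite -[RHS]big_filter; apply: perm_big; apply: uniq_perm.
    - exact: box_seq_uniq.
    - by rewrite filter_uniq // box_seq_uniq.
    - move=> g; rewrite mem_filter; case: (boolP (g \in box_seq m N1)) => //= g1.
      by rewrite sub.
  have D : u N2 - u N1 = \sum_(g <- box_seq m N2 | g \notin box_seq m N1) b g.
    by rewrite E /u (bigID (fun g => g \in box_seq m N1)) /= addrAC subrr add0r.
  split; first by rewrite -subr_ge0 D sumr_ge0.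
  move=> P HP; rewrite D big_mkcond [leRHS]big_mkcond /=; apply: ler_sum => g _.
  case: (boolP (P g)) => Pg; last by case: ifP.
  by rewrite ifT //; apply/negP => /HP; rewrite Pg.
have ucauchy (e1 : R) : 0 < e1 -> exists N0, forall N, (N0 <= N)%N -> u N - u N0 <= e1.
  move=> e10; rewrite addK in cv.
  have [l lv] : exists l : K, forall e, 0 < e -> exists n0, forall n, (n0 <= n)%N ->
      normc (l - \sum_(al : {ffun 'I_m -> 'I_n}) `|power_term a (real_complex R tau *: h) al|) <= e.
    by eexists; exact: (cvg_complexP cv).
  have e20 : 0 < e1 / 2 by lra.
  have [N0 HN] := lv _ e20.
  exists N0 => N NN; have := HN N NN; have := HN N0 (leqnn _); rewrite !uE => h1 h2.
  apply: le_trans (ler_norm _) _; rewrite -nc_real rmorphB.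
  have -> : real_complex R (u N) - real_complex R (u N0) =
    (l - real_complex R (u N0)) - (l - real_complex R (u N)) by ring.
  by rewrite (le_trans (ncB _ _)) //; lra.
move=> e1 e10.
have [N0 HN0] := ucauchy _ e10.
(* Indices in the box of size [N0] have degree at most m * N0, so those of degree [n] or more lie
   outside it, in the tail bounded by [e1]. *)
exists (m * N0).+1 => n nn t tt.
have [_] := H _ (inb t tt); rewrite addK => ct.
apply/ler_addgt0Pr => e2 e20.
have [N1 HN1] := cvg_complexP ct e20.
pose N := maxn N1 (maxn N0 n).
have NN1 : (N1 <= N)%N by rewrite leq_maxl.
have NN0 : (N0 <= N)%N by rewrite /N maxnA (leq_trans (leq_maxr N1 N0)) // leq_maxl.
have Nn : (n <= N)%N by rewrite /N maxnA leq_maxr.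
have h1 := HN1 N NN1.
set S := \sum_al _ in h1.
have SE : S = \sum_(g <- box_seq m N) a g * cmon (t *: h) g.
  by rewrite /S (power_term_sum _ _ id).
have -> : f (x + t *: h) - (power_sum (line_coef a h) n).[t] =
  (f (x + t *: h) - S) + (S - (power_sum (line_coef a h) n).[t]) by ring.
rewrite (le_trans (ncD _ _)) // [leRHS]addrC lerD //.
rewrite (line_sum _ _ _ Nn) SE (bigID (fun g => (degree g < n)%N)) /= addrAC subrr add0r.
rewrite (le_trans (nc_sum _ _ _)) //.
apply: le_trans (HN0 N NN0).
have [_ Hu] := umono N0 N NN0.
apply: le_trans (Hu (fun g => ~~ (degree g < n)%N) _); last first.
  move=> g /degree_box gd; rewrite negbK; apply: leq_trans nn.
  by rewrite ltnS.
apply: ler_sum => g _; rewrite /b !normcM ler_wpM2l ?nc_ge0 //.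
rewrite !cmonZ !normcM !ncX ler_wpM2r ?nc_ge0 // lerXn2r ?nnegrE ?nc_ge0 //.
by rewrite ntau.
Qed.

(* Orthogonality of the characters of the torus recovers the coefficients of a
   homogeneous polynomial from its values at points with unimodular
   coordinates. *)
Lemma line_coef_inv (a : MI -> C) (g : MI) : let k := degree g in
  a g = (k.+1%:R ^+ m)^-1 * \sum_(j : {ffun 'I_m -> 'I_k.+1})
    (\prod_i unity R k ^+ (j i * g i))^-1 *
    line_coef a (\row_i unity R k ^+ (j i)) k.
Proof.
move=> k.
have E (j : {ffun 'I_m -> 'I_k.+1}) :
    (\prod_i unity R k ^+ (j i * g i))^-1 * line_coef a (\row_i unity R k ^+ (j i)) k =
    \sum_(g' <- degree_seq m k)
      a g' * \prod_i (unity R k ^+ (j i * g' i) / unity R k ^+ (j i * g i)).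
  rewrite /line_coef mulr_sumr; apply: eq_bigr => g' _.
  rewrite mulrCA; congr (_ * _); rewrite big_split /= mulrC; congr (_ * _).
    by rewrite /cmon; apply: eq_bigr => i _; rewrite mxE -exprM.
  by rewrite prodfV.
under eq_bigr => j _ do rewrite E.
rewrite exchange_big /=.
have S g' : g' \in degree_seq m k -> \sum_(j : {ffun 'I_m -> 'I_k.+1})
    a g' * \prod_i (unity R k ^+ (j i * g' i) / unity R k ^+ (j i * g i)) =
    (a g * k.+1%:R ^+ m) *+ (g' == g).
  rewrite mem_degree_seq => /eqP gk.
  rewrite -mulr_sumr -(bigA_distr_bigA (fun i (j : 'I_k.+1) =>
    unity R k ^+ (j * g' i) / unity R k ^+ (j * g i))) /=.
  have g'i i : (g' i <= k)%N by rewrite -gk leq_degree.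
  under eq_bigr => i _ do rewrite (unity_sum R (g'i i) (leq_degree g i)).
  have [->|gg] := eqVneq g' g.
    under eq_bigr => i _ do rewrite eqxx mulr1n.
    by rewrite prodr_const card_ord mulr1n.
  have [i gi] : exists i, g' i != g i.
    apply: contrapT => /forallNP Hi; move/eqP: gg; apply; apply/ffunP => i.
    by apply/eqP; move/negP: (Hi i); rewrite negbK.
  by rewrite (bigD1 i) //= (negbTE gi) mulr0n mul0r mulr0 mulr0n.
rewrite (eq_big_seq _ S) (bigD1_seq g) ?degree_seq_uniq ?mem_degree_seq //=.
rewrite eqxx mulr1n big1 ?addr0; last by move=> g' /negbTE ->.
by rewrite mulrC mulfK // expf_neq0 // pnatr_eq0.
Qed.

End lines.

(** * From bounded complex analytic functions to Wiener series *)

Section complex_measurable.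
Context (R : realType) d (Z : measurableType d).
Local Notation C := R[i].

Definition complex_measurable (f : Z -> C) : Prop :=
  measurable_fun setT (fun z => complex.Re (f z)) /\
  measurable_fun setT (fun z => complex.Im (f z)).

Lemma complex_measurableD f g : complex_measurable f -> complex_measurable g ->
  complex_measurable (fun z => f z + g z).
Proof.
move=> [f1 f2] [g1 g2]; split.
  rewrite (_ : (fun z => _) = (fun z => complex.Re (f z) + complex.Re (g z))).
    exact: measurable_funD.
  by apply/funext => z; case: (f z) => ? ?; case: (g z).
rewrite (_ : (fun z => _) = (fun z => complex.Im (f z) + complex.Im (g z))).
  exact: measurable_funD.
by apply/funext => z; case: (f z) => ? ?; case: (g z).
Qed.

Lemma complex_measurableZ (a : C) f : complex_measurable f ->
  complex_measurable (fun z => a * f z).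
Proof.
case: a => a b [f1 f2]; split.
  rewrite (_ : (fun z => _) = (fun z => a * complex.Re (f z) - b * complex.Im (f z))).
    by apply: measurable_funB; apply: measurable_funM.
  by apply/funext => z; case: (f z).
rewrite (_ : (fun z => _) = (fun z => a * complex.Im (f z) + b * complex.Re (f z))).
  by apply: measurable_funD; apply: measurable_funM.
by apply/funext => z; case: (f z).
Qed.

Lemma complex_measurable_sum (I : Type) (r : seq I) (F : I -> Z -> C) :
  (forall i, complex_measurable (F i)) ->
  complex_measurable (fun z => \sum_(i <- r) F i z).
Proof.
move=> mF; elim: r => [|i r IH].
  rewrite (_ : (fun z => _) = (fun=> 0)); last by apply/funext => z; rewrite big_nil.
  by split; exact: measurable_cst.
rewrite (_ : (fun z => _) = (fun z => F i z + \sum_(j <- r) F j z)).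
  exact: complex_measurableD.
by apply/funext => z; rewrite big_cons.
Qed.

Lemma complex_measurable_lim (F : nat -> Z -> C) (f : Z -> C) :
  (forall n, complex_measurable (F n)) ->
  (forall z e, 0 < e -> exists n0, forall n, (n0 <= n)%N ->
     normc (F n z - f z) <= e) ->
  complex_measurable f.
Proof.
move=> mF H; split.
  apply: (@measurable_fun_cvg _ _ _ setT (fun n z => complex.Re (F n z))).
    by move=> n; have [] := mF n.
  move=> z _; apply/cvgrPdist_le => e e0; have [n0 Hn] := H z e e0.
  exists n0 => // n /= nn; rewrite distrC; apply: le_trans (Hn n nn).
  by apply: le_trans (nc_Re _); case: (F n z) => ? ?; case: (f z).
apply: (@measurable_fun_cvg _ _ _ setT (fun n z => complex.Im (F n z))).
  by move=> n; have [] := mF n.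
move=> z _; apply/cvgrPdist_le => e e0; have [n0 Hn] := H z e e0.
exists n0 => // n /= nn; rewrite distrC; apply: le_trans (Hn n nn).
by apply: le_trans (nc_Im _); case: (F n z) => ? ?; case: (f z).
Qed.

End complex_measurable.

Section wiener_of_complex.
Variables (R : realType) (m : nat).
Local Notation C := R[i].
Local Notation MI := (multi_index m).
Local Notation count := (@index_measure m R).
Context d (Z : measurableType d).

Lemma to_complexD (x h : 'rV[R]_m) : to_complex (x + h) = to_complex x + to_complex h.
Proof. by apply/rowP => j; rewrite !mxE rmorphD. Qed.

(** Coordinates of modulus at most 1 have Euclidean norm at most sqrt m; [m.+1] is a bound that also
    allows m = 0. *)
Lemma complex_ball_line (x : 'rV[R]_m) (r : R) (h : 'rV[C]_m) (t : C) :
  0 < r -> (forall i, normc (h 0 i) <= 1) -> normc t < r / m.+1%:R ->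
  complex_ball x r (to_complex x + t *: h).
Proof.
move=> r0 h1 tr; rewrite /complex_ball /=.
have m0 : 0 < m.+1%:R :> R by rewrite ltr0n.
have -> : \sum_(j < m) normc ((to_complex x + t *: h) 0 j - real_complex R (x 0 j)) ^+ 2 =
    \sum_(j < m) normc (t * h 0 j) ^+ 2.
  by apply: eq_bigr => j _; rewrite !mxE addrC addKr.
rewrite -(ger0_norm (ltW r0)) -sqrtr_sqr ltr_sqrt ?exprn_gt0 //.
apply: (@le_lt_trans _ _ (\sum_(j < m) normc t ^+ 2)).
  apply: ler_sum => j _; rewrite normcM lerXn2r // ?nnegrE ?mulr_ge0 ?nc_ge0 //.
  by rewrite ler_piMr // nc_ge0.
rewrite sumr_const card_ord -mulr_natr.
have h2 : normc t ^+ 2 * m%:R <= (normc t * m.+1%:R) ^+ 2.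
  rewrite exprMn ler_wpM2l ?sqr_ge0 // -natrX ler_nat.
  by rewrite expnS (leq_trans (leqnSn m)) // leq_pmulr.
apply: le_lt_trans h2 _; rewrite ltrXn2r // ?nnegrE ?mulr_ge0 ?nc_ge0 ?ltW //.
by rewrite -ltr_pdivlMr.
Qed.

(** Along each line the series converges on a disc whose radius does not depend on the direction, so
    Cauchy's estimate bounds the homogeneous components; averaging over the torus bounds each
    coefficient by M z / s^degree. Halving [s] then makes the norm at most [M z] times the m-th
    power of the sum of the (1/2)^k, which is 2. *)
Lemma wiener_of_complex (f : Z -> 'rV[C]_m -> C) (x0 : 'rV[R]_m) (r : R) (M : Z -> R) :
  0 < r -> (forall z, analytic_on (complex_ball x0 r) (f z)) ->
  (forall z w, complex_ball x0 r w -> normc (f z w) <= M z) ->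
  (forall w, complex_ball x0 r w -> complex_measurable (f ^~ w)) ->
  exists rho : R, 0 < rho /\ wiener rho (fun z => M z * 2 ^+ m)
    (fun z h => complex.Re (f z (to_complex (x0 + h)))).
Proof.
move=> r0 fa fM fm.
pose r1 := r / m.+1%:R; have r10 : 0 < r1 by rewrite divr_gt0.
have xb : complex_ball x0 r (to_complex x0).
  rewrite -[to_complex x0]addr0 -(scale0r 0); apply: complex_ball_line => //.
    by move=> i; rewrite mxE normc0.
  by rewrite normc0.
have M0 z : 0 <= M z by apply: le_trans (fM z _ xb); exact: nc_ge0.
have /choice[a Ha] := fun z => analytic_line (fa z _ xb).
pose unim := [set h : 'rV[C]_m | forall i, normc (h 0 i) <= 1].
pose g z (h : 'rV[C]_m) t := f z (to_complex x0 + t *: h).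
have gs z h : unim h -> forall s, s < r1 -> disc_sum (line_coef (a z) h) (g z h) s.
  move=> hu; have [tau [tau0 hs]] := Ha z h.
  apply: (@disc_sum_extend _ _ _ r1 tau (M z)) => //.
    by move=> t tr; apply: fM; exact: complex_ball_line.
  move=> w wr; have [b Hb] := analytic_line (fa z _ (complex_ball_line x0 r0 hu wr)).
  have [eta [eta0 hb]] := Hb h; exists eta; split => // e e0.
  have [n Hn] := hb e e0; exists (power_sum (line_coef b h) n) => t te.
  by rewrite /g scalerDl addrA; apply: Hn => //; exact: ltW.
pose s := r1 / 2; have s0 : 0 < s by rewrite /s; lra.
have sr : s < r1 by rewrite /s; lra.
pose rho := s / 2; have rho0 : 0 < rho by rewrite /rho; lra.
have lc z h k : unim h -> normc (line_coef (a z) h k) * s ^+ k <= M z.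
  move=> hu; apply: (@disc_sum_cauchy _ _ (g z h)); [exact: ltW|exact: gs|move=> t ts].
  by apply: fM; apply: complex_ball_line => //; exact: le_lt_trans ts sr.
have uu k (j : {ffun 'I_m -> 'I_k.+1}) : unim (\row_i unity R k ^+ (j i)).
  by move=> i; rewrite mxE ncX nc_unity expr1n.
have aM z k : normc (a z k) * s ^+ degree k <= M z.
  rewrite line_coef_inv normcM normcV ncX nc_nat mulrAC mulrC.
  rewrite mulrC mulrAC -mulrA mulrC.
  rewrite ler_pdivrMr ?exprn_gt0 ?ltr0n //.
  apply: le_trans (ler_wpM2r _ (nc_sum _ _ _)) _; first by rewrite exprn_ge0 // ltW.
  rewrite mulr_suml.
  apply: (@le_trans _ _ (\sum_(j : {ffun 'I_m -> 'I_(degree k).+1}) M z)).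
    apply: ler_sum => j _; rewrite normcM normcV; set P := normc (\prod_i _).
    have -> : P = 1.
      rewrite /P; elim/big_rec: _ => [|i y _ IH]; first exact: normc1.
      by rewrite normcM IH ncX nc_unity expr1n mulr1.
    by rewrite invr1 mul1r; apply: lc; exact: uu.
  rewrite sumr_const (_ : #|_| = ((degree k).+1 ^ m)%N); first by rewrite -[leLHS]mulr_natr natrX.
  by rewrite card_ffun !card_ord.
(* The components are pointwise limits of finite linear combinations of values of [f], hence
   measurable in [z]. *)
have lm h k : unim h -> complex_measurable (fun z => line_coef (a z) h k).
  move=> hu; pose sc := real_complex R s.
  have ns : normc sc = s by rewrite nc_real gtr0_norm.
  have sc0 : sc ^+ k != 0.
    rewrite expf_neq0 //; apply/eqP => h0; move: ns; rewrite h0 normc0 => e.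
    by move: s0; rewrite -e ltxx.
  rewrite (_ : (fun z => _) = (fun z => (sc ^+ k)^-1 * (line_coef (a z) h k * sc ^+ k))).
    apply: complex_measurableZ.
    apply: (@complex_measurable_lim _ _ _ (fun n z => circle_average n k (g z h) sc)).
      move=> n; apply: complex_measurableZ; apply: complex_measurable_sum => j.
      rewrite (_ : (fun z => _) = (fun z => (unity R n ^+ (j * k))^-1 *
          f z (to_complex x0 + (sc * unity R n ^+ j) *: h))).
        apply: complex_measurableZ; apply: fm; apply: complex_ball_line => //.
        by rewrite normcM ncX nc_unity expr1n mulr1 ns.
      by apply/funext => z; rewrite mulrC.
    move=> z e e0; have [n0 Hn] := disc_sum_average k (gs z h hu s sr) e0.
    by exists n0 => n nn; apply: Hn => //; rewrite ns.
  by apply/funext => z; rewrite mulrC mulfK.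
have am k : measurable_fun setT (fun z => complex.Re (a z k)).
  have [] : complex_measurable (fun z => a z k); last by [].
  under eq_fun => z do rewrite line_coef_inv.
  apply: complex_measurableZ; apply: complex_measurable_sum => j.
  by apply: complex_measurableZ; apply: lm; exact: uu.
have wd k : weight rho k = s ^+ degree k * (1 / 2) ^+ degree k.
  by rewrite -exprMn /weight prodrXr /rho mulrA mulr1.
exists rho; split => //; exists (fun k z => complex.Re (a z k)).
have ca z : (\int[count]_k (`|complex.Re (a z k)| * weight rho k)%:E <=
    (M z * 2 ^+ m)%:E)%E.
  apply: (counting_ge0_le (@multi_index_measurable m) (@index_measure1 m R) _
    (@box_seq_uniq m) (@box_seq_cover m)) => [k|N].
    by rewrite mulr_ge0 // weight_ge0 // ltW.
  apply: (@le_trans _ _ (\sum_(k <- box_seq m N) M z * (1 / 2) ^+ degree k)).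
    apply: ler_sum => k _; rewrite wd mulrA ler_wpM2r ?exprn_ge0 //.
    by apply: le_trans (aM z k); rewrite ler_wpM2r ?nc_Re // exprn_ge0 // ltW.
  rewrite -mulr_sumr ler_wpM2l // big_map big_enum /=.
  under eq_bigr => al _ do rewrite /degree -prodrXr.
  under eq_bigr => al _ do under eq_bigr => i _ do rewrite ffunE.
  rewrite -(bigA_distr_bigA (fun (i : 'I_m) (k : 'I_N) => (1 / 2 : R) ^+ k)) /=.
  rewrite prodr_const card_ord lerXn2r // ?nnegrE ?sumr_ge0 //.
  have := geometric_sum (1 / 2 : R) N; have : 0 <= (1 / 2 : R) ^+ N.
    by rewrite exprn_ge0 //; lra.
  set S := \sum_(_ < _) _; set T := _ ^+ N; lra.
split => // z h hb.
have fi : count.-integrable setT (EFin \o (fun k => complex.Re (a z k) * mon h k)).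
  exact: (coefficient_integrable (ca z) hb).
pose ds n := [seq k <- box_seq m n | (degree k < n)%N].
have dsu n : uniq (ds n) by rewrite filter_uniq // box_seq_uniq.
have dsc k : \forall n \near \oo, k \in ds n.
  by exists (degree k).+1 => // n /= kn; rewrite mem_filter kn box_degree.
have C1 := counting_exhaust (@multi_index_measurable m) (@index_measure1 m R) dsu dsc fi.
rewrite -[RHS]fineK; last exact: integrable_fin_num fi.
congr EFin; apply/esym; apply: (cvg_unique _ C1) => //.
apply/cvgrPdist_le => e e0.
(* The real point [h] lies at t = rho on the line through h / rho, a direction with coordinates of
   modulus at most 1. *)
pose h' : 'rV[C]_m := \row_i real_complex R (h 0 i / rho).
have h'u : unim h'.
  move=> i; rewrite mxE nc_real normrM normfV (gtr0_norm rho0).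
  by rewrite ler_pdivrMr // mul1r; exact: hb.
pose t := real_complex R rho.
have th : t *: h' = to_complex h.
  by apply/rowP => i; rewrite !mxE -rmorphM mulrC divfK ?gt_eqF.
have nt : normc t <= s by rewrite nc_real gtr0_norm // /rho; lra.
have [n0 Hn] := gs z h' h'u s sr e e0.
exists n0 => // n /= nn; apply: le_trans (Hn n nn t nt).
apply: le_trans (nc_Re _).
have -> : complex.Re (g z h' t - (power_sum (line_coef (a z) h') n).[t]) =
    complex.Re (g z h' t) - complex.Re ((power_sum (line_coef (a z) h') n).[t]).
  by case: (g z h' t) => ? ?; case: (_.[_]).
rewrite (line_sum _ _ _ (leqnn n)) th /g th -to_complexD big_filter.
rewrite (_ : complex.Re (\sum_(_ <- _ | _) _) =
  \sum_(k <- box_seq m n | (degree k < n)%N) complex.Re (a z k) * mon h k) //.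
elim/big_ind2: _ => [|v1 u1 v2 u2 <- <-|k _] //.
  by case: u1 => ? ?; case: u2.
have -> : cmon (to_complex h) k = real_complex R (mon h k).
  by rewrite /cmon /mon rmorph_prod; apply: eq_bigr => i _; rewrite mxE rmorphXn.
by case: (a z k) => u v; rewrite /= mulr0 subr0.
Qed.

End wiener_of_complex.

(** * Relative errors of weighted means *)

Section relative_perturbation.
Variables (R : realType) (m : nat) (rho : R).
Hypothesis rho0 : 0 < rho.
Context d (Z : measurableType d).
Implicit Types (F : Z -> 'rV[R]_m -> R).

Lemma wiener_cst_le (c c' : R) F : c <= c' -> wiener rho (fun=> c) F ->
  wiener rho (fun=> c') F.
Proof. by move=> cc W; exact: wiener_le W (fun=> cc). Qed.

Lemma wiener_lt1 (e : R) F z h : wiener rho (fun=> e) F -> box rho h -> e < 1 ->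
  0 < 1 + F z h.
Proof.
move=> W hb e1; have := wiener_norm z W hb; rewrite ler_norml => /andP[h1 _]; lra.
Qed.

Lemma wiener_average (I : finType) (om : I -> Z -> R) (F : I -> Z -> 'rV[R]_m -> R)
    (C c : R) : 0 <= c -> (forall i, measurable_fun setT (om i)) ->
  (forall z, \sum_i `|om i z| <= C) ->
  (forall i, wiener rho (fun=> c) (F i)) ->
  wiener rho (fun=> C * c) (fun z h => \sum_i om i z * F i z h).
Proof.
move=> c0 mo oC W; have H i := wiener_scale rho0 (mo i) (W i).
apply: (wiener_le (wiener_sum rho0 (index_enum I) (P := predT) (fun i _ => H i))).
by move=> z; rewrite -mulr_suml ler_wpM2r.
Qed.

Lemma wiener_rel_mul (a b : R) F G : wiener rho (fun=> a) F -> wiener rho (fun=> b) G ->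
  wiener rho (fun=> a + b + a * b) (fun z h => (1 + F z h) * (1 + G z h) - 1).
Proof.
move=> WF WG; apply: (wiener_ext (wiener_add rho0 (wiener_add rho0 WF WG)
  (wiener_mul rho0 WF WG))) => z h hb; ring.
Qed.

Section weights.
Variables (I : finType) (c : I -> Z -> R) (x : I -> Z -> 'rV[R]_m -> R) (e : R).
Hypothesis c0 : forall i z, 0 <= c i z.
Hypothesis S0 : forall z, 0 < \sum_i c i z.
Hypothesis mc : forall i, measurable_fun setT (c i).
Hypothesis We : forall i, wiener rho (fun=> e) (x i).
Hypothesis e1 : 0 <= e < 1.

Let om i z := c i z / \sum_k c k z.
Definition mean_error z h := \sum_i om i z * x i z h.

Lemma weight_sum1 z : \sum_i c i z / (\sum_k c k z) = 1.
Proof. by rewrite -mulr_suml divff // gt_eqF. Qed.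

Lemma measurable_weight i : measurable_fun setT (fun z => c i z / \sum_k c k z).
Proof.
apply: measurable_funM => //.
(* The reciprocal of a positive function is written as [expR (- ln _)], a composition of measurable
   maps. *)
apply: (eq_measurable_fun (fun z => expR (- ln (\sum_k c k z)))) => [z _|].
  by rewrite expRN lnK // posrE.
apply: measurableT_comp => //; apply: measurableT_comp => //.
apply: measurableT_comp => //; exact: measurable_sum.
Qed.

Lemma wiener_mean_error : wiener rho (fun=> e) mean_error.
Proof.
have /andP[e0 _] := e1.
rewrite -[e]mul1r; apply: wiener_average => //.
- exact: measurable_weight.
- move=> z; rewrite -[leRHS](weight_sum1 z); apply: ler_sum => i _.
  by rewrite ger0_norm // divr_ge0 // ltW.
Qed.

Lemma weight_perturb z h : \sum_i c i z * (1 + x i z h) =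
  (\sum_i c i z) * (1 + mean_error z h).
Proof.
rewrite mulrDr mulr1 /mean_error mulr_sumr -big_split /=; apply: eq_bigr => i _.
by rewrite mulrDr mulr1 /om mulrA mulrCA divff ?mulr1 // gt_eqF.
Qed.

(** The change is om_i (x_i - mean) / (1 + mean). Its bound stays proportional to [om i], so it can
    be summed over [i] at no cost in the number of states. *)
Lemma wiener_weight i : wiener rho (fun z => om i z * (2 * e / (1 - e)))
  (fun z h => c i z * (1 + x i z h) / (\sum_k c k z * (1 + x k z h)) - om i z).
Proof.
have /andP[e0 e1'] := e1.
have W1 := wiener_mul rho0 (wiener_sub rho0 (We i) wiener_mean_error)
  (wiener_inv rho0 e1' wiener_mean_error).
have := wiener_scale rho0 (measurable_weight i) W1 => W2.
apply: (wiener_ext (wiener_le W2 _)) => [z|z h hb].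
  rewrite ger0_norm; last by rewrite divr_ge0 // ltW.
  by rewrite /om /cst (_ : e + e = 2 * e) //; ring.
rewrite weight_perturb.
have h1 : 1 + mean_error z h != 0 by rewrite gt_eqF // (wiener_lt1 z wiener_mean_error).
have h2 : \sum_k c k z != 0 by rewrite gt_eqF.
by rewrite /om; field; rewrite h1 h2.
Qed.

End weights.
End relative_perturbation.

(** * Windows of observations *)

Section tuples.
Context d (T : measurableType d).

Definition tuple_belast n (t : n.+1.-tuple T) : n.-tuple T :=
  [tuple tnth t (widen_ord (leqnSn n) i) | i < n].

Lemma tuple_belastE n (t : n.+1.-tuple T) : tuple_belast t = take n t :> seq T.
Proof.
apply: (@eq_from_nth _ (thead t)).
  by rewrite size_tuple size_take size_tuple ltnSn.
move=> i; rewrite size_tuple => iltn.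
have e : i = Ordinal iltn by [].
rewrite {1}e -tnth_nth tnth_mktuple.
by rewrite nth_take // (tnth_nth (thead t)).
Qed.

Lemma measurable_tuple_belast n : measurable_fun setT (@tuple_belast n).
Proof.
apply/measurable_fun_tnthP => i; rewrite (_ : _ \o _ = (@tnth _ _)^~ (widen_ord (leqnSn n) i)).
  exact: measurable_tnth.
by apply/funext => t /=; rewrite tnth_mktuple.
Qed.

Definition tuple_behead n (t : n.+1.-tuple T) : n.-tuple T := [tuple of behead t].

Lemma measurable_tuple_behead n : measurable_fun setT (@tuple_behead n).
Proof. exact: measurable_behead. Qed.

Lemma measurable_thead n : measurable_fun setT (@thead n T).
Proof. exact: measurable_tnth. Qed.

Lemma tuple_consE n (t : n.+1.-tuple T) : t = thead t :: tuple_behead t :> seq T.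
Proof. by rewrite {1}(tuple_eta t). Qed.

End tuples.

(** * Backward vectors and conditional transition kernels *)

Section backward_weights.
Variables (R : realType) (m l : nat).
Variables (P : 'rV[R]_m -> 'I_l -> 'I_l -> R) (q : 'rV[R]_m -> 'I_l -> R -> R).

(* [bw h t i] is the density of the observations [t] given that the hidden
   chain starts at [i], and [pd w h t] their density under the initial law [w h].
   The quotient [ratio h t i] is the conditional density of the last observation. *)
Fixpoint bw (h : 'rV[R]_m) (t : seq R) (i : 'I_l) : R :=
  if t is z :: t' then q h i z * \sum_j P h i j * bw h t' j else 1.

Definition pd (w : 'rV[R]_m -> 'I_l -> R) (h : 'rV[R]_m) (t : seq R) : R :=
  \sum_i w h i * bw h t i.

(** The law of the next hidden state given the present one, [i], and the observations [t] from the
    next time on. *)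
Definition kernel (h : 'rV[R]_m) (t : seq R) (i j : 'I_l) : R :=
  P h i j * bw h t j / \sum_k P h i k * bw h t k.

Definition all_but_last (t : seq R) : seq R := take (size t).-1 t.

Definition ratio (h : 'rV[R]_m) (t : seq R) (i : 'I_l) : R :=
  bw h t i / bw h (all_but_last t) i.

Lemma all_but_last_cons z t : (0 < size t)%N ->
  all_but_last (z :: t) = z :: all_but_last t.
Proof. by rewrite /all_but_last /=; case: (size t). Qed.

Variable (i0 : 'I_l).

Lemma bw_gt0 h t i : (forall i j, 0 < P h i j) -> (forall i z, 0 < q h i z) ->
  0 < bw h t i.
Proof.
move=> P0 q0; elim: t i => [|z t IH] i //=; rewrite mulr_gt0 //.
rewrite (bigD1 i0) //= ltr_pwDl ?mulr_gt0 // sumr_ge0 // => j _.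
by rewrite mulr_ge0 // ltW.
Qed.

(** The channel factor of the new first observation cancels, so prepending it acts on [ratio] as
    averaging by a stochastic matrix. This averaging produces the forgetting. *)
Lemma ratio_cons h z t i : (forall i j, 0 < P h i j) -> (forall i z, 0 < q h i z) ->
  (0 < size t)%N ->
  ratio h (z :: t) i = \sum_j kernel h (all_but_last t) i j * ratio h t j.
Proof.
move=> P0 q0 st; have b0 t' j : 0 < bw h t' j by exact: bw_gt0.
rewrite /ratio all_but_last_cons //= /kernel.
rewrite invfM mulrACA divff ?mul1r ?gt_eqF // mulr_suml.
apply: eq_bigr => j _.
have B0 : bw h (all_but_last t) j != 0 by rewrite gt_eqF.
have S0 : \sum_k P h i k * bw h (all_but_last t) k != 0.
  rewrite gt_eqF // (bigD1 i0) //= ltr_pwDl ?mulr_gt0 // sumr_ge0 // => k _.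
  by rewrite mulr_ge0 // ltW.
by field; rewrite S0 B0.
Qed.

End backward_weights.

(** * Integrals over windows of observations *)

Lemma ge0_integral_lincomb d (T : measurableType d) (R : realType)
    (mu : {measure set T -> \bar R}) (I : finType) (a : I -> R) (f : I -> T -> R) :
  (forall i, 0 <= a i) -> (forall i, measurable_fun setT (f i)) ->
  (forall i x, 0 <= f i x) ->
  (\int[mu]_x (\sum_i a i * f i x)%:E = \sum_i (a i)%:E * \int[mu]_x (f i x)%:E)%E.
Proof.
move=> a0 mf f0; under eq_integral => x _ do rewrite -sumEFin.
rewrite ge0_integral_sum //.
- apply: eq_bigr => i _; under eq_integral => x _ do rewrite EFinM.
  rewrite ge0_integralZl // ?lee_fin //; first exact/measurable_EFinP.
  by move=> x _; rewrite lee_fin.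
- by move=> i; apply/measurable_EFinP; apply: measurable_funM.
- by move=> i x _; rewrite lee_fin mulr_ge0.
Qed.

(** Nonnegative weights commute with positive and negative parts, so an identity for nonnegative
    test functions extends to signed ones without integrability. *)
Lemma integral_transfer d1 d2 (T1 : measurableType d1) (T2 : measurableType d2)
    (R : realType) (mu1 : {measure set T1 -> \bar R}) (mu2 : {measure set T2 -> \bar R})
    (b1 : T1 -> R) (b2 : T2 -> R) (p : T1 -> T2) (f : T2 -> R) :
  (forall x, 0 <= b1 x) -> (forall x, 0 <= b2 x) -> measurable_fun setT f ->
  (forall g : T2 -> R, (forall x, 0 <= g x) -> measurable_fun setT g ->
    (\int[mu1]_x (b1 x * g (p x))%:E = \int[mu2]_x (b2 x * g x)%:E)%E) ->
  (\int[mu1]_x (b1 x * f (p x))%:E = \int[mu2]_x (b2 x * f x)%:E)%E.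
Proof.
move=> b10 b20 mf H; rewrite integralE [RHS]integralE.
have pE (b c : R) : 0 <= b -> (maxe (b * c)%:E 0 = (b * Num.max c 0)%:E)%E.
  by move=> b0; rewrite -EFin_max maxr_pMr // mulr0.
have nE (b c : R) : 0 <= b -> (maxe (- (b * c)%:E) 0 = (b * Num.max (- c) 0)%:E)%E.
  by move=> b0; rewrite -EFinN -mulrN pE.
have Hp := H (fun x => Num.max (f x) 0) _ _.
have Hn := H (fun x => Num.max (- f x) 0) _ _.
congr (_ - _)%E.
- transitivity (\int[mu1]_x (b1 x * Num.max (f (p x)) 0)%:E)%E.
    by apply: eq_integral => x _; rewrite funeposE pE.
  rewrite Hp; first by apply: eq_integral => x _; rewrite funeposE pE.
    by move=> x; rewrite le_max lexx orbT.
  exact: measurable_maxr.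
- transitivity (\int[mu1]_x (b1 x * Num.max (- f (p x)) 0)%:E)%E.
    by apply: eq_integral => x _; rewrite funenegE nE.
  rewrite Hn; first by apply: eq_integral => x _; rewrite funenegE nE.
    by move=> x; rewrite le_max lexx orbT.
  by apply: measurable_maxr => //; exact: measurableT_comp.
Qed.

Section tuple_integrals.
Context d (T : measurableType d) (R : realType).
Variable mu : {sigma_finite_measure set T -> \bar R}.
Variables (n : nat) (f : n.+1.-tuple T -> \bar R).
Hypothesis mf : measurable_fun setT f.
Hypothesis f0 : forall t, (0 <= f t)%E.

Let mc := @measurable_tuple_consp _ T n.

Let E0 : (\int[tuple_measure mu n.+1]_t f t =
  \int[mu \x tuple_measure mu n]_p f (tuple_consp p))%E.
Proof. by rewrite /= /cons_measure ge0_integral_pushforward // preimage_setT. Qed.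

Let mfc : measurable_fun setT (fun p : T * n.-tuple T => f (tuple_consp p)).
Proof. exact: (measurableT_comp mf mc). Qed.

Lemma integral_tuple_cons : (\int[tuple_measure mu n.+1]_t f t =
  \int[mu]_z \int[tuple_measure mu n]_t f (tuple_consp (z, t)))%E.
Proof. by rewrite E0 fubini_tonelli1. Qed.

Lemma integral_tuple_consC : (\int[tuple_measure mu n.+1]_t f t =
  \int[tuple_measure mu n]_t \int[mu]_z f (tuple_consp (z, t)))%E.
Proof. by rewrite E0 fubini_tonelli2. Qed.

End tuple_integrals.

Lemma measurable_tuple_consp2 d (T : measurableType d) n (z : T) :
  measurable_fun setT (fun t : n.-tuple T => tuple_consp (z, t)).
Proof.
apply: (@measurable_comp _ _ _ _ _ _ setT (@tuple_consp _ T n) setT (fun t => (z, t))) => //.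
- exact: measurable_tuple_consp.
- exact: measurable_fun_pair.
Qed.

Lemma tuple_belast_cons d (T : measurableType d) n (z : T) (t : n.+1.-tuple T) :
  tuple_belast (tuple_consp (z, t)) = tuple_consp (z, tuple_belast t).
Proof. by apply: val_inj; rewrite /= !tuple_belastE. Qed.

(** * Consistency of the marginals *)

Section marginals.
Variables (R : realType) (m l : nat).
Variables (P : 'rV[R]_m -> 'I_l -> 'I_l -> R) (w : 'rV[R]_m -> 'I_l -> R)
  (q : 'rV[R]_m -> 'I_l -> R -> R) (h : 'rV[R]_m).
Hypothesis P_ge0 : forall i j, 0 <= P h i j.
Hypothesis P_sum : forall i, \sum_j P h i j = 1.
Hypothesis q_ge0 : forall i z, 0 <= q h i z.
Hypothesis q_meas : forall i, measurable_fun setT (q h i).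
Hypothesis q_mass : forall i, (\int[@lebesgue_measure R]_z (q h i z)%:E = 1)%E.
Hypothesis w_ge0 : forall i, 0 <= w h i.
Hypothesis w_sum : \sum_i w h i = 1.
Hypothesis w_stationary : forall j, \sum_i w h i * P h i j = w h j.

Local Notation mu := (@lebesgue_measure R).
Local Notation mun n := (tuple_measure mu n).
Local Notation bw := (bw P q).
Local Notation pd := (pd P q w h).

Lemma bw_ge0 t i : 0 <= bw h t i.
Proof.
elim: t i => [//|z t IH] i /=; rewrite mulr_ge0 // sumr_ge0 // => j _.
exact: mulr_ge0.
Qed.

Lemma pd_ge0 t : 0 <= pd t.
Proof. by rewrite sumr_ge0 // => i _; rewrite mulr_ge0 // bw_ge0. Qed.

Lemma measurable_bw n i : measurable_fun setT (fun t : n.-tuple R => bw h t i).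
Proof.
elim: n i => [|n IH] i.
  apply: (eq_measurable_fun (fun=> 1 : R)); last exact: measurable_cst.
  by move=> t _; rewrite tuple0.
apply: (eq_measurable_fun (fun t : n.+1.-tuple R => q h i (thead t) *
    \sum_j P h i j * bw h (tuple_behead t) j)).
  by move=> t _; rewrite (tuple_consE t).
apply: measurable_funM.
  exact: (measurableT_comp (q_meas i) (@measurable_thead _ R n)).
apply: measurable_sum => j; apply: measurable_funM => //.
exact: (measurableT_comp (IH j) (@measurable_tuple_behead _ R n)).
Qed.

Lemma measurable_pd n : measurable_fun setT (fun t : n.-tuple R => pd t).
Proof. by apply: measurable_sum => i; apply: measurable_funM => //; exact: measurable_bw. Qed.

(** The first observation is peeled off until only the one to be integrated out is left; its density
    under the channel has mass 1 and the rows of [P] sum to 1. *)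
Lemma bw_marginal n i (g : n.-tuple R -> R) :
  (forall t, 0 <= g t) -> measurable_fun setT g ->
  (\int[mun n.+1]_t (bw h t i * g (tuple_belast t))%:E =
   \int[mun n]_t (bw h t i * g t)%:E)%E.
Proof.
have mbf k j (f : k.-tuple R -> R) : measurable_fun setT f ->
    measurable_fun setT (fun t : k.-tuple R => (bw h t j * f t)%:E).
  by move=> mf; apply/measurable_EFinP; apply: measurable_funM => //; exact: measurable_bw.
have mbe k (f : k.-tuple R -> R) : measurable_fun setT f ->
    measurable_fun setT (fun t : k.+1.-tuple R => f (tuple_belast t)).
  by move=> mf; exact: (measurableT_comp mf (@measurable_tuple_belast _ R k)).
elim: n i g => [|n IH] i g g0 mg.
  rewrite integral_tuple_cons; last 2 first.
  - by apply: mbf; exact: mbe.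
  - by move=> t; rewrite lee_fin mulr_ge0 // bw_ge0.
  rewrite [RHS]integral_dirac //; last by apply: mbf.
  rewrite diracT mul1e.
  transitivity (\int[mu]_z ((g [tuple])%:E * (q h i z)%:E))%E.
    apply: eq_integral => z _; rewrite integral_dirac // ?diracT ?mul1e.
      rewrite (tuple0 (tuple_belast _)) /=; under eq_bigr => j _ do rewrite mulr1.
      by rewrite P_sum mulr1 mulrC EFinM.
    apply: (measurableT_comp (mbf _ i _ (mbe _ _ mg))).
    exact: measurable_tuple_consp2.
  rewrite ge0_integralZl //.
  - by rewrite q_mass mule1 mul1r.
  - exact: (measurableT_comp (@EFin_measurable R setT) (q_meas i)).
  - by move=> z _; rewrite lee_fin.
  - by rewrite lee_fin.
rewrite integral_tuple_cons; last 2 first.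
- by apply: mbf; exact: mbe.
- by move=> t; rewrite lee_fin mulr_ge0 // bw_ge0.
rewrite [RHS]integral_tuple_cons; last 2 first.
- exact: mbf.
- by move=> t; rewrite lee_fin mulr_ge0 // bw_ge0.
apply: eq_integral => z _.
pose gz (t : n.-tuple R) := g (tuple_consp (z, t)).
have mgz : measurable_fun setT gz by exact: (measurableT_comp mg (@measurable_tuple_consp2 _ R n z)).
have gz0 t : 0 <= gz t by exact: g0.
transitivity (\int[mun n.+1]_t (\sum_j (q h i z * P h i j) *
    (bw h t j * gz (tuple_belast t)))%:E)%E.
  apply: eq_integral => t _; rewrite tuple_belast_cons /= -/(gz _); congr EFin.
  by rewrite mulr_sumr mulr_suml; apply: eq_bigr => j _; ring.
transitivity (\int[mun n]_t (\sum_j (q h i z * P h i j) * (bw h t j * gz t))%:E)%E; last first.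
  apply: eq_integral => t _ /=; rewrite -/(gz _); congr EFin.
  by rewrite mulr_sumr mulr_suml; apply: eq_bigr => j _; ring.
rewrite !ge0_integral_lincomb //.
- by apply: eq_bigr => j _; rewrite IH.
- by move=> j; rewrite mulr_ge0.
- by move=> j; apply/measurable_EFinP; exact: mbf.
- by move=> j t; rewrite mulr_ge0 // bw_ge0.
- by move=> j; rewrite mulr_ge0.
- by move=> j; apply/measurable_EFinP; apply: mbf; exact: mbe.
- by move=> j t; rewrite mulr_ge0 // bw_ge0.
Qed.

Lemma bw_mass n i : (\int[mun n]_t (bw h t i)%:E = 1)%E.
Proof.
elim: n => [|n IH].
  rewrite integral_dirac ?diracT ?mul1e //.
  by apply/measurable_EFinP; exact: measurable_bw.
rewrite -IH.
have := @bw_marginal n i (cst 1) (fun=> ler01) (measurable_cst _).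
under eq_integral => t _ do rewrite /= mulr1.
by under [in RHS]eq_integral => t _ do rewrite /= mulr1.
Qed.

Lemma pd_marginal_last n (g : n.-tuple R -> R) : measurable_fun setT g ->
  (\int[mun n.+1]_t (pd t * g (tuple_belast t))%:E = \int[mun n]_t (pd t * g t)%:E)%E.
Proof.
move=> mg; apply: (@integral_transfer _ _ _ _ R (mun n.+1) (mun n) (fun t : n.+1.-tuple R => pd t)
  (fun t : n.-tuple R => pd t) (@tuple_belast _ R n) g) => //; try by move=> t; exact: pd_ge0.
move=> {mg}g g0 mg.
transitivity (\int[mun n.+1]_t (\sum_i w h i * (bw h t i * g (tuple_belast t)))%:E)%E.
  by apply: eq_integral => t _; rewrite mulr_suml; congr EFin; apply: eq_bigr => i _; rewrite mulrA.
transitivity (\int[mun n]_t (\sum_i w h i * (bw h t i * g t))%:E)%E; last first.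
  by apply: eq_integral => t _; rewrite mulr_suml; congr EFin; apply: eq_bigr => i _; rewrite mulrA.
rewrite !ge0_integral_lincomb //.
- by apply: eq_bigr => i _; rewrite bw_marginal.
- by move=> i; apply: measurable_funM => //; exact: measurable_bw.
- by move=> i t; rewrite mulr_ge0 // bw_ge0.
- move=> i; apply: measurable_funM; first exact: measurable_bw.
  exact: (measurableT_comp mg (@measurable_tuple_belast _ R n)).
- by move=> i t; rewrite mulr_ge0 // bw_ge0.
Qed.

Lemma pd_mass n : (\int[mun n]_t (pd t)%:E = 1)%E.
Proof.
rewrite ge0_integral_lincomb //.
- under eq_bigr => i _ do rewrite bw_mass mule1.
  by rewrite sumEFin w_sum.
- by move=> i; exact: measurable_bw.
- by move=> i t; exact: bw_ge0.
Qed.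

(** Integrating out the first observation advances the initial law by one step of the chain, which
    stationarity undoes. *)
Lemma pd_marginal_first n (g : n.-tuple R -> R) : measurable_fun setT g ->
  (\int[mun n.+1]_t (pd t * g (tuple_behead t))%:E = \int[mun n]_t (pd t * g t)%:E)%E.
Proof.
move=> mg; apply: (@integral_transfer _ _ _ _ R (mun n.+1) (mun n) (fun t : n.+1.-tuple R => pd t)
  (fun t : n.-tuple R => pd t) (@tuple_behead _ R n) g) => //; try by move=> t; exact: pd_ge0.
move=> {mg}g g0 mg.
rewrite integral_tuple_consC; last 2 first.
- apply/measurable_EFinP; apply: measurable_funM; first exact: measurable_pd.
  exact: (measurableT_comp mg (@measurable_tuple_behead _ R n)).
- by move=> t; rewrite lee_fin mulr_ge0 // pd_ge0.
apply: eq_integral => t _.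
transitivity (\int[mu]_z (\sum_i (w h i * (\sum_j P h i j * bw h t j) * g t) * q h i z)%:E)%E.
  apply: eq_integral => z _; congr EFin; rewrite /pd mulr_suml; apply: eq_bigr => i _.
  rewrite [X in _ * g X](_ : _ = t); last exact: val_inj.
  by rewrite /=; ring.
rewrite ge0_integral_lincomb //.
- under eq_bigr => i _ do rewrite q_mass mule1.
  rewrite sumEFin -mulr_suml; congr EFin; congr (_ * _).
  under eq_bigr => i _ do rewrite mulr_sumr.
  rewrite exchange_big /=; apply: eq_bigr => j _.
  by rewrite -[w h j]w_stationary mulr_suml; apply: eq_bigr => i _; rewrite mulrA.
- move=> i; rewrite mulr_ge0 // mulr_ge0 // sumr_ge0 // => j _.
  by rewrite mulr_ge0 // bw_ge0.
Qed.

Lemma pd_first n (g : R -> R) : (forall z, 0 <= g z) -> measurable_fun setT g ->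
  (\int[mun n.+1]_t (pd t * g (thead t))%:E =
   \sum_i (w h i)%:E * \int[mu]_z (q h i z * g z)%:E)%E.
Proof.
move=> g0 mg; rewrite integral_tuple_cons; last 2 first.
- apply/measurable_EFinP; apply: measurable_funM; first exact: measurable_pd.
  exact: (measurableT_comp mg (@measurable_thead _ R n)).
- by move=> t; rewrite lee_fin mulr_ge0 // pd_ge0.
rewrite -ge0_integral_lincomb //; last 2 first.
- by move=> i; exact: (measurable_funM (q_meas i) mg).
- by move=> i z; rewrite mulr_ge0.
apply: eq_integral => z _.
transitivity (\int[mun n]_t (\sum_j (\sum_i w h i * q h i z * P h i j * g z) * bw h t j)%:E)%E.
  apply: eq_integral => t _; congr EFin; rewrite /pd mulr_suml.
  under [RHS]eq_bigr => j _ do rewrite mulr_suml.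
  rewrite [RHS]exchange_big /=; apply: eq_bigr => i _.
  rewrite theadE mulr_sumr mulr_sumr mulr_suml; apply: eq_bigr => j _; ring.
rewrite ge0_integral_lincomb //.
- under eq_bigr => j _ do rewrite bw_mass mule1.
  rewrite sumEFin; congr EFin; rewrite exchange_big /=; apply: eq_bigr => i _.
  transitivity ((w h i * (q h i z * g z)) * \sum_j P h i j).
    by rewrite mulr_sumr; apply: eq_bigr => j _; ring.
  by rewrite P_sum mulr1.
- by move=> j; rewrite sumr_ge0 // => i _; rewrite mulr_ge0 // !mulr_ge0.
- by move=> j; exact: measurable_bw.
- by move=> j t; exact: bw_ge0.
Qed.

End marginals.

(** * The density as a sum over hidden paths *)

Section path_sums.
Variable (T : finType).

Definition path_cons n (p : T * {ffun 'I_n -> T}) : {ffun 'I_n.+1 -> T} :=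
  [ffun k => if unlift ord0 k is Some j then p.2 j else p.1].

Definition path_uncons n (y : {ffun 'I_n.+1 -> T}) : T * {ffun 'I_n -> T} :=
  (y ord0, [ffun k => y (lift ord0 k)]).

Lemma path_cons0 n p : @path_cons n p ord0 = p.1.
Proof. by rewrite ffunE unlift_none. Qed.

Lemma path_consS n p k : @path_cons n p (lift ord0 k) = p.2 k.
Proof. by rewrite ffunE liftK. Qed.

Lemma path_consK n : cancel (@path_cons n) (@path_uncons n).
Proof.
move=> [i y]; rewrite /path_uncons path_cons0; congr pair.
by apply/ffunP => k; rewrite ffunE path_consS.
Qed.

Lemma path_unconsK n : cancel (@path_uncons n) (@path_cons n).
Proof.
move=> y; apply/ffunP => k; rewrite ffunE.
by case: unliftP => [j ->|->] //=; rewrite ffunE.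
Qed.

Lemma sum_paths (R : realType) n (F : {ffun 'I_n.+1 -> T} -> R) :
  \sum_y F y = \sum_i \sum_(y : {ffun 'I_n -> T}) F (path_cons (i, y)).
Proof.
rewrite pair_bigA /= (reindex (@path_cons n)) /=.
  by apply: eq_bigr => -[i y] _.
by exists (@path_uncons n) => p _; [exact: path_consK|exact: path_unconsK].
Qed.

End path_sums.

Section density.
Variables (R : realType) (m l : nat).
Variables (P : 'rV[R]_m -> 'I_l -> 'I_l -> R) (w : 'rV[R]_m -> 'I_l -> R)
  (q : 'rV[R]_m -> 'I_l -> R -> R) (h : 'rV[R]_m).
Hypothesis P_sum : forall i, \sum_j P h i j = 1.

(** The initial coefficients are arbitrary so that the induction can absorb the first symbol and the
    first transition into [c']. *)
Lemma sum_paths_bw n (c : 'I_l -> R) (z : n.+1.-tuple R) :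
  \sum_(y : {ffun 'I_n.+1 -> 'I_l})
    c (y ord0) * (\prod_(k < n) P h (y (widen_ord (leqnSn n) k)) (y (lift ord0 k))) *
    (\prod_(k < n.+1) q h (y k) (tnth z k)) = \sum_i c i * bw P q h z i.
Proof.
elim: n c z => [|n IH] c z; rewrite sum_paths; apply: eq_bigr => i _.
  have one (F : {ffun 'I_0 -> 'I_l} -> R) : \sum_y F y = F [ffun k => i].
    rewrite (big_pred1 [ffun k => i]) // => y; apply/esym/eqP/ffunP => -[].
    by [].
  rewrite one big_ord0 big_ord1 mulr1 path_cons0 /= (tuple_consE z) /=.
  have -> : behead z = [::] by apply: size0nil; rewrite size_behead size_tuple.
  rewrite /=; under eq_bigr => j _ do rewrite mulr1.
  by rewrite P_sum mulr1.
rewrite (tuple_consE z) /= !mulr_sumr.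
pose c' j := c i * q h i (thead z) * P h i j.
transitivity (\sum_j c' j * bw P q h (tuple_behead z) j); last first.
  by apply: eq_bigr => j _; rewrite /c'; ring.
rewrite -IH; apply: eq_bigr => y _.
have E1 : \prod_(k < n.+1) P h (path_cons (i, y) (widen_ord (leqnSn n.+1) k))
    (path_cons (i, y) (lift ord0 k)) = P h i (y ord0) *
    \prod_(k < n) P h (y (widen_ord (leqnSn n) k)) (y (lift ord0 k)).
  rewrite big_ord_recl; congr (_ * _).
    rewrite path_consS (_ : widen_ord _ _ = ord0) ?path_cons0 //; exact: val_inj.
  apply: eq_bigr => k _.
  rewrite (_ : widen_ord _ _ = lift ord0 (widen_ord (leqnSn n) k)); last exact: val_inj.
  by rewrite !path_consS.
have E2 : \prod_(k < n.+2) q h (path_cons (i, y) k) (tnth z k) = q h i (thead z) *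
    \prod_(k < n.+1) q h (y k) (tnth (tuple_behead z) k).
  rewrite big_ord_recl path_cons0; congr (_ * _); apply: eq_bigr => k _.
  by rewrite path_consS {1}(tuple_eta z) tnthS.
by rewrite E1 E2 path_cons0 /c' /=; ring.
Qed.

Lemma hmc_density_pd (Pm : 'M[R]_l) (p : 'rV[R]_l) (qm : 'I_l -> R -> R) n
    (z : n.+1.-tuple R) :
  (forall i j, Pm i j = P h i j) -> (forall i, p 0 i = w h i) ->
  (forall i x, qm i x = q h i x) ->
  hmc_density Pm p qm z = pd P q w h z.
Proof.
move=> PE pE qE; rewrite /pd -sum_paths_bw; apply: eq_bigr => y _.
rewrite /path_probability /channel_density pE; congr (_ * _ * _).
  by apply: eq_bigr => k _; rewrite PE.
by apply: eq_bigr => k _; rewrite qE.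
Qed.

End density.

(** * Chains close to one with positive transition probabilities *)

Section perturbed_chain.
Variables (R : realType) (m l : nat) (rho : R).
Hypothesis rho0 : 0 < rho.
Variables (P : 'rV[R]_m -> 'I_l -> 'I_l -> R) (w : 'rV[R]_m -> 'I_l -> R)
  (q : 'rV[R]_m -> 'I_l -> R -> R) (i0 : 'I_l) (kap : R).
Hypothesis kap01 : 0 < kap <= 1.
Hypothesis P_comparable : forall i j i' j', kap * P 0 i' j' <= P 0 i j.
Hypothesis P0_gt0 : forall i j, 0 < P 0 i j.
Hypothesis P0_sum : forall i, \sum_j P 0 i j = 1.
Hypothesis w0_gt0 : forall i, 0 < w 0 i.
Hypothesis q0_gt0 : forall i z, 0 < q 0 i z.
Hypothesis q0_meas : forall i, measurable_fun setT (q 0 i).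

(* [eta] bounds the relative error of the backward vectors and [del] that of
   the data; one step of the chain contracts errors by [1 - kap], which leaves
   [kap * eta = 4 * del] for the error of the data. *)
Let eta : R := kap / 256.
Let del : R := kap * eta / 4.
(** The relative error of a product of factors with errors [del] and [eta]. The rate [rc] below
    sacrifices half of the contraction [kap] to the perturbation of the kernel. *)
Let eps : R := del + eta + del * eta.
Let rc : R := 1 - kap / 2.

Hypothesis WP : forall i j,
  wiener rho (fun _ : unit => del) (fun _ h => P h i j / P 0 i j - 1).
Hypothesis Ww : forall i,
  wiener rho (fun _ : unit => del) (fun _ h => w h i / w 0 i - 1).
Hypothesis Wq : forall i,
  wiener rho (fun _ : R => del) (fun z h => q h i z / q 0 i z - 1).

Local Notation "n .-tup" := (n.-tuple R) (at level 2, format "n .-tup").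
Local Notation bw := (bw P q).
Local Notation kernel := (kernel P q).
Local Notation ratio := (ratio P q).

Lemma kap_gt0 : 0 < kap. Proof. by case/andP: kap01. Qed.
Lemma kap_le1 : kap <= 1. Proof. by case/andP: kap01. Qed.

Lemma eta_gt0 : 0 < eta.
Proof. by have := kap_gt0; rewrite /eta; lra. Qed.

Lemma eta_small : eta <= 1 / 256.
Proof. by have := kap_le1; rewrite /eta; lra. Qed.

Lemma del_gt0 : 0 < del.
Proof. by rewrite /del divr_gt0 // mulr_gt0 ?kap_gt0 ?eta_gt0. Qed.

Lemma del_le : del <= eta / 4.
Proof.
have := kap_le1; have := eta_gt0; rewrite /del => h1 h2.
by rewrite ler_pM2r ?invr_gt0 // ler_piMl // ltW.
Qed.

Lemma del_eta : del * eta <= eta / 256.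
Proof.
have := del_le; have := del_gt0; have := eta_gt0; have := eta_small => h1 h2 h3 h4.
have : del * eta <= eta / 4 * (1 / 256) by apply: ler_pM => //; lra.
lra.
Qed.

Lemma eps_ge0 : 0 <= eps.
Proof.
have := del_gt0; have := eta_gt0 => h1 h2.
have := mulr_gt0 h2 h1; rewrite /eps; lra.
Qed.

Lemma eps_le : eps <= 13 / 10 * eta.
Proof. by have := del_eta; have := del_le; have := eta_gt0; rewrite /eps; lra. Qed.

Lemma eps_small : eps <= 1 / 190.
Proof. by have := eps_le; have := eta_small; lra. Qed.

Lemma P_gt0 h i j : box rho h -> 0 < P h i j.
Proof.
move=> hb; have d1 : del < 1 by have := del_le; have := eta_small; lra.
have := wiener_lt1 tt (WP i j) hb d1; rewrite addrC subrK.
by rewrite pmulr_lgt0 // invr_gt0.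
Qed.

Lemma w_gt0 h i : box rho h -> 0 < w h i.
Proof.
move=> hb; have d1 : del < 1 by have := del_le; have := eta_small; lra.
have := wiener_lt1 tt (Ww i) hb d1; rewrite addrC subrK.
by rewrite pmulr_lgt0 // invr_gt0.
Qed.

Lemma q_gt0 h i z : box rho h -> 0 < q h i z.
Proof.
move=> hb; have d1 : del < 1 by have := del_le; have := eta_small; lra.
have := wiener_lt1 z (Wq i) hb d1; rewrite addrC subrK.
by rewrite pmulr_lgt0 // invr_gt0.
Qed.

Lemma bw_pos h t i : box rho h -> 0 < bw h t i.
Proof.
by move=> hb; apply: (bw_gt0 i0) => *; [exact: P_gt0|exact: q_gt0].
Qed.

Lemma bw0_pos t i : 0 < bw 0 t i.
Proof. exact: (bw_gt0 i0). Qed.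

Lemma sum_gt0 (f : 'I_l -> R) : (forall i, 0 < f i) -> 0 < \sum_i f i.
Proof.
move=> f0; rewrite (bigD1 i0) //= ltr_pwDl // sumr_ge0 // => j _.
exact: ltW.
Qed.

Lemma measurable_bw0 n i : measurable_fun setT (fun t : n.-tup => bw 0 t i).
Proof. exact: measurable_bw. Qed.

Let kw (i : 'I_l) n (j : 'I_l) (t : n.-tup) : R := P 0 i j * bw 0 t j.
Let kernel0 n (i j : 'I_l) (t : n.-tup) : R := kw i j t / \sum_k kw i k t.
Let sw n (j : 'I_l) (t : n.-tup) : R := bw 0 t j / \sum_k bw 0 t k.

Lemma kw_gt0 i n j (t : n.-tup) : 0 < kw i j t.
Proof. by rewrite mulr_gt0 // bw0_pos. Qed.

Lemma measurable_kw i n j : measurable_fun setT (@kw i n j).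
Proof. by apply: measurable_funM => //; exact: measurable_bw0. Qed.

Lemma measurable_kernel0 n i j : measurable_fun setT (@kernel0 n i j).
Proof.
apply: measurable_weight => [t|k]; first by apply: sum_gt0 => k; exact: kw_gt0.
exact: measurable_kw.
Qed.

Lemma measurable_sw n j : measurable_fun setT (@sw n j).
Proof.
apply: measurable_weight => [t|k]; first by apply: sum_gt0 => k; exact: bw0_pos.
exact: measurable_bw0.
Qed.

Lemma kernel0_sum n i (t : n.-tup) : \sum_j kernel0 i j t = 1.
Proof.
rewrite /kernel0 -mulr_suml divff // gt_eqF // sum_gt0 // => k; exact: kw_gt0.
Qed.

Lemma sw_sum n (t : n.-tup) : \sum_j sw j t = 1.
Proof.
rewrite /sw -mulr_suml divff // gt_eqF // sum_gt0 // => k; exact: bw0_pos.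
Qed.

Lemma kernel0_ge0 n i j (t : n.-tup) : 0 <= kernel0 i j t.
Proof.
rewrite divr_ge0 // ltW ?kw_gt0 // sum_gt0 // => k; exact: kw_gt0.
Qed.

Lemma sw_ge0 n j (t : n.-tup) : 0 <= sw j t.
Proof. by rewrite divr_ge0 // ltW ?bw0_pos // sum_gt0 // => k; exact: bw0_pos. Qed.

(** Doeblin minorization. After clearing denominators it says that kap times the sum of the P_ik b_k
    is at most P_ij times the sum of the b_k, which holds term by term by comparability. *)
Lemma kernel0_sw n i j (t : n.-tup) : kap * sw j t <= kernel0 i j t.
Proof.
have S0 : 0 < \sum_k bw 0 t k by apply: sum_gt0 => k; exact: bw0_pos.
have K0 : 0 < \sum_k kw i k t by apply: sum_gt0 => k; exact: kw_gt0.
rewrite /kernel0 /sw mulrA ler_pdivrMr // mulrAC ler_pdivlMr //.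
rewrite mulrAC /kw [leRHS]mulrAC ler_wpM2r ?(ltW (bw0_pos _ _)) //.
rewrite !mulr_sumr; apply: ler_sum => k _.
by rewrite mulrA ler_wpM2r ?(ltW (bw0_pos _ _)).
Qed.

Lemma kernel0_sw_sum n i (t : n.-tup) :
  \sum_j `|kernel0 i j t - kap * sw j t| = 1 - kap.
Proof.
under eq_bigr => j _ do rewrite ger0_norm ?subr_ge0 ?kernel0_sw //.
by rewrite sumrB kernel0_sum -mulr_sumr sw_sum mulr1.
Qed.

Section step.
Variables (n : nat) (u : 'I_l -> n.-tup -> 'rV[R]_m -> R).
Hypothesis Wu : forall j, wiener rho (fun=> eta) (u j).

Definition transition_error i j h := P h i j / P 0 i j - 1.
Local Notation e := transition_error.
Definition entry_error i j (t : n.-tup) h := (1 + e i j h) * (1 + u j t h) - 1.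
Local Notation x := entry_error.

Lemma wiener_entry_error i j : wiener rho (fun=> eps) (x i j).
Proof.
apply: wiener_rel_mul => //.
exact: (wiener_comp (@measurable_cst _ _ _ _ setT tt) (WP i j)).
Qed.

Definition step_error i (t : n.-tup) h := mean_error (@kw i n) (x i) t h.
(** The share of [step_error] that comes from the minorizing law [sw] and is therefore the same for
    all starting states. *)
Definition common_error (t : n.-tup) h := kap * \sum_j sw j t * u j t h.
Local Notation V := step_error.
Local Notation W := common_error.

Lemma wiener_step_error i : wiener rho (fun=> eps) (V i).
Proof.
apply: wiener_mean_error => //.
- by move=> j t; exact/ltW/kw_gt0.
- by move=> t; apply: sum_gt0 => k; exact: kw_gt0.
- by move=> j; exact: measurable_kw.
- exact: wiener_entry_error.
- by rewrite eps_ge0 /=; have := eps_small; lra.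
Qed.

Lemma wiener_common_error : wiener rho (fun=> kap * eta) W.
Proof.
have H : wiener rho (fun=> 1 * eta) (fun (t : n.-tup) h => \sum_j sw j t * u j t h).
  apply: wiener_average => //; first exact/ltW/eta_gt0.
    exact: measurable_sw.
  by move=> t; under eq_bigr => j _ do rewrite ger0_norm ?sw_ge0 //; rewrite sw_sum.
have := wiener_scale rho0 (@measurable_cst _ _ n.-tup R setT kap) H.
move=> H2; apply: (wiener_le H2) => t.
by rewrite mul1r /cst gtr0_norm // kap_gt0.
Qed.

(** With the minorized part removed, the errors [u] are averaged with weights of total mass 1 - kap;
    del + del * eta accounts for the transition error, whose weights have mass 1. *)
Lemma wiener_error_diff i : wiener rho (fun=> (1 - kap) * eta + (del + del * eta))
  (fun t h => V i t h - W t h).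
Proof.
have H1 : wiener rho (fun=> (1 - kap) * eta)
    (fun (t : n.-tup) h => \sum_j (kernel0 i j t - kap * sw j t) * u j t h).
  apply: wiener_average => //; first exact/ltW/eta_gt0.
    move=> j; apply: measurable_funB; first exact: measurable_kernel0.
    by apply: measurable_funM => //; exact: measurable_sw.
  by move=> t; rewrite kernel0_sw_sum.
have H2 j : wiener rho (fun=> del + del * eta)
    (fun (t : n.-tup) h => e i j h * (1 + u j t h)).
  have We := wiener_comp (@measurable_cst _ _ n.-tup _ setT tt) (WP i j).
  have := wiener_add rho0 We (wiener_mul rho0 We (Wu j)).
  by move=> H; apply: (wiener_ext H) => t h hb; rewrite mulrDr mulr1.
have H3 : wiener rho (fun=> 1 * (del + del * eta))
    (fun (t : n.-tup) h => \sum_j kernel0 i j t * (e i j h * (1 + u j t h))).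
  apply: wiener_average => //.
  - by have := mulr_gt0 del_gt0 eta_gt0; have := del_gt0; lra.
  - exact: measurable_kernel0.
  - by move=> t; under eq_bigr => j _ do rewrite ger0_norm ?kernel0_ge0 //; rewrite kernel0_sum.
apply: (wiener_ext (wiener_le (wiener_add rho0 H1 H3) _)) => [t|t h hb].
  by rewrite mul1r.
rewrite /step_error /common_error /mean_error mulr_sumr -sumrB -big_split /=; apply: eq_bigr => j _.
by rewrite -/(kernel0 i j t) /entry_error; ring.
Qed.

Lemma bw_step (a : R) (h : 'rV[R]_m) z (t : n.-tup) i : box rho h ->
  (forall j, bw h t j = a * (bw 0 t j * (1 + u j t h))) ->
  bw h (z :: t) i = a * (bw 0 (z :: t) i * ((1 + (q h i z / q 0 i z - 1)) * (1 + V i t h))).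
Proof.
move=> hb E /=.
have -> : \sum_j P h i j * bw h t j =
    a * \sum_j kw i j t * (1 + x i j t h).
  rewrite mulr_sumr; apply: eq_bigr => j _; rewrite E /kw /entry_error /transition_error.
  by field; rewrite gt_eqF.
rewrite weight_perturb; last by move=> t'; apply: sum_gt0 => k; exact: kw_gt0.
rewrite -/(V i t h).
have q0 : q 0 i z != 0 by rewrite gt_eqF.
have -> : 1 + (q h i z / q 0 i z - 1) = q h i z / q 0 i z by ring.
rewrite -/(kw i _ t); set S := \sum_k kw i k t.
by field.
Qed.

(** The bound [eta] reproduces itself: the contraction gains kap * eta = 4 * del, of which the
    channel and the transition each consume one [del], and the second-order terms are small because
    eta <= 1 / 256. *)
Lemma eta_step : del + (1 + del) * (((1 - kap) * eta + (del + del * eta)) / (1 - kap * eta))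
  <= eta.
Proof.
have k0 := kap_gt0; have k1 := kap_le1; have e0 := eta_gt0; have es := eta_small.
have d0 := del_gt0; have de := del_eta; have dl := del_le.
have ke : kap * eta = 4 * del by rewrite /del; field.
have e1 : 0 < 1 - kap * eta by rewrite ke; lra.
have num : (1 - kap) * eta + (del + del * eta) = eta - 4 * del + (del + del * eta).
  by rewrite -ke; ring.
rewrite num ke -lerBrDl mulrA ler_pdivrMr -?ke // ke.
have dd : del * del <= del / 256 by rewrite ler_wpM2l ?(ltW d0) //; lra.
have dd0 : 0 < del * del by rewrite mulr_gt0.
have dde2 : del * (del * eta) <= del * (1 / 256).
  by rewrite ler_wpM2l ?(ltW d0) //; lra.
have deb : del * eta <= del / 256 by rewrite ler_wpM2l ?(ltW d0) //; lra.
have de0 : 0 < del * eta by rewrite mulr_gt0.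
have E1 : (1 + del) * (eta - 4 * del + (del + del * eta)) =
   eta - 3 * del + 2 * (del * eta) - 3 * (del * del) + del * (del * eta) by ring.
have E2 : (eta - del) * (1 - 4 * del) = eta - 4 * (del * eta) - del + 4 * (del * del).
  by ring.
by rewrite E1 E2; lra.
Qed.

End step.

(* The backward vectors stay, up to a common scalar factor, in a fixed
   relative neighbourhood of the unperturbed ones: one step of the kernel
   contracts the relative error by the factor [1 - kap], which pays for the
   new perturbation. *)
Lemma bw_relative n : exists (a : n.-tup -> 'rV[R]_m -> R)
    (u : 'I_l -> n.-tup -> 'rV[R]_m -> R),
  (forall j, wiener rho (fun=> eta) (u j)) /\
  forall t h, box rho h -> 0 < a t h /\
    forall j, bw h t j = a t h * (bw 0 t j * (1 + u j t h)).
Proof.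
elim: n => [|n [a [u [Wu H]]]].
  exists (fun _ _ => 1), (fun _ _ _ => 0); split.
    move=> j; apply: (wiener_le (wiener_cst m rho0 (@measurable_cst _ _ _ R setT 0))) => t.
    by rewrite /cst normr0 ltW // eta_gt0.
  by move=> t h hb; split => // j; rewrite tuple0 /= addr0 !mulr1.
have WV := wiener_step_error Wu; have WW := wiener_common_error Wu; have WVW := wiener_error_diff Wu.
set V := step_error u in WV WVW; set W := common_error u in WW WVW.
have ke1 : kap * eta < 1.
  have := kap_le1; have := kap_gt0; have := eta_small; have := eta_gt0 => h1 h2 h3 h4.
  have : kap * eta <= 1 * (1 / 256) by apply: ler_pM => //; exact: ltW.
  lra.
(* The common error [W] goes into the scalar factor; the relative error keeps only (V - W) / (1 + W)
   and the channel error. *)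
exists (fun t h => a (tuple_behead t) h * (1 + W (tuple_behead t) h)).
exists (fun i t h => (1 + (q h i (thead t) / q 0 i (thead t) - 1)) *
   ((1 + V i (tuple_behead t) h) / (1 + W (tuple_behead t) h)) - 1).
have mb := @measurable_tuple_behead _ R n.
split.
  move=> i.
  have W1 := wiener_mul rho0 (WVW i) (wiener_inv rho0 ke1 WW).
  have W1' := wiener_comp mb W1.
  have Wq' := wiener_comp (@measurable_thead _ R n) (Wq i).
  have W2 := wiener_add rho0 Wq' (wiener_add rho0 W1' (wiener_mul rho0 Wq' W1')).
  apply: (wiener_ext (wiener_le W2 _)) => [t|t h hb].
    apply: le_trans eta_step; rewrite [X in _ <= _ + X]mulrDl mul1r.
    exact: lexx.
  have w1 : 1 + W (tuple_behead t) h != 0.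
    by rewrite gt_eqF // (wiener_lt1 _ WW).
  have q0 : q 0 i (thead t) != 0 by rewrite gt_eqF.
  by field; rewrite q0 w1.
move=> t h hb; have [a0 E] := H (tuple_behead t) h hb.
have w1 : 0 < 1 + W (tuple_behead t) h by rewrite (wiener_lt1 _ WW).
split; first by rewrite mulr_gt0.
move=> i; rewrite (tuple_consE t) (bw_step (u := u) _ _ hb E) -/V.
have q0 : q 0 i (thead t) != 0 by rewrite gt_eqF.
have w2 : 1 + W (tuple_behead t) h != 0 by rewrite gt_eqF.
by field; rewrite ?q0 ?w2.
Qed.

(** Each observation contributes one factor 1 + del for the channel and one for the transition. No
    common factor is split off here, since the density needs the full norm. *)
Lemma wiener_bw_weight n i : wiener rho
  (fun t : n.-tup => (1 + del) ^+ n.*2 * bw 0 t i) (fun t h => bw h t i).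
Proof.
elim: n i => [|n IH] i.
  apply: (wiener_ext (wiener_le (wiener_cst m rho0 (@measurable_cst _ _ _ R setT 1)) _)).
    by move=> t; rewrite tuple0 /= normr1 mulr1.
  by move=> t h hb; rewrite tuple0.
have mb := @measurable_tuple_behead _ R n; have mt := @measurable_thead _ R n.
have W1 := wiener_cst m rho0 (@measurable_cst _ _ n.+1.-tup R setT 1).
have W2 := wiener_add rho0 W1 (wiener_comp mt (Wq i)).
have W3 := wiener_scale rho0 (measurableT_comp (q0_meas i) mt) W2.
have W4 j := wiener_scale rho0 (@measurable_cst _ _ n.+1.-tup R setT (P 0 i j))
  (wiener_mul rho0 (wiener_add rho0 W1 (wiener_comp (@measurable_cst _ _ n.+1.-tup _ setT tt) (WP i j)))
    (wiener_comp mb (IH j))).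
have W5 := wiener_mul rho0 W3 (wiener_sum rho0 (index_enum 'I_l) (P := predT) (fun j _ => W4 j)).
apply: (wiener_ext (wiener_le W5 _)) => [t|t h hb].
  rewrite (tuple_consE t) /= /cst normr1 doubleS !exprS.
  rewrite (gtr0_norm (q0_gt0 _ _)).
  set X := (1 + del) ^+ n.*2; set S := (X in _ <= _ * (_ * X)).
  rewrite (_ : \sum_(_ < l) _ = (1 + del) * X * S).
    by rewrite le_eqVlt; apply/orP; left; apply/eqP; ring.
  rewrite mulr_sumr; apply: eq_bigr => j _; rewrite (gtr0_norm (P0_gt0 _ _)).
  by ring.
rewrite (tuple_consE t) /= /cst; congr (_ * _).
  by rewrite mulrC addrC subrK divfK // gt_eqF.
apply: eq_bigr => j _; rewrite mulrA; congr (_ * _).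
by rewrite mulrC addrC subrK divfK // gt_eqF.
Qed.

(** The law of the first hidden state given the observations [t]. *)
Definition start_weight (h : 'rV[R]_m) (t : seq R) i : R :=
  w h i * bw h t i / \sum_k w h k * bw h t k.

Lemma start_weight0_sum (t : seq R) : \sum_i start_weight 0 t i = 1.
Proof.
rewrite /start_weight -mulr_suml divff // gt_eqF // sum_gt0 // => k.
by rewrite mulr_gt0 // bw0_pos.
Qed.

Lemma start_weight0_ge0 (t : seq R) i : 0 <= start_weight 0 t i.
Proof.
rewrite /start_weight divr_ge0 // ltW ?mulr_gt0 ?bw0_pos //.
by apply: sum_gt0 => k; rewrite mulr_gt0 // bw0_pos.
Qed.

(** * Conditional laws of hidden states under perturbation *)

Section perturbed_weights.
Variables (n : nat).

Let eps1 : 0 <= eps < 1.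
Proof. by rewrite eps_ge0 /=; have := eps_small; lra. Qed.

Lemma eps_ratio : 2 * eps / (1 - eps) <= kap / 2.
Proof.
have := eps_small; have := eps_le; have := kap_gt0; rewrite /eta => k0 h1 h2.
have h3 : 0 < 1 - eps by lra.
rewrite ler_pdivrMr //.
have : kap / 2 * eps <= kap / 2 * (1 / 190) by rewrite ler_wpM2l //; lra.
by rewrite mulrBr mulr1; lra.
Qed.

(* Weights of the form [c_i (1 + x_i) / sum_k c_k (1 + x_k)] built from the
   backward vectors do not see the common factor of [bw_relative]. *)
Lemma bw_weights (I : finType) (c : I -> n.-tup -> R) (s : I -> 'I_l)
    (e : I -> 'rV[R]_m -> R) :
  (forall i t, 0 < c i t) -> (exists i : I, True) ->
  (forall i, measurable_fun setT (c i)) ->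
  (forall i, wiener rho (fun _ : unit => del) (fun _ h => e i h)) ->
  forall f : I -> n.-tup -> 'rV[R]_m -> R,
  (forall i t h, box rho h ->
     f i t h = c i t / bw 0 t (s i) * (1 + e i h) * bw h t (s i)) ->
  forall i, wiener rho (fun t => c i t / (\sum_k c k t) * (2 * eps / (1 - eps)))
    (fun t h => f i t h / (\sum_k f k t h) - c i t / \sum_k c k t).
Proof.
move=> c0 [i1 _] mc We f fE i.
have [a [u [Wu H]]] := bw_relative n.
pose x i (t : n.-tup) h := (1 + e i h) * (1 + u (s i) t h) - 1.
have Wx j : wiener rho (fun=> eps) (x j).
  apply: wiener_rel_mul => //.
  exact: (wiener_comp (@measurable_cst _ _ n.-tup _ setT tt) (We j)).
have S0 (t : n.-tup) : 0 < \sum_i c i t.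
  by rewrite (bigD1 i1) //= ltr_pwDl // sumr_ge0 // => j _; exact: ltW.
have := wiener_weight rho0 (fun i t => ltW (c0 i t)) S0 mc Wx eps1 i.
move=> W; apply: (wiener_ext W) => t h hb.
have [a0 E] := H t h hb.
have fx j : f j t h = a t h * (c j t * (1 + x j t h)).
  by rewrite fE // E /x; field; rewrite gt_eqF // bw0_pos.
rewrite fx; under eq_bigr => k _ do rewrite fx.
by rewrite -mulr_sumr invfM mulrACA divff ?gt_eqF // mul1r.
Qed.

(** The bounds sum over [j] to (1 - kap) + kap / 2 = rc. The unperturbed law [sw] is subtracted even
    from the perturbed kernel, so that the subtracted part still does not depend on [i]. *)
Lemma wiener_kernel i j : wiener rho
  (fun t : n.-tup => kernel0 i j t - kap * sw j t + kernel0 i j t * (kap / 2))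
  (fun t h => kernel h t i j - kap * sw j t).
Proof.
have Wi : exists _ : 'I_l, True by exists i0.
have WK := bw_weights (fun j t => kw_gt0 i j t) Wi (@measurable_kw i n) (s := id) (WP i)
  (f := fun j t h => P h i j * bw h t j) _ j.
have {}WK : wiener rho (fun t : n.-tup => kernel0 i j t * (2 * eps / (1 - eps)))
    (fun t h => kernel h t i j - kernel0 i j t).
  apply: WK => k t h hb; rewrite /kw mulfK ?gt_eqF ?bw0_pos //.
  by rewrite addrC subrK mulrCA divff ?mulr1 // gt_eqF.
have mk : measurable_fun setT (fun t : n.-tup => kernel0 i j t - kap * sw j t).
  apply: measurable_funB; first exact: measurable_kernel0.
  by apply: measurable_funM => //; exact: measurable_sw.
apply: (wiener_ext (wiener_le (wiener_add rho0 (wiener_cst m rho0 mk) WK) _)) => [t|t h hb].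
  rewrite ger0_norm ?subr_ge0 ?kernel0_sw // lerD2l ler_wpM2l ?kernel0_ge0 //.
  exact: eps_ratio.
by ring.
Qed.

Lemma wiener_start_weight i : wiener rho (fun t : n.-tup => 2 * start_weight 0 t i)
  (fun t h => start_weight h t i).
Proof.
have Wi : exists _ : 'I_l, True by exists i0.
have mc j : measurable_fun setT (fun t : n.-tup => w 0 j * bw 0 t j).
  by apply: measurable_funM => //; exact: measurable_bw0.
have c0 j (t : n.-tup) : 0 < w 0 j * bw 0 t j by rewrite mulr_gt0 // bw0_pos.
have WK := bw_weights c0 Wi mc (s := id) Ww
  (f := fun j t h => w h j * bw h t j) _ i.
have {}WK : wiener rho (fun t : n.-tup => start_weight 0 t i * (2 * eps / (1 - eps)))
    (fun t h => start_weight h t i - start_weight 0 t i).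
  apply: WK => k t h hb; rewrite mulfK ?gt_eqF ?bw0_pos //.
  by rewrite addrC subrK mulrCA divff ?mulr1 // gt_eqF.
have ms : measurable_fun setT (fun t : n.-tup => start_weight 0 t i).
  by apply: measurable_weight => // t; apply: sum_gt0 => k.
apply: (wiener_ext (wiener_le (wiener_add rho0 (wiener_cst m rho0 ms) WK) _)) => [t|t h hb].
  rewrite ger0_norm ?start_weight0_ge0 //.
  have -> : 2 * start_weight 0 t i = start_weight 0 t i + start_weight 0 t i by ring.
  rewrite lerD2l ler_piMr ?start_weight0_ge0 //.
  by apply: le_trans eps_ratio _; have := kap_le1; lra.
by ring.
Qed.

End perturbed_weights.

(** * Contraction of the ratios of backward vectors *)

Lemma average_osc (K s f : 'I_l -> R) (lo W : R) :
  (forall j, kap * s j <= K j) -> \sum_j K j = 1 -> \sum_j s j = 1 ->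
  (forall j, lo <= f j <= lo * (1 + W)) ->
  kap * (\sum_j s j * f j) + (1 - kap) * lo <= \sum_j K j * f j
    <= kap * (\sum_j s j * f j) + (1 - kap) * (lo * (1 + W)).
Proof.
move=> sK K1 s1 fl.
have E : \sum_j K j * f j = kap * (\sum_j s j * f j) + \sum_j (K j - kap * s j) * f j.
  rewrite mulr_sumr -big_split /=; apply: eq_bigr => j _; ring.
have S : \sum_j (K j - kap * s j) = 1 - kap by rewrite sumrB K1 -mulr_sumr s1 mulr1.
rewrite E !lerD2l -S !mulr_suml; apply/andP; split; apply: ler_sum => j _;
  by rewrite ler_wpM2l ?subr_ge0 //; case/andP: (fl j).
Qed.

Lemma ratio0_gt0 t i : 0 < ratio 0 t i.
Proof. by rewrite divr_gt0 // bw0_pos. Qed.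

Lemma ratio0_cons z t i : (0 < size t)%N ->
  ratio 0 (z :: t) i = \sum_j kernel 0 (all_but_last t) i j * ratio 0 t j.
Proof. by move=> st; apply: (ratio_cons i0). Qed.

(** Prepending an observation averages [ratio] by the kernel: all new values share the contribution
    kap * S of [sw], and the old spread enters with weight 1 - kap only. The start needs two
    observations: one averaging by [P] makes the values comparable up to the factor [kap], whence
    the constant [kap ^- 2]. *)
Lemma ratio0_osc (t : seq R) : (1 < size t)%N -> exists lo : R, 0 < lo /\
  forall j, lo <= ratio 0 t j <= lo * (1 + kap ^- 2 * (1 - kap) ^+ (size t - 2)).
Proof.
have k0 := kap_gt0.
elim: t => [//|z t IH] st; have [st1|st1] := leqP (size t) 1.
  have {st1} st1 : size t = 1%N by apply/eqP; rewrite eqn_leq st1.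
  have ab : all_but_last t = [::] by rewrite /all_but_last st1 take0.
  have E i : ratio 0 (z :: t) i = \sum_j P 0 i j * ratio 0 t j.
    rewrite ratio0_cons ?st1 // ab; apply: eq_bigr => j _.
    rewrite /kernel /=; under eq_bigr => k _ do rewrite mulr1.
    by rewrite P0_sum divr1 mulr1.
  have comp i i' : kap * ratio 0 (z :: t) i' <= ratio 0 (z :: t) i.
    rewrite !E mulr_sumr; apply: ler_sum => j _.
    by rewrite mulrA ler_wpM2r // ltW // ratio0_gt0.
  exists (kap * ratio 0 (z :: t) i0); split; first by rewrite mulr_gt0 // ratio0_gt0.
  move=> j; rewrite comp /= st1 subnn expr0 mulr1.
  apply: (@le_trans _ _ (kap * ratio 0 (z :: t) i0 * kap ^- 2)); last first.
    by rewrite ler_wpM2l ?lerDr // ltW // mulr_gt0 // ratio0_gt0.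
  rewrite (_ : kap * ratio 0 (z :: t) i0 * kap ^- 2 = ratio 0 (z :: t) i0 / kap).
    by rewrite ler_pdivlMr // mulrC; exact: comp.
  by field; rewrite gt_eqF.
have [lo [lo0 H]] := IH st1.
have st0 : (0 < size t)%N by exact: ltnW.
pose s j := sw j (in_tuple (all_but_last t)).
pose S := \sum_j s j * ratio 0 t j.
have s1 : \sum_j s j = 1 by exact: sw_sum.
have Slo : lo <= S.
  rewrite -[lo]mul1r -s1 mulr_suml; apply: ler_sum => j _.
  by rewrite ler_wpM2l ?sw_ge0 //; case/andP: (H j).
have step i := average_osc
  (fun j => kernel0_sw i j (in_tuple (all_but_last t)))
  (kernel0_sum i (in_tuple (all_but_last t))) s1 H.
have kap1 : 0 <= 1 - kap by rewrite subr_ge0 kap_le1.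
(* The new lower end is at least the old one, so the relative width shrinks by the factor 1 -
   kap. *)
exists (kap * S + (1 - kap) * lo); split.
  by rewrite ltr_pwDl ?mulr_gt0 ?mulr_ge0 ?(ltW lo0) // (lt_le_trans lo0).
move=> i; rewrite ratio0_cons //; have /andP[h1 h2] := step i.
apply/andP; split=> //; apply: le_trans h2 _.
rewrite /= subSn //.
set X := kap ^- 2 * (1 - kap) ^+ (size t - 2).
have -> : kap ^- 2 * (1 - kap) ^+ (size t - 2).+1 = (1 - kap) * X.
  by rewrite /X [(1 - kap) ^+ _.+1]exprS mulrCA.
have X0 : 0 <= (1 - kap) * X.
  by rewrite mulr_ge0 // /X mulr_ge0 ?exprn_ge0 // invr_ge0 exprn_ge0 // ltW.
have le1 : lo <= kap * S + (1 - kap) * lo.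
  have : kap * lo <= kap * S by rewrite ler_wpM2l // ltW.
  lra.
have := ler_wpM2r X0 le1; rewrite /S; lra.
Qed.

Lemma all_but_last_tuple n (t : n.+1.-tup) : all_but_last t = tuple_belast t :> seq R.
Proof. by rewrite tuple_belastE /all_but_last size_tuple. Qed.

(** The average by the kernel is split along the minorization: the first part depends on [i] and
    contracts by [rc], the second does not depend on [i]. *)
Lemma wiener_contract n (v : 'I_l -> n.+1.-tup -> 'rV[R]_m -> R) (c : R) : 0 <= c ->
  (forall j, wiener rho (fun=> c) (v j)) ->
  (forall i, wiener rho (fun=> rc * c) (fun (t : n.+1.-tup) h =>
     \sum_j (kernel h (all_but_last t) i j - kap * sw j (tuple_belast t)) * v j t h)) /\
  wiener rho (fun=> kap * c) (fun (t : n.+1.-tup) h =>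
     \sum_j kap * sw j (tuple_belast t) * v j t h).
Proof.
move=> c0 Wv; have mb := @measurable_tuple_belast _ R n; split.
  move=> i; have H j := wiener_mul rho0 (wiener_comp mb (@wiener_kernel n i j)) (Wv j).
  apply: (wiener_ext (wiener_le (wiener_sum rho0 (index_enum 'I_l) (P := predT) (fun j _ => H j)) _)).
    move=> t /=; rewrite -mulr_suml ler_wpM2r // big_split /= -mulr_suml kernel0_sum.
    by rewrite sumrB kernel0_sum -mulr_sumr sw_sum /rc; lra.
  by move=> t h hb; apply: eq_bigr => j _; rewrite all_but_last_tuple.
apply: wiener_average => //.
  move=> j; apply: measurable_funM => //; apply: measurableT_comp => //.
  exact: measurable_sw.
move=> t; rewrite (eq_bigr (fun j => kap * sw j (tuple_belast t))) => [|j _].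
  by rewrite -mulr_sumr sw_sum mulr1.
by rewrite ger0_norm // mulr_ge0 ?sw_ge0 //; exact: ltW kap_gt0.
Qed.

Lemma kernel_sum h t i : box rho h -> \sum_j kernel h t i j = 1.
Proof.
move=> hb; rewrite /kernel -mulr_suml divff // gt_eqF // sum_gt0 // => k.
by rewrite mulr_gt0 ?P_gt0 ?bw_pos.
Qed.

Lemma rc01 : 0 < rc < 1.
Proof. by have := kap_gt0; have := kap_le1; rewrite /rc => ? ?; apply/andP; split; lra. Qed.

(** [g] is an uncontrolled nonzero factor that will cancel, [T] collects the parts that no longer
    depend on the state, and [v] is what still does. [T] is kept outside [g] because the recursion
    is additive and [g] stays fixed. *)
Definition ratio_state k (g : k.+2.-tup -> 'rV[R]_m -> R)
    (T : k.+2.-tup -> 'rV[R]_m -> R) (v : 'I_l -> k.+2.-tup -> 'rV[R]_m -> R) : Prop :=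
  forall t h, box rho h -> g t h != 0 /\
    forall j, ratio h t j = g t h * (1 + T t h + v j t h).

Lemma ratio_step k g T v (t : k.+3.-tup) h i : box rho h -> @ratio_state k g T v ->
  ratio h t i = g (tuple_behead t) h * (1 + T (tuple_behead t) h +
    \sum_j kernel h (all_but_last (tuple_behead t)) i j * v j (tuple_behead t) h).
Proof.
move=> hb H; have [_ E] := H (tuple_behead t) h hb.
rewrite (tuple_consE t) (ratio_cons i0); last 3 first.
- by move=> *; exact: P_gt0.
- by move=> *; exact: q_gt0.
- by rewrite size_tuple.
under eq_bigr => j _ do rewrite E.
set G := g _ h; set A := 1 + T _ h.
transitivity (G * A * (\sum_j kernel h (all_but_last (tuple_behead t)) i j) +
  G * \sum_j kernel h (all_but_last (tuple_behead t)) i j * v j (tuple_behead t) h).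
  by rewrite !mulr_sumr -big_split /=; apply: eq_bigr => j _; ring.
by rewrite kernel_sum // mulr1; ring.
Qed.

Section contraction.
Variable n0 : nat.
Hypothesis n0_large : kap ^- 2 * (1 - kap) ^+ n0 <= 1 / 128.

(** At h = 0 all ratios agree with that of the reference state [i0] up to a relative error 1 / 128;
    passing to [h] adds the errors [eta] of the numerator and of the denominator. The scalar factors
    of [bw_relative] go into [g]. *)
Lemma ratio_state0 : exists g T v, [/\ wiener rho (fun=> 0) T,
  forall j, wiener rho (fun=> 1 / 32) (v j) & @ratio_state n0 g T v].
Proof.
have [a [u [Wu H]]] := bw_relative n0.+2.
have [a' [u' [Wu' H']]] := bw_relative n0.+1.
have mb := @measurable_tuple_belast _ R n0.+1.
have Wb j := wiener_comp mb (Wu' j).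
pose nu j (t : n0.+2.-tup) := ratio 0 t j / ratio 0 t i0 - 1.
have e1 : eta < 1 by have := eta_small; lra.
have mr j : measurable_fun setT (fun t : n0.+2.-tup => ratio 0 t j).
  apply: (eq_measurable_fun (fun t : n0.+2.-tup =>
    bw 0 t j * expR (- ln (bw 0 (tuple_belast t) j)))).
    by move=> t _; rewrite expRN lnK ?posrE ?bw0_pos // /ratio all_but_last_tuple.
  apply: measurable_funM; first exact: measurable_bw0.
  have mbb : measurable_fun setT (fun t : n0.+2.-tup => bw 0 (tuple_belast t) j).
    exact: (measurableT_comp (@measurable_bw0 n0.+1 j) mb).
  apply: measurableT_comp => //; apply: measurableT_comp => //.
  exact: (measurableT_comp (@measurable_ln R) mbb).
have mnu j : measurable_fun setT (nu j).
  apply: measurable_funB => //.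
  apply: (eq_measurable_fun (fun t : n0.+2.-tup =>
    ratio 0 t j * expR (- ln (ratio 0 t i0)))).
    by move=> t _; rewrite expRN lnK ?posrE ?ratio0_gt0.
  apply: measurable_funM => //.
  apply: measurableT_comp => //; apply: measurableT_comp => //.
  exact: measurableT_comp.
have nub j t : `|nu j t| <= 1 / 128.
  have [|lo [lo0 Hlo]] := @ratio0_osc t; first by rewrite size_tuple.
  rewrite size_tuple subSS subSS subn0 in Hlo.
  have := n0_large; set W := kap ^- 2 * _ in Hlo * => Wle.
  have /andP[h1 h2] := Hlo j; have /andP[h3 h4] := Hlo i0.
  have r0 := ratio0_gt0 t i0.
  have W0 : 0 <= W by nra.
  rewrite /nu ler_norml; apply/andP; split.
    rewrite lerBrDr ler_pdivlMr //.
    nra.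
  by rewrite lerBlDr ler_pdivrMr //; nra.
exists (fun t h => a t h / a' (tuple_belast t) h * ratio 0 t i0), (fun _ _ => 0),
  (fun j t h => (1 + nu j t) * ((1 + u j t h) / (1 + u' j (tuple_belast t) h)) - 1).
split.
- apply: (wiener_le (wiener_cst m rho0 (@measurable_cst _ _ _ R setT 0))) => t.
  by rewrite /cst normr0.
- move=> j.
  have W1 := wiener_mul rho0 (wiener_sub rho0 (Wu j) (Wb j)) (wiener_inv rho0 e1 (Wb j)).
  have Wn := wiener_le (wiener_cst m rho0 (mnu j)) (nub j).
  have W2 := wiener_add rho0 Wn (wiener_add rho0 W1 (wiener_mul rho0 Wn W1)).
  apply: (wiener_ext (wiener_le W2 _)) => [t|t h hb] /=.
    have := eta_small; have := eta_gt0 => h1 h2; rewrite /cst.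
    have : (eta + eta) / (1 - eta) <= 1 / 120 by rewrite ler_pdivrMr; lra.
    lra.
  have h1 : 1 + u' j (tuple_belast t) h != 0.
    by rewrite gt_eqF // (wiener_lt1 _ (Wu' j)).
  by field.
- move=> t h hb; have [a0 E] := H t h hb; have [a0' E'] := H' (tuple_belast t) h hb.
  split.
    by apply: lt0r_neq0; rewrite mulr_gt0 ?ratio0_gt0 // divr_gt0.
  move=> j; rewrite {1}/ratio all_but_last_tuple E E'.
  have h1 : 1 + u' j (tuple_belast t) h != 0.
    by rewrite gt_eqF // (wiener_lt1 _ (Wu' j)).
  have E0 k : ratio 0 t k = bw 0 t k / bw 0 (tuple_belast t) k.
    by rewrite /ratio all_but_last_tuple.
  rewrite /nu !E0; field.
  by rewrite h1 !gt_eqF ?bw0_pos.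
Qed.

(** A step moves a term of norm kap / 32 * rc^k from [v] to [T]. As kap = 2 * (1 - rc), these norms
    telescope and [T] never exceeds 1 / 16, which keeps 1 + T invertible. *)
Lemma ratio_states k : exists g T v, [/\ wiener rho (fun=> 1 / 16 * (1 - rc ^+ k)) T,
  forall j, wiener rho (fun=> 1 / 32 * rc ^+ k) (v j) & @ratio_state (k + n0) g T v].
Proof.
have /andP[r0 r1] := rc01.
elim: k => [|k [g [T [v [WT Wv H]]]]].
  have [g [T [v [WT Wv H]]]] := ratio_state0; exists g, T, v; split => //.
    by apply: wiener_cst_le WT; rewrite expr0 subrr mulr0.
  by move=> j; apply: wiener_cst_le (Wv j); rewrite expr0 mulr1.
have c0 : 0 <= 1 / 32 * rc ^+ k by rewrite mulr_ge0 // exprn_ge0 // ltW.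
have [W1 W2] := wiener_contract c0 Wv.
have mb := @measurable_tuple_behead _ R (k + n0).+2.
exists (fun t h => g (tuple_behead t) h).
exists (fun t h => T (tuple_behead t) h +
  \sum_j kap * sw j (tuple_belast (tuple_behead t)) * v j (tuple_behead t) h).
exists (fun i t h => \sum_j (kernel h (all_but_last (tuple_behead t)) i j -
   kap * sw j (tuple_belast (tuple_behead t))) * v j (tuple_behead t) h).
split.
- apply: wiener_cst_le (wiener_comp mb (wiener_add rho0 WT W2)).
  have -> : kap = 2 * (1 - rc) by rewrite /rc; field.
  by rewrite exprS; lra.
- move=> i; apply: wiener_cst_le (wiener_comp mb (W1 i)).
  by rewrite exprS; lra.
- move=> t h hb; split; first by case: (H (tuple_behead t) h hb).
  move=> i; rewrite (ratio_step t i hb H) -2!addrA -[in RHS]addrA; congr (_ * (_ + (_ + _))).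
  rewrite -big_split /=; apply: eq_bigr => j _; ring.
Qed.

End contraction.

(** * Conditional log densities and their increments *)

Local Notation pd := (pd P q w).

Definition log_ratio (h : 'rV[R]_m) (t : seq R) : R := ln (pd h t / pd h (behead t)).

Lemma pd_gt0 h t : box rho h -> 0 < pd h t.
Proof. by move=> hb; apply: sum_gt0 => i; rewrite mulr_gt0 ?w_gt0 ?bw_pos. Qed.

Lemma pd0_gt0 t : 0 < pd 0 t.
Proof. by apply: sum_gt0 => i; rewrite mulr_gt0 ?bw0_pos. Qed.

Lemma measurable_pd0 n : measurable_fun setT (fun t : n.-tup => pd 0 t).
Proof. exact: measurable_pd. Qed.

Lemma start_weight_sum h (t : seq R) : box rho h -> \sum_i start_weight h t i = 1.
Proof.
move=> hb; rewrite /start_weight -mulr_suml divff // gt_eqF // sum_gt0 // => k.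
by rewrite mulr_gt0 ?w_gt0 ?bw_pos.
Qed.

(** The conditional density of the last observation is a mixture over the first hidden state, under
    its law given all the other observations. *)
Lemma pd_ratio h (t : seq R) : box rho h ->
  pd h t / pd h (all_but_last t) = \sum_i start_weight h (all_but_last t) i * ratio h t i.
Proof.
move=> hb; rewrite /pd mulr_suml; apply: eq_bigr => i _.
rewrite /start_weight /ratio; set S := \sum_k _.
have S0 : S != 0 by apply: lt0r_neq0; exact: pd_gt0.
have b0 : bw h (all_but_last t) i != 0 by apply: lt0r_neq0; rewrite bw_pos.
by field; rewrite b0 S0.
Qed.

Lemma behead_belast n (t : n.+2.-tup) :
  tuple_behead (tuple_belast t) = tuple_belast (tuple_behead t) :> seq R.
Proof.
by rewrite /= !tuple_belastE [in LHS](tuple_consE t).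
Qed.

Section log_increment.
Variable n0 : nat.
Hypothesis n0_large : kap ^- 2 * (1 - kap) ^+ n0 <= 1 / 128.

(* Appending an observation in the far future changes the conditional
   density of the present one by the factor (1+T+A)/(1+T+B), in which A and
   B are averages of the exponentially small terms of [ratio_states]. *)
Lemma wiener_log_increment k : wiener rho (fun=> rc ^+ k)
  (fun (t : (k + n0).+3.-tup) h => log_ratio h t - log_ratio h (tuple_belast t)).
Proof.
have /andP[r0 r1] := rc01.
have [g [T [v [WT Wv H]]]] := ratio_states n0_large k.
have e0 : 0 <= rc ^+ k by rewrite exprn_ge0 // ltW.
have e1 : rc ^+ k <= 1 by rewrite exprn_ile1 // ltW.
set c := 1 / 32 * rc ^+ k in Wv.
have c0 : 0 <= c by rewrite mulr_ge0.
have [W1 W2] := wiener_contract c0 Wv.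
(* The image of [v] under the kernel, seen from state [i] one time earlier; its norm is at most (rc
   + kap) * c, hence 2 * c. *)
pose v1 i (t : (k + n0).+2.-tup) h := \sum_j kernel h (all_but_last t) i j * v j t h.
have Wv1 i : wiener rho (fun=> 2 * c) (v1 i).
  apply: (wiener_ext (wiener_le (wiener_add rho0 (W1 i) W2) _)) => [t|t h hb].
    rewrite -mulrDl ler_wpM2r // /rc.
    by have := kap_le1; lra.
  rewrite /v1 -big_split /=; apply: eq_bigr => j _; ring.
have mb3 := @measurable_tuple_behead _ R (k + n0).+2.
have mt3 := @measurable_tuple_belast _ R (k + n0).+2.
have mt2 := @measurable_tuple_belast _ R (k + n0).+1.
pose A (t : (k + n0).+3.-tup) h :=
  \sum_i start_weight h (tuple_belast t) i * v1 i (tuple_behead t) h.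
pose B (t : (k + n0).+2.-tup) h := \sum_i start_weight h (tuple_belast t) i * v i t h.
have WA : wiener rho (fun=> 4 * c) A.
  have Wi i := wiener_mul rho0 (wiener_comp mt3 (@wiener_start_weight _ i))
    (wiener_comp mb3 (Wv1 i)).
  apply: (wiener_le (wiener_sum rho0 (index_enum 'I_l) (P := predT) (fun i _ => Wi i))).
  move=> t /=; rewrite (eq_bigr (fun i => 4 * c * start_weight 0 (tuple_belast t) i)).
    by rewrite -mulr_sumr start_weight0_sum mulr1.
  by move=> i _; ring.
have WB : wiener rho (fun=> 2 * c) B.
  have Wi i := wiener_mul rho0 (wiener_comp mt2 (@wiener_start_weight _ i)) (Wv i).
  apply: (wiener_le (wiener_sum rho0 (index_enum 'I_l) (P := predT) (fun i _ => Wi i))).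
  move=> t /=; rewrite -mulr_suml -mulr_sumr start_weight0_sum; lra.
have WTB : wiener rho (cst (1 / 8)) (fun t h => T t h + B t h).
  apply: wiener_cst_le (wiener_add rho0 WT WB).
  by rewrite /c; lra.
have e8 : 1 / 8 < 1 :> R by lra.
have WY := wiener_mul rho0 (wiener_sub rho0 WA (wiener_comp mb3 WB))
  (wiener_comp mb3 (wiener_inv rho0 e8 WTB)).
(* The constant 3 / 14 is (4 + 2) / 32 times 8 / 7, the last factor bounding the inverse of 1 + T +
   B. *)
have {}WY : wiener rho (cst (3 / 14 * rc ^+ k)) (fun t h =>
    (A t h - B (tuple_behead t) h) *
    (1 + (T (tuple_behead t) h + B (tuple_behead t) h))^-1).
  apply: (wiener_le WY) => t /=; rewrite /c.
  have -> : (1 - 1 / 8)^-1 = 8 / 7 :> R by field.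
  by lra.
have ey : 3 / 14 * rc ^+ k < 1 by lra.
apply: (wiener_ext (wiener_le (wiener_ln rho0 ey WY) _)) => [t|t h hb] /=.
  rewrite ler_pdivrMr; last by lra.
  have : 3 / 14 * rc ^+ k * rc ^+ k <= 3 / 14 * rc ^+ k * 1 by rewrite ler_wpM2l //; lra.
  by lra.
have tE : all_but_last t = tuple_belast t :> seq R by exact: all_but_last_tuple.
have bE : all_but_last (tuple_behead t) = tuple_belast (tuple_behead t) :> seq R.
  exact: all_but_last_tuple.
have [g0 E] := H (tuple_behead t) h hb.
have b1 : 0 < 1 + (T (tuple_behead t) h + B (tuple_behead t) h).
  by rewrite (wiener_lt1 _ WTB).
set G := g (tuple_behead t) h in g0 E.
have N1 : pd h t / pd h (tuple_belast t) = G * (1 + T (tuple_behead t) h + A t h).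
  rewrite -tE pd_ratio // tE /A.
  under eq_bigr => i _ do rewrite (ratio_step t i hb H) -/G -/(v1 i (tuple_behead t) h).
  transitivity (G * ((1 + T (tuple_behead t) h) * (\sum_i start_weight h (tuple_belast t) i)
    + \sum_i start_weight h (tuple_belast t) i * v1 i (tuple_behead t) h)).
    by rewrite mulr_sumr -big_split /= mulr_sumr; apply: eq_bigr => i _; ring.
  by rewrite start_weight_sum // mulr1.
have N2 : pd h (tuple_behead t) / pd h (tuple_belast (tuple_behead t)) =
    G * (1 + T (tuple_behead t) h + B (tuple_behead t) h).
  rewrite -bE pd_ratio // bE /B.
  under eq_bigr => i _ do rewrite E.
  set s := tuple_belast _.
  transitivity (G * ((1 + T (tuple_behead t) h) * (\sum_i start_weight h s i)
    + \sum_i start_weight h s i * v i (tuple_behead t) h)).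
    by rewrite mulr_sumr -big_split /= mulr_sumr; apply: eq_bigr => i _; ring.
  by rewrite start_weight_sum // mulr1.
have p s : 0 < pd h s by exact: pd_gt0.
rewrite /log_ratio -ln_div ?posrE ?divr_gt0 //; congr ln.
have -> : behead (tuple_belast t) = tuple_belast (tuple_behead t) :> seq R.
  exact: behead_belast.
set X := tuple_behead t in N1 N2 b1 *; set Y := tuple_belast t in N1 *.
(* The four densities are regrouped into two conditional densities of the last observation, with and
   without the first one among the conditions. Both contain the factor [G], which cancels. *)
have -> : pd h t / pd h (behead t) / (pd h Y / pd h (tuple_belast X)) =
    (pd h t / pd h Y) / (pd h X / pd h (tuple_belast X)).
  rewrite -/(tval X); field; rewrite !gt_eqF //.
rewrite N1 N2; move: b1; set b := B X h => b1.
have {}b1 : 1 + T X h + b != 0 by rewrite -addrA gt_eqF.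
by rewrite addrA; field; rewrite ?b1 ?g0.
Qed.

End log_increment.

(** Both densities are expanded over the backward vector of the same tuple [tuple_behead t], so that
    its scalar factor cancels in the quotient. For the numerator this requires sums over pairs of
    states, the first one and its successor. *)
Lemma wiener_log_ratio n : wiener rho (fun t : n.+1.-tup => `|log_ratio 0 t| + 1)
  (fun t h => log_ratio h t).
Proof.
have [a [u [Wu H]]] := bw_relative n.
have mb := @measurable_tuple_behead _ R n.
have mt := @measurable_thead _ R n.
have es := eps_small; have ds := del_le; have ets := eta_small; have d0 := del_gt0.
have en := eps_ge0.
pose x1 j (t : n.-tup) h := (1 + (w h j / w 0 j - 1)) * (1 + u j t h) - 1.
have Wx1 j : wiener rho (fun=> eps) (x1 j).
  apply: wiener_rel_mul => //.
  exact: (wiener_comp (@measurable_cst _ _ n.-tup _ setT tt) (Ww j)).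
pose x2 (p : 'I_l * 'I_l) (t : n.+1.-tup) h :=
  (1 + ((1 + ((1 + (w h p.1 / w 0 p.1 - 1)) * (1 + (q h p.1 (thead t) / q 0 p.1 (thead t) - 1)) - 1))
     * (1 + (P h p.1 p.2 / P 0 p.1 p.2 - 1)) - 1)) * (1 + u p.2 (tuple_behead t) h) - 1.
have dd : 0 < del * del <= del / 100.
  by rewrite mulr_gt0 //= ler_wpM2l //; lra.
have ddd : 0 < del * del * del <= del / 100.
  have /andP[d1 d2] := dd; apply/andP; split; first by rewrite mulr_gt0.
  have : del * del * del <= del * del * 1 by rewrite ler_wpM2l ?(ltW d1) //; lra.
  by lra.
have Wx2 p : wiener rho (fun=> 1 / 4) (x2 p).
  have mu1 := @measurable_cst _ _ n.+1.-tup _ setT tt.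
  have := wiener_rel_mul rho0 (wiener_rel_mul rho0 (wiener_rel_mul rho0
    (wiener_comp mu1 (Ww p.1)) (wiener_comp mt (Wq p.1)))
    (wiener_comp mu1 (WP p.1 p.2))) (wiener_comp mb (Wu p.2)).
  apply: wiener_cst_le.
  set e := del + del + del * del + del + (del + del + del * del) * del.
  have e0 : 0 <= e <= 1 / 100.
    have /andP[d1 d2] := dd; have /andP[d3 d4] := ddd.
    have -> : e = 3 * del + 3 * (del * del) + del * del * del by rewrite /e; ring.
    by apply/andP; split; lra.
  have /andP[e1 e2] := e0; have h0 := eta_gt0.
  have : e * eta <= 1 / 100 * (1 / 256) by apply: ler_pM => //; exact: ltW.
  by lra.
pose c1 j (t : n.-tup) := w 0 j * bw 0 t j.
pose c2 (p : 'I_l * 'I_l) (t : n.+1.-tup) :=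
  w 0 p.1 * q 0 p.1 (thead t) * P 0 p.1 p.2 * bw 0 (tuple_behead t) p.2.
have c1_gt0 j t : 0 < c1 j t by rewrite mulr_gt0 // bw0_pos.
have c2_gt0 j t : 0 < c2 j t by rewrite !mulr_gt0 // bw0_pos.
have mc1 j : measurable_fun setT (c1 j).
  by apply: measurable_funM => //; exact: measurable_bw0.
have mc2 p : measurable_fun setT (c2 p).
  have mq : measurable_fun setT (fun t : n.+1.-tup => q 0 p.1 (thead t)).
    exact: (measurableT_comp (q0_meas p.1) mt).
  have mbb : measurable_fun setT (fun t : n.+1.-tup => bw 0 (tuple_behead t) p.2).
    exact: (measurableT_comp (@measurable_bw0 n p.2) mb).
  by apply: measurable_funM => //; apply: measurable_funM => //; apply: measurable_funM.
have S1 t : 0 < \sum_j c1 j t by apply: sum_gt0 => j.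
have pE2 h (t : n.+1.-tup) : pd h t = \sum_(p : 'I_l * 'I_l)
    w h p.1 * q h p.1 (thead t) * P h p.1 p.2 * bw h (tuple_behead t) p.2.
  rewrite -(pair_bigA _ (fun i j => w h i * q h i (thead t) * P h i j * bw h (tuple_behead t) j)) /=.
  rewrite (tuple_consE t); apply: eq_bigr => i _ /=.
  rewrite !mulr_sumr; apply: eq_bigr => j _; by rewrite !mulrA.
have S2 t : 0 < \sum_p c2 p t by rewrite -pE2 pd0_gt0.
have epb : 0 <= eps < 1 by rewrite en /=; lra.
have qb : 0 <= 1 / 4 :> R /\ 1 / 4 < 1 :> R by split; lra.
have {}qb : (0 <= 1 / 4 :> R) && (1 / 4 < 1 :> R) by case: qb => -> ->.
have W1 := wiener_mean_error rho0 (fun j t => ltW (c1_gt0 j t)) S1 mc1 Wx1.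
have W2 := wiener_mean_error rho0 (fun j t => ltW (c2_gt0 j t)) S2 mc2 Wx2 qb.
have {}W1 := wiener_cst_le (c' := 1 / 4) _ (W1 epb).
have {}W1 : wiener rho (fun=> 1 / 4) (mean_error c1 x1) by apply: W1; lra.
have q1 : 1 / 4 < 1 :> R by lra.
have L2 := wiener_ln rho0 q1 W2.
have L1 := wiener_comp mb (wiener_ln rho0 q1 W1).
have mpd := measurableT_comp (@measurable_ln R) (@measurable_pd0 n.+1).
have mpdb := measurableT_comp (measurableT_comp (@measurable_ln R) (@measurable_pd0 n)) mb.
have mL : measurable_fun setT (fun t : n.+1.-tup => log_ratio 0 t).
  apply: (eq_measurable_fun (fun t : n.+1.-tup => ln (pd 0 t) - ln (pd 0 (tuple_behead t)))).
    by move=> t _; rewrite /log_ratio ln_div ?posrE ?pd0_gt0.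
  exact: measurable_funB.
apply: (wiener_ext (wiener_le (wiener_add rho0 (wiener_cst m rho0 mL)
   (wiener_sub rho0 L2 L1)) _)) => [t|t h hb] /=.
  have -> : (1 - 1 / 4)^-1 = 4 / 3 :> R by field.
  by rewrite lerD2l; lra.
have [a0 E] := H (tuple_behead t) h hb.
have z1 : 0 < 1 + mean_error c1 x1 (tuple_behead t) h by rewrite (wiener_lt1 _ W1).
have z2 : 0 < 1 + mean_error c2 x2 t h by rewrite (wiener_lt1 _ W2).
have w0n i : w 0 i != 0 by rewrite gt_eqF.
have P0n i j : P 0 i j != 0 by rewrite gt_eqF.
have q0n i z : q 0 i z != 0 by rewrite gt_eqF.
have N1 : pd h (tuple_behead t) =
    a (tuple_behead t) h * (pd 0 (tuple_behead t) * (1 + mean_error c1 x1 (tuple_behead t) h)).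
  rewrite /pd -[X in X * (1 + _)]/(\sum_i c1 i (tuple_behead t)) -weight_perturb // mulr_sumr.
  by apply: eq_bigr => j _; rewrite E /x1 /c1; field.
have N2 : pd h t = a (tuple_behead t) h * (pd 0 t * (1 + mean_error c2 x2 t h)).
  rewrite !pE2 -[X in X * (1 + _)]/(\sum_i c2 i t) -weight_perturb // mulr_sumr.
  apply: eq_bigr => j _; rewrite E /x2 /c2; field.
  by rewrite q0n P0n w0n.
rewrite /log_ratio -[behead t]/(tval (tuple_behead t)) N1 N2.
have p0 s : 0 < pd 0 s := pd0_gt0 s.
rewrite -ln_div ?posrE // -lnM ?posrE ?divr_gt0 //; congr ln.
by field; rewrite !gt_eqF.
Qed.

Lemma wiener_pd n : wiener rho (fun t : n.-tup => (1 + del) ^+ (n.*2).+1 * pd 0 t)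
  (fun t h => pd h t).
Proof.
have Wwi i : wiener rho (fun t : n.-tup => (1 + del) * w 0 i) (fun t h => w h i).
  have W := wiener_add rho0 (wiener_cst m rho0 (@measurable_cst _ _ _ R setT 1))
     (wiener_comp (@measurable_cst _ _ n.-tup _ setT tt) (Ww i)).
  have := wiener_scale rho0 (@measurable_cst _ _ _ R setT (w 0 i)) W => {}W.
  apply: (wiener_ext (wiener_le W _)) => [t|t h hb] /=.
    by rewrite normr1 gtr0_norm // mulrC.
  by field; rewrite gt_eqF.
have Wi i := wiener_mul rho0 (Wwi i) (@wiener_bw_weight n i).
apply: (wiener_ext (wiener_le (wiener_sum rho0 (index_enum 'I_l) (P := predT)
   (fun i _ => Wi i)) _)) => [t|t h hb //] /=.
rewrite /pd mulr_sumr; apply: ler_sum => i _; rewrite exprS le_eqVlt; apply/orP; left.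
by apply/eqP; ring.
Qed.

(** * Block entropies and the entropy rate *)

Section entropy.
Hypothesis P_sum : forall h, box rho h -> forall i, \sum_j P h i j = 1.
Hypothesis w_sum : forall h, box rho h -> \sum_i w h i = 1.
Hypothesis w_stationary : forall h, box rho h -> forall j, \sum_i w h i * P h i j = w h j.
Hypothesis q_mass : forall h, box rho h ->
  forall i, (\int[@lebesgue_measure R]_z (q h i z)%:E = 1)%E.
Hypothesis q0_log : forall i j,
  (\int[@lebesgue_measure R]_z (q 0 j z * `|ln (q 0 i z)|)%:E < +oo)%E.

Local Notation mun n := (tuple_measure (@lebesgue_measure R) n).

Lemma measurable_q h i : box rho h -> measurable_fun setT (q h i).
Proof.
move=> hb; have mW := wiener_measurable (Wq i) hb.
apply: (eq_measurable_fun (fun z => q 0 i z * ((q h i z / q 0 i z - 1) + 1))).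
  by move=> z _; rewrite subrK mulrC divfK // gt_eqF.
by apply: measurable_funM => //; exact: measurable_funD.
Qed.

Lemma box0 : box rho (0 : 'rV[R]_m).
Proof. by move=> i; rewrite mxE normr0 ltW. Qed.

(** Given the later observations, the density at [z] is a mean of the values [q 0 i z]: by
    stationarity the weights [a] add up to [pd 0 t]. *)
Lemma log_ratio0_le (t : seq R) z :
  `|log_ratio 0 (z :: t)| <= \sum_i `|ln (q 0 i z)|.
Proof.
set M := \sum_i _.
pose a i := w 0 i * \sum_j P 0 i j * bw 0 t j.
have a0 i : 0 < a i.
  by rewrite mulr_gt0 // sum_gt0 // => j; rewrite mulr_gt0 // bw0_pos.
have aS : \sum_i a i = pd 0 t.
  rewrite /pd /a; under eq_bigr => i _ do rewrite mulr_sumr.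
  rewrite exchange_big /=; apply: eq_bigr => j _.
  by rewrite -(w_stationary box0) mulr_suml; apply: eq_bigr => i _; rewrite mulrA.
have pS : pd 0 (z :: t) = \sum_i a i * q 0 i z.
  by apply: eq_bigr => i _; rewrite /a /=; ring.
have lM i : `|ln (q 0 i z)| <= M.
  by rewrite /M (bigD1 i) //= lerDl sumr_ge0.
have qM i : expR (- M) <= q 0 i z <= expR M.
  have := lM i; rewrite ler_norml => /andP[h1 h2].
  by rewrite -[q 0 i z]lnK ?posrE // !ler_expR h1.
have p0 : 0 < pd 0 t by exact: pd0_gt0.
have r1 : expR (- M) <= pd 0 (z :: t) / pd 0 t <= expR M.
  rewrite ler_pdivlMr // ler_pdivrMr // pS -aS !mulr_sumr.
  apply/andP; split; apply: ler_sum => i _; have /andP[h1 h2] := qM i.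
    by rewrite mulrC; apply: ler_wpM2l => //; exact: ltW.
  by rewrite [leRHS]mulrC; apply: ler_wpM2l => //; exact: ltW.
have r0 : 0 < pd 0 (z :: t) / pd 0 t by rewrite divr_gt0 // pd0_gt0.
by rewrite /log_ratio /= ler_norml -[X in X && _]ler_expR -[X in _ && X]ler_expR lnK.
Qed.

Definition expectation n (F : n.-tup -> 'rV[R]_m -> R) h : R :=
  fine (\int[mun n]_t (pd h t * F t h)%:E)%E.

Lemma wiener_expectation n c F (C : R) : wiener rho c F -> measurable_fun setT c ->
  (\int[mun n]_t (pd 0 t * c t)%:E <= C%:E)%E ->
  (forall h, box rho h -> (mun n).-integrable setT (fun t => (pd h t * F t h)%:E)) /\
  wiener rho (fun _ : unit => (1 + del) ^+ (n.*2).+1 * C) (fun _ => @expectation n F).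
Proof.
move=> WF mc cC; have W := wiener_mul rho0 (@wiener_pd n) WF.
set K := (1 + del) ^+ _ in W *.
have K0 : 0 <= K by rewrite exprn_ge0 // addr_ge0 // ltW // del_gt0.
have mpc : measurable_fun setT (fun t : n.-tup => pd 0 t * c t).
  by apply: measurable_funM => //; exact: measurable_pd0.
have mKpc : measurable_fun setT (fun t : n.-tup => K * pd 0 t * c t).
  by apply: (eq_measurable_fun (fun t : n.-tup => K * (pd 0 t * c t))) => [t _|];
    [rewrite mulrA|exact: measurable_funM].
have c0 t : 0 <= c t by exact: (wiener_ge0 rho0 t WF).
have p0 t : 0 <= pd 0 t by exact: ltW (pd0_gt0 t).
have bound : (\int[mun n]_t (K * pd 0 t * c t)%:E <= (K * C)%:E)%E.
  under eq_integral => t _ do rewrite -mulrA EFinM.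
  rewrite ge0_integralZl //.
  - by rewrite EFinM lee_wpmul2l // lee_fin.
  - exact/measurable_EFinP.
  - by move=> t _; rewrite lee_fin mulr_ge0.
have int h : box rho h -> (mun n).-integrable setT (fun t => (pd h t * F t h)%:E).
  move=> hb; apply: (@le_integrable _ _ R (mun n) setT measurableT (fun t : n.-tup => (pd h t * F t h)%:E)
    (fun t : n.-tup => (K * pd 0 t * c t)%:E)) => //.
  - by apply/measurable_EFinP; exact: (wiener_measurable W hb).
  - move=> t _; rewrite !abse_EFin lee_fin; apply: le_trans (wiener_norm t W hb) _.
    exact: ler_norm.
  - apply/integrableP; split; first exact/measurable_EFinP.
    apply: le_lt_trans (ltry (K * C)); apply: le_trans bound.
    rewrite le_eqVlt; apply/orP; left; apply/eqP; apply: eq_integral => t _.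
    by rewrite gee0_abs // lee_fin !mulr_ge0.
split => //.
have Ws := wiener_comp (@measurable_snd _ _ unit n.-tup) W.
have WI := @wiener_integral R m _ _ unit _ (mun n) rho rho0
  (fun p => K * pd 0 p.2 * c p.2) (fun=> K * C) (fun p h => pd h p.2 * F p.2 h)
  (fun=> @expectation n F) Ws.
apply: WI => //= -[] h hb.
by rewrite fineK //; apply: integrable_fin_num => //; exact: int.
Qed.

Lemma pd0_mass n : (\int[mun n]_t (pd 0 t)%:E = 1)%E.
Proof.
apply: pd_mass => //.
- by move=> i j; exact: ltW (P0_gt0 i j).
- by move=> i z; exact: ltW (q0_gt0 i z).
- exact: q_mass box0.
- by move=> i; exact: ltW (w0_gt0 i).
- exact: w_sum box0.
Qed.

Definition mean_log_ratio n := @expectation n.+1 (fun t h => log_ratio h t).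

(** The pointwise bound involves the first observation only, whose law is the same for all [n]. *)
Lemma mean_log_ratio_bound : exists C : R, forall n,
  (\int[mun n.+1]_t (pd 0 t * (`|log_ratio 0 t| + 1))%:E <= C%:E)%E.
Proof.
pose g z : R := \sum_i `|ln (q 0 i z)| + 1.
have mg : measurable_fun setT g.
  apply: measurable_funD => //; apply: measurable_sum => i.
  by do 2 apply: measurableT_comp => //.
have g0 z : 0 <= g z by rewrite addr_ge0 // sumr_ge0.
have fin j : (\int[@lebesgue_measure R]_z (q 0 j z * g z)%:E < +oo)%E.
  have -> : (\int[@lebesgue_measure R]_z (q 0 j z * g z)%:E =
     \sum_i (1%:E * \int[@lebesgue_measure R]_z (q 0 j z * `|ln (q 0 i z)|)%:E) + 1)%E.
    rewrite -(ge0_integral_lincomb (@lebesgue_measure R) (fun=> ler01)) => [|i|i z].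
    - rewrite -(q_mass box0 j) -ge0_integralD //.
      + apply: eq_integral => z _; rewrite -EFinD; congr EFin.
        rewrite /g mulrDr mulr1; congr (_ + _); rewrite mulr_sumr.
        by apply: eq_bigr => i _; rewrite mul1r.
      + by move=> z _; rewrite lee_fin sumr_ge0 // => i _; rewrite mul1r mulr_ge0 // ltW.
      + apply: (measurableT_comp (@EFin_measurable R setT)); apply: measurable_sum => i.
        apply: measurable_funM => //; apply: (measurable_funM (q0_meas j)).
        by do 2 apply: measurableT_comp => //.
      + by move=> z _; rewrite lee_fin ltW.
      + exact: (measurableT_comp (@EFin_measurable R setT) (q0_meas j)).
    - apply: (measurable_funM (q0_meas j)).
      by do 2 apply: measurableT_comp => //.
    - by rewrite mulr_ge0 // ltW.
  rewrite lte_add_pinfty ?ltry //.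
  by apply: lte_sum_pinfty => i _; rewrite mul1e.
exists (\sum_j w 0 j * fine (\int[@lebesgue_measure R]_z (q 0 j z * g z)%:E)).
move=> n; apply: (@le_trans _ _ (\int[mun n.+1]_t (pd 0 t * g (thead t))%:E)%E).
  have mpt := @measurable_pd0 n.+1.
  apply: ge0_le_integral => //.
  - by move=> t _; rewrite lee_fin mulr_ge0 ?(ltW (pd0_gt0 t)) // addr_ge0.
  - apply/measurable_EFinP; apply: measurable_funM => //; apply: measurable_funD => //.
    apply: measurableT_comp => //.
    exact: (wiener_measurable (@wiener_log_ratio n) box0).
  - apply/measurable_EFinP; apply: measurable_funM => //.
    exact: (measurableT_comp mg (@measurable_thead _ R n)).
  - move=> t _; rewrite lee_fin ler_wpM2l ?(ltW (pd0_gt0 t)) // lerD2r.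
    by rewrite [in leLHS](tuple_consE t); exact: log_ratio0_le.
rewrite pd_first //.
- rewrite -sumEFin le_eqVlt; apply/orP; left; apply/eqP; apply: eq_bigr => j _.
  rewrite EFinM fineK // ge0_fin_numE //; apply: integral_ge0 => z _.
  by rewrite lee_fin mulr_ge0 // ltW.
- by move=> i j; exact: ltW (P0_gt0 i j).
- by move=> i z; exact: ltW (q0_gt0 i z).
- exact: q_mass box0.
- by move=> i; exact: ltW (w0_gt0 i).
Qed.

Lemma wiener_mean_log_ratio n : exists C : R,
  (forall h, box rho h ->
    (mun n.+1).-integrable setT (fun t => (pd h t * log_ratio h t)%:E)) /\
  wiener rho (fun _ : unit => C) (fun _ => mean_log_ratio n).
Proof.
have [C HC] := mean_log_ratio_bound.
have mc : measurable_fun setT (fun t : n.+1.-tup => `|log_ratio 0 t| + 1).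
  apply: measurable_funD => //; apply: measurableT_comp => //.
  exact: (wiener_measurable (@wiener_log_ratio n) box0).
have H := wiener_expectation (@wiener_log_ratio n) mc (HC n).
by exists ((1 + del) ^+ (n.+1.*2).+1 * C).
Qed.

Section fixed_parameter.
Variable h : 'rV[R]_m.
Hypothesis hb : box rho h.

Let P_ge0 i j : 0 <= P h i j. Proof. exact: ltW (P_gt0 i j hb). Qed.
Let q_ge0 i z : 0 <= q h i z. Proof. exact: ltW (q_gt0 i z hb). Qed.
Let w_ge0 i : 0 <= w h i. Proof. exact: ltW (w_gt0 i hb). Qed.
Let q_meas i : measurable_fun setT (q h i). Proof. exact: measurable_q. Qed.
Let pge0 (t : seq R) : 0 <= pd h t. Proof. exact: ltW (pd_gt0 t hb). Qed.
Let mpd n : measurable_fun setT (fun t : n.-tup => pd h t).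
Proof. exact: measurable_pd. Qed.

Lemma marginal_first n (g : n.-tup -> R) : measurable_fun setT g ->
  (\int[mun n.+1]_t (pd h t * g (tuple_behead t))%:E = \int[mun n]_t (pd h t * g t)%:E)%E.
Proof.
move=> mg; apply: pd_marginal_first => //; first exact: q_mass.
exact: w_stationary.
Qed.

Lemma marginal_last n (g : n.-tup -> R) : measurable_fun setT g ->
  (\int[mun n.+1]_t (pd h t * g (tuple_belast t))%:E = \int[mun n]_t (pd h t * g t)%:E)%E.
Proof.
by move=> mg; apply: pd_marginal_last => //; [exact: P_sum|exact: q_mass].
Qed.

Lemma integrable_marginal n (p : n.+1.-tup -> n.-tup) (g : n.-tup -> R) :
  measurable_fun setT p -> measurable_fun setT g ->
  (forall f : n.-tup -> R, measurable_fun setT f ->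
    (\int[mun n.+1]_t (pd h t * f (p t))%:E = \int[mun n]_t (pd h t * f t)%:E)%E) ->
  (mun n).-integrable setT (fun t => (pd h t * g t)%:E) ->
  (mun n.+1).-integrable setT (fun t => (pd h t * g (p t))%:E).
Proof.
move=> mp mg H /integrableP[_ fin]; apply/integrableP; split.
  apply/measurable_EFinP; apply: measurable_funM.
    exact: mpd.
  exact: (measurableT_comp mg mp).
have mag : measurable_fun setT (fun t => `|g t|) by exact: measurableT_comp.
have E k (f : k.-tup -> R) : (\int[mun k]_t `|(pd h t * f t)%:E| =
    \int[mun k]_t (pd h t * `|f t|)%:E)%E.
  by apply: eq_integral => t _; rewrite abse_EFin normrM ger0_norm.
by rewrite (E _ (fun t => g (p t))) (H (fun t => `|g t|)) // -(E _ g).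
Qed.

Let mlr n : measurable_fun setT (fun t : n.+1.-tup => log_ratio h t).
Proof. exact: (wiener_measurable (@wiener_log_ratio n) hb). Qed.

(** The chain rule, with the first observation conditioned on the others, whose density is again
    [pd] by stationarity. Integrability is part of the induction because the integral of the sum has
    to be split. *)
Lemma block_entropy_sum n :
  (mun n).-integrable setT (fun t => (pd h t * ln (pd h t))%:E) /\
  (\int[mun n]_t (pd h t * ln (pd h t))%:E = (\sum_(k < n) mean_log_ratio k h)%:E)%E.
Proof.
have ml k : measurable_fun setT (fun t : k.-tup => ln (pd h t)).
  exact: (measurableT_comp (@measurable_ln R) (@mpd k)).
elim: n => [|n [I IH]].
  have E (t : 0.-tup) : pd h t * ln (pd h t) = 0.
    rewrite tuple0 (_ : pd h _ = 1) ?ln1 ?mulr0 //.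
    by rewrite -[RHS](w_sum hb); apply: eq_bigr => i _; rewrite /= mulr1.
  have E' : (fun t : 0.-tup => (pd h t * ln (pd h t))%:E) = cst 0%E.
    by apply/funext => t; rewrite E.
  rewrite E' big_ord0 integral0; split => //.
  exact: integrable0.
have [C [I1 _]] := wiener_mean_log_ratio n.
have {}I1 := I1 h hb.
have mb := @measurable_tuple_behead _ R n.
have I2 := integrable_marginal mb (ml n) (@marginal_first n) I.
have E : (fun t : n.+1.-tup => (pd h t * ln (pd h t))%:E) =
    (fun t => (pd h t * log_ratio h t)%:E + (pd h t * ln (pd h (tuple_behead t)))%:E)%E.
  apply/funext => t; rewrite -EFinD; congr EFin; rewrite -mulrDr; congr (_ * _).
  by rewrite /log_ratio ln_div ?posrE ?pd_gt0 // subrK.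
rewrite E; split; first exact: integrableD.
rewrite integralD // (marginal_first (ml n)) IH big_ord_recr /= addeC EFinD; congr (_ + _)%E.
by rewrite /mean_log_ratio /expectation fineK //; exact: integrable_fin_num.
Qed.

(** The shorter mean is rewritten as an integral over the longer window that ignores the last
    observation, so the difference becomes one expectation. *)
Lemma mean_log_ratioS n : mean_log_ratio n.+1 h = mean_log_ratio n h +
  @expectation n.+2 (fun t h => log_ratio h t - log_ratio h (tuple_belast t)) h.
Proof.
have [C [I1 _]] := wiener_mean_log_ratio n.
have [C' [I2 _]] := wiener_mean_log_ratio n.+1.
have {}I1 := I1 h hb; have {}I2 := I2 h hb.
have I3 := integrable_marginal (@measurable_tuple_belast _ R n.+1) (@mlr n)
  (@marginal_last n.+1) I1.
rewrite /mean_log_ratio /expectation.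
under [X in _ + fine X]eq_integral => t _ do rewrite mulrBr EFinB.
have F2 := integrable_fin_num measurableT I2.
have F3 := integrable_fin_num measurableT I3.
rewrite (integralB_EFin measurableT I2 I3) (fineB F2 F3).
by rewrite (marginal_last (@mlr n)) addrC subrK.
Qed.

End fixed_parameter.

Lemma forgetting_rate : exists n0 : nat, kap ^- 2 * (1 - kap) ^+ n0 <= 1 / 128.
Proof.
have k0 := kap_gt0; have k1 := kap_le1.
have n1 : `|1 - kap| < 1 by rewrite ger0_norm; lra.
have /cvgrPdist_le/(_ (1 / 128)) := cvg_geometric (kap ^- 2) n1.
have e0 : 0 < 1 / 128 :> R by lra.
move=> /(_ e0)[n0 _ H]; exists n0; have := H n0 (leqnn _).
rewrite sub0r normrN /geometric /=; apply: le_trans; exact: ler_norm.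
Qed.

Let lam : R := (1 + del) ^+ 2 * rc.

(** Since del <= kap / 1024, the growth (1 + del)^2 <= 1 + kap / 256 is outweighed by rc = 1 - kap /
    2. *)
Lemma lam01 : 0 < lam < 1.
Proof.
have k0 := kap_gt0; have k1 := kap_le1; have d0 := del_gt0.
have /andP[r0 r1] := rc01.
have dk : del <= kap / 1024.
  rewrite /del /eta; have : kap * kap <= kap * 1 by rewrite ler_wpM2l // ltW.
  by lra.
apply/andP; split; first by rewrite mulr_gt0 // exprn_gt0 //; lra.
have sq : (1 + del) ^+ 2 <= 1 + kap / 256.
  have : del * del <= del * 1 by rewrite ler_wpM2l ?(ltW d0) //; lra.
  by rewrite expr2; lra.
apply: (@le_lt_trans _ _ ((1 + kap / 256) * rc)); first by rewrite ler_wpM2r // ltW.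
rewrite /rc; have : 0 < kap * kap by rewrite mulr_gt0.
by lra.
Qed.

Lemma entropy_rate_wiener : exists (C : R) (H : 'rV[R]_m -> R),
  wiener rho (fun _ : unit => C) (fun _ => H) /\
  forall h, box rho h ->
    (fun n => ((n.+1%:R^-1)%:E * - \int[mun n.+1]_t (pd h t * ln (pd h t))%:E)%E)
      @ \oo --> (H h)%:E.
Proof.
have [n0 Hn0] := forgetting_rate.
have /andP[l0 l1] := lam01; have /andP[r0 r1] := rc01.
have [C0 [_ W0]] := wiener_mean_log_ratio n0.+1.
pose D k := @expectation (k + n0).+3 (fun t h => log_ratio h t - log_ratio h (tuple_belast t)).
pose K : R := (1 + del) ^+ (n0.+3.*2).+1.
have K0 : 0 <= K by rewrite exprn_ge0 // addr_ge0 // ltW // del_gt0.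
(* The growth of the norm of the density splits into a constant and (1 + del)^(2k), which is part of
   lam^k. *)
have dbl k : (((k + n0).+3.*2).+1 = (n0.+3.*2).+1 + 2 * k)%N.
  by rewrite mul2n -!addnS doubleD addSn addnC.
have WD k : wiener rho (fun _ : unit => K * lam ^+ k) (fun _ => D k).
  have bnd : (\int[mun (k + n0).+3]_t (pd 0 t * rc ^+ k)%:E <= (rc ^+ k)%:E)%E.
    under eq_integral => t _ do rewrite mulrC EFinM.
    rewrite ge0_integralZl //.
    - by rewrite pd0_mass mule1.
    - by apply/measurable_EFinP; exact: measurable_pd0.
    - by move=> t _; rewrite lee_fin ltW // pd0_gt0.
    - by rewrite lee_fin exprn_ge0 // ltW.
  have [_ W] := wiener_expectation (wiener_log_increment Hn0 k) (measurable_cst _) bnd.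
  apply: (wiener_le W) => -[]; rewrite /K /lam exprMn -exprM mulrA -exprD.
  by rewrite dbl.
(* A telescoping series: its partial sums are the means [mean_log_ratio] from index [n0.+1] on. *)
pose F k h := if k is k'.+1 then D k' h else mean_log_ratio n0.+1 h.
have C00 : 0 <= C0 by have := wiener_ge0 rho0 tt W0.
(* Dividing [K] by [lam] makes up for the shift of index in [F], so that one geometric series
   dominates all terms. *)
pose A : R := C0 + K / lam; pose c k : R := A * lam ^+ k.
have A0 : 0 <= A by rewrite addr_ge0 // divr_ge0 // ltW.
have WF k : wiener rho (fun _ : unit => c k) (fun _ => F k).
  case: k => [|k] /=.
    apply: (wiener_le W0) => _; rewrite /c expr0 mulr1 lerDl.
    by rewrite divr_ge0 // ltW.
  apply: (wiener_le (WD k)) => _; rewrite /c /A exprS mulrA.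
  have -> : (C0 + K / lam) * lam = C0 * lam + K by field; rewrite gt_eqF.
  apply: ler_wpM2r; first by rewrite exprn_ge0 // ltW.
  by rewrite lerDr mulr_ge0 // ltW.
have S h n : box rho h -> \sum_(k < n.+1) F k h = mean_log_ratio (n + n0.+1) h.
  move=> hb; elim: n => [|n IH]; first by rewrite big_ord1.
  rewrite big_ord_recr IH /= addSn mean_log_ratioS //; congr (_ + _).
  by rewrite /D -!addnS.
pose H h := limn (series (fun k => F k h)).
have cvgF h : box rho h -> series (fun k => F k h) @ \oo --> H h.
  move=> hb; suff : cvgn (series (fun k => F k h)) by [].
  apply: normed_cvg; apply: (@series_le_cvg _ _ c) => [k|k|k|].
  - exact: normr_ge0.
  - by rewrite mulr_ge0 // exprn_ge0 // ltW.
  - exact: (wiener_norm tt (WF k) hb).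
  - by apply: is_cvg_geometric_series; rewrite gtr0_norm.
exists (A / (1 - lam)), (fun h => - H h); split.
  apply: wiener_opp => //; apply: (wiener_series rho0 WF).
    move=> _ n; rewrite -mulr_sumr ler_pdivlMr ?subr_gt0 //.
    by rewrite -mulrA geometric_sum ler_piMr // gerBl exprn_ge0 // ltW.
  move=> _ h hb; rewrite (_ : (fun n => _) = series (fun k => F k h)); first exact: cvgF.
  by apply/funext => n; rewrite /series /= big_mkord.
move=> h hb.
have cG : (fun n => mean_log_ratio n h) @ \oo --> H h.
  rewrite -(cvg_shiftn n0.+1); have := cvgF h hb; rewrite -[X in X -> _](cvg_shiftn 1) => cF.
  apply: cvg_trans cF; apply: near_eq_cvg; near=> n.
  by rewrite /= /series /= big_mkord addn1 S.
have cA : - arithmetic_mean (fun n => mean_log_ratio n h) @ \oo --> - H h.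
  by apply: cvgN; exact: cesaro.
have : (fun n => (- (n.+1%:R^-1 * \sum_(k < n.+1) mean_log_ratio k h))%:E) @ \oo --> (- H h)%:E.
  apply: cvg_EFin; first exact: nearW.
  apply: cvg_trans cA; apply: near_eq_cvg; near=> n.
  by rewrite /= fctE /arithmetic_mean /= /series /= big_mkord.
apply: cvg_trans; apply: near_eq_cvg; near=> n.
by have [_ ->] := block_entropy_sum hb n.+1; rewrite -EFinN -EFinM mulrN.
Unshelve. all: by end_near.
Qed.

End entropy.

End perturbed_chain.

(** * Lower bounds and the stationary vector *)

Lemma pos_lower_bound (R : realType) (I : finType) (f : I -> R) :
  (forall i, 0 < f i) -> exists c : R, 0 < c <= 1 /\ forall i, c <= f i.
Proof.
(* The summand 1 ensures that the bound is at most 1 and covers an empty [I]. *)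
move=> f0; pose S := 1 + \sum_i (f i)^-1.
have S1 : 1 <= S by rewrite lerDl sumr_ge0 // => i _; rewrite invr_ge0 ltW.
have S0 : 0 < S by lra.
exists S^-1; split; first by rewrite invr_gt0 S0 invf_le1.
move=> i; rewrite -[f i]invrK lef_pV2 ?posrE ?invr_gt0 //.
rewrite /S (bigD1 i) //= addrCA lerDl addr_ge0 // sumr_ge0 // => j _.
by rewrite invr_ge0 ltW.
Qed.

(* Since [w = w (P - c J) + c 1], with [J] the all-ones matrix, [w] is the sum
   of the Neumann series [sum_n c 1 (P - c J)^n]. *)
Lemma wiener_stationary (R : realType) (m l : nat) (rho : R)
    (P : 'rV[R]_m -> 'I_l -> 'I_l -> R) (w : 'rV[R]_m -> 'I_l -> R)
    (a : 'I_l -> 'I_l -> R) (c theta : R) :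
  0 < rho -> 0 <= c -> 0 <= theta < 1 ->
  (forall i j, wiener rho (fun _ : unit => a i j) (fun _ h => P h i j - c)) ->
  (forall i, \sum_j a i j <= theta) ->
  (forall h, box rho h -> [/\ forall j, 0 <= w h j, \sum_j w h j = 1 &
    forall j, \sum_i w h i * P h i j = w h j]) ->
  forall j, exists C : R, wiener rho (fun _ : unit => C) (fun _ h => w h j).
Proof.
move=> rho0 c0 /andP[th0 th1] WP at_ Hw j.
pose V n := iter n (fun (v : 'I_l -> 'rV[R]_m -> R) j h =>
  \sum_i v i h * (P h i j - c)) (fun _ _ => c).
pose v n := iter n (fun (u : 'I_l -> R) j => \sum_i u i * a i j) (fun=> c).
have a0 i k : 0 <= a i k by have := wiener_ge0 rho0 tt (WP i k).
have WV n k : wiener rho (fun _ : unit => v n k) (fun _ h => V n k h).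
  elim: n k => [|n IH] k.
    apply: (wiener_le (wiener_cst m rho0 (@measurable_cst _ _ unit R setT c))) => _ /=.
    by rewrite ger0_norm.
  exact: (wiener_sum rho0 (index_enum 'I_l) (P := predT)
    (fun i _ => wiener_mul rho0 (IH i) (WP i k))).
have v0 n k : 0 <= v n k by have := wiener_ge0 rho0 tt (WV n k).
have contr (u : 'I_l -> R) : (forall i, 0 <= u i) ->
    \sum_k \sum_i u i * a i k <= theta * \sum_i u i.
  move=> u0; rewrite exchange_big /= mulr_sumr; apply: ler_sum => i _.
  by rewrite -mulr_sumr mulrC ler_wpM2r.
have vS n : \sum_k v n k <= theta ^+ n * (\sum_(k < l) c).
  elim: n => [|n IH]; first by rewrite expr0 mul1r.
  by apply: le_trans (contr _ (v0 n)) _; rewrite exprS -mulrA ler_wpM2l.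
have vj n : v n j <= theta ^+ n * (\sum_(k < l) c).
  by apply: le_trans (vS n); rewrite (bigD1 j) //= lerDl sumr_ge0.
exists ((\sum_(k < l) c) / (1 - theta)).
apply: (wiener_series rho0 (fun n => WV n j)) => [_ n|_ h hb].
  apply: (@le_trans _ _ (\sum_(k < n) theta ^+ k * \sum_(i < l) c)).
    by apply: ler_sum => k _.
  have cl : 0 <= \sum_(i < l) c by rewrite sumr_ge0.
  rewrite -mulr_suml ler_pdivlMr ?subr_gt0 // mulrAC geometric_sum mulrC.
  by rewrite ler_piMr // gerBl exprn_ge0.
have [w0 w1 wP] := Hw h hb.
(* The remainder starts from [w] itself and is multiplied by P - c at each step, so its l^1 norm is
   at most theta^n; this identifies the sum of the series. *)
pose e n k := w h k - \sum_(i < n) V i k h.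
have eS n k : e n.+1 k = \sum_i e n i * (P h i k - c).
  rewrite [RHS](eq_bigr (fun i => w h i * P h i k - w h i * c -
    (\sum_(n' < n) V n' i h) * (P h i k - c))); last by move=> i _; rewrite /e; ring.
  rewrite !sumrB wP -mulr_suml w1 mul1r /e big_ord_recl.
  rewrite opprD addrA; congr (_ - _).
  under [RHS]eq_bigr => i _ do rewrite mulr_suml.
  by rewrite exchange_big.
have eb n : \sum_k `|e n k| <= theta ^+ n.
  elim: n => [|n IH].
    rewrite expr0 -w1; apply: ler_sum => k _.
    by rewrite /e big_ord0 subr0 ger0_norm.
  have : \sum_k `|e n.+1 k| <= \sum_k \sum_i `|e n i| * a i k.
    apply: ler_sum => k _; rewrite eS; apply: le_trans (ler_norm_sum _ _ _) _.
    apply: ler_sum => i _; rewrite normrM ler_wpM2l //.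
    exact: (wiener_norm tt (WP i k) hb).
  move/le_trans; apply; apply: le_trans (contr _ _) _ => //.
  by rewrite exprS ler_wpM2l.
have cth : (fun n => theta ^+ n : R) @ \oo --> (0 : R).
  have := @cvg_geometric R 1 theta; rewrite ger0_norm // => /(_ th1).
  by apply: cvg_trans; apply: near_eq_cvg; near=> n; rewrite /= mul1r.
apply/cvgrPdist_le => /= x x0; have /cvgrPdist_le/(_ x x0) := cth.
apply: filterS => n; rewrite sub0r normrN ger0_norm ?exprn_ge0 // => h1.
apply: le_trans h1; apply: le_trans (eb n).
by rewrite -/(e n j) (bigD1 j) //= lerDl sumr_ge0.
Unshelve. all: by end_near.
Qed.

(** * Smallness on small boxes *)

Section small_radius.
Variables (R : realType) (m : nat).
Context d (Z : measurableType d).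

(** Conditions on the radius are phrased as holding near 0 on the right, so that finitely many of
    them share a radius without explicit minima. *)
Lemma near_small (r0 : R) (Q : R -> Prop) : 0 < r0 ->
  (forall r, 0 < r <= r0 -> Q r) -> \forall r \near 0^'+, Q r.
Proof.
move=> r00 H; near=> r; apply: H; apply/andP; split.
  by near: r; exact: nbhs_right_gt.
by near: r; exact: nbhs_right_le.
Unshelve. all: by end_near.
Qed.

(** A majorant proportional to [F z 0] makes the radius independent of [z]: on the box of radius r
    the nonconstant part has norm at most r / rho times the majorant. *)
Lemma wiener_relative (rho K del : R) (c : Z -> R) (F : Z -> 'rV[R]_m -> R) :
  0 < rho -> 0 < del -> wiener rho c F -> (forall z, 0 < F z 0) ->
  (forall z, c z <= K * F z 0) ->
  \forall r \near 0^'+, wiener r (fun=> del) (fun z h => F z h / F z 0 - 1).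
Proof.
move=> rho0 d0 W F0 cK; pose K1 := `|K| + 1.
have K10 : 0 < K1 by rewrite ltr_pwDr.
have r00 : 0 < Num.min rho (rho * del / K1) by rewrite lt_min rho0 !divr_gt0 // mulr_gt0.
apply: near_small r00 _ => r; rewrite le_min => /and3P[r0 r1 r2].
have hb0 : box rho (0 : 'rV[R]_m) by move=> i; rewrite mxE normr0 ltW.
have rr : 0 < r <= rho by rewrite r0.
have W1 := wiener_shrink rho0 rr W.
have mF : measurable_fun setT (fun z => expR (- ln (F z 0))).
  apply: measurableT_comp => //; apply: measurableT_comp => //.
  by apply: measurableT_comp => //; exact: (wiener_measurable W hb0).
apply: (wiener_ext (wiener_le (wiener_scale r0 mF W1) _)) => [z|z h hb].
  rewrite expRN lnK ?posrE // gtr0_norm ?invr_gt0 // mulrC ler_pdivrMr //.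
  have cz : c z <= K1 * F z 0.
    apply: le_trans (cK z) _; rewrite ler_pM2r // /K1.
    by have := ler_norm K; lra.
  apply: (@le_trans _ _ (r / rho * (K1 * F z 0))).
    by rewrite ler_wpM2l // divr_ge0 // ltW.
  rewrite mulrA ler_pM2r // mulrAC ler_pdivrMr // -ler_pdivlMr //.
  by rewrite [del * rho]mulrC.
by rewrite expRN lnK ?posrE // mulrBr mulVf ?gt_eqF // mulrC.
Qed.

Lemma near_small_box (A : set 'rV[R]_m) (x : 'rV[R]_m) : open A -> A x ->
  \forall r \near 0^'+, forall h, box r h -> A (x + h).
Proof.
move=> oA Ax; have /nbhs_ballP[e /= e0 H] : nbhs x A by exact: open_nbhs_nbhs.
have e20 : 0 < e / 2 by rewrite divr_gt0.
apply: near_small e20 _ => r /andP[r0 re] h hb; apply: H; split => // i j.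
rewrite -ball_normE /= mxE opprD addNKr normrN.
rewrite (ord1 i); apply: le_lt_trans (hb j) _; lra.
Qed.

End small_radius.

(** * Consequences of the hypotheses on the complex extension *)

Local Open Scope complex_scope.

Lemma complex_measurable_section (R : realType) (m : nat) (f : 'rV[R[i]^o]_m -> R -> R[i])
    (B : set 'rV[R[i]^o]_m) (w : 'rV[R[i]^o]_m) :
  {within [set: R] `*` B, continuous ((fun zt => f zt.2 zt.1) : R * 'rV[R[i]^o]_m -> R[i]^o)} ->
  B w -> complex_measurable (f w).
Proof.
move=> /subspace_continuousP cf Bw.
have near_eps (z0 e : R) : 0 < e ->
    \forall z \near z0, normc (f w z0 - f w z) <= e.
  move=> e0; have /cvgrPdist_le H := cf (z0, w) (conj I Bw).
  have e0C : 0 < e%:C by rewrite ltcR.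
  have {}H := H _ e0C.
  have [[U V] /= [zU wV] UV] := H.
  apply: filterS zU => z Uz; have := UV (z, w) (conj Uz (nbhs_singleton wV)) (conj I Bw).
  by move=> h1; rewrite -lecR; exact: h1.
split; apply: continuous_measurable_fun => z0; apply/cvgrPdist_le => e e0.
- have := near_eps z0 e e0; apply: filterS => z; apply: le_trans.
  by rewrite -raddfB nc_Re.
- have := near_eps z0 e e0; apply: filterS => z; apply: le_trans.
  by rewrite -raddfB nc_Im.
Qed.

Lemma normc_le_of_clog (R : realType) (x : R[i]) :
  normc (clog x) <= 1 -> normc x <= expR 1.
Proof.
have [x0|x0] := ltP 0 (normc x); last by move=> _; apply: le_trans x0 _; exact: expR_ge0.
move=> /(le_trans (nc_Re (clog x))) H1.
rewrite -[normc x]lnK ?posrE // ler_expR; apply: le_trans H1; exact: ler_norm.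
Qed.

(** The value [q i z] lies between the two envelopes, so |ln q| is at most the absolute logarithm of
    the upper envelope where ln q >= 0 and of the lower one elsewhere; the weight [q j z] is at most
    the upper envelope. Extended logarithms allow the envelopes to be zero or infinite. *)
Lemma log_envelope_integrable (R : realType) (l m : nat)
    (qC : 'rV[R[i]]_m -> 'I_l -> R -> R[i]) (q : 'I_l -> R -> R) (x : 'rV[R]_m) (r : R)
    (w : 'rV[R[i]]_m) i j :
  complex_ball x r w -> (forall y z, 0 < q y z) ->
  (forall y, measurable_fun setT (q y)) ->
  (forall y z, qC w y z = (q y z)%:C) ->
  (@lebesgue_measure R).-integrable setT
    (fun z => q_breve qC x r z * lne (q_hat qC x r z))%E ->
  (@lebesgue_measure R).-integrable setT
    (fun z => q_breve qC x r z * lne (q_breve qC x r z))%E ->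
  (\int[@lebesgue_measure R]_z (q j z * `|ln (q i z)|)%:E < +oo)%E.
Proof.
move=> xw q0 mq qE i1 i2.
have env y z : envelope_values qC x r z (q y z)%:E.
  by exists (y, w) => //=; rewrite qE nc_real gtr0_norm.
have up y z : ((q y z)%:E <= q_breve qC x r z)%E by exact: ereal_sup_ubound.
have lo y z : (q_hat qC x r z <= (q y z)%:E)%E by exact: ereal_inf_lbound.
have lo0 z : (0 <= q_hat qC x r z)%E.
  by apply: le_ereal_inf_tmp => _ [[y v] _ <-]; rewrite lee_fin nc_ge0.
have up0 z : (0 <= q_breve qC x r z)%E by apply: le_trans (up i z); rewrite lee_fin ltW.
set b := q_breve qC x r in i1 i2 up up0; set a := q_hat qC x r in i1 lo lo0.
have [/integrableP[m1 f1] /integrableP[m2 f2]] := (i1, i2).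
apply: (@le_lt_trans _ _ (\int[@lebesgue_measure R]_z
   (`|b z * lne (a z)| + `|b z * lne (b z)|))%E); last first.
  rewrite ge0_integralD //; last 2 first.
  - exact: measurableT_comp.
  - exact: measurableT_comp.
  by rewrite lte_add_pinfty.
apply: ge0_le_integral => //.
- by move=> z _; rewrite lee_fin mulr_ge0 // ltW.
- apply: (measurableT_comp (@EFin_measurable R setT)); apply: (measurable_funM (mq j)).
  apply: measurableT_comp => //; exact: (measurableT_comp (@measurable_ln R) (mq i)).
- by apply: emeasurable_funD; exact: measurableT_comp.
move=> z _; rewrite !abseM (gee0_abs (up0 z)) -ge0_muleDr //.
rewrite EFinM; apply: lee_pmul => //.
  by rewrite lee_fin ltW.
have lE : ((ln (q i z))%:E = lne (q i z)%:E)%E by rewrite lne_EFin.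
have pa : (lne (a z) <= (ln (q i z))%:E)%E.
  by rewrite lE lee_lne ?lo // !in_itv /= ?lo0 ?leey // lee_fin ltW.
have pb : ((ln (q i z))%:E <= lne (b z))%E.
  by rewrite lE lee_lne ?up // !in_itv /= ?up0 ?leey // lee_fin ltW.
have [n0|n0] := leP 0 (ln (q i z)).
  apply: (@le_trans _ _ `|lne (b z)|%E); last by rewrite leeDr.
  by rewrite (le_trans _ (lee_abs _)) // ger0_norm.
apply: (@le_trans _ _ `|lne (a z)|%E); last by rewrite leeDl.
rewrite -abseN; apply: le_trans (lee_abs _).
by rewrite ltr0_norm // EFinN leeN2.
Qed.

Section product_parameters.
Variables (R : realType) (m1 m2 : nat).
Context d (Z : measurableType d).

Lemma wiener_lsubmx (rho : R) (c : Z -> R) (F : Z -> 'rV[R]_m1 -> R) : 0 < rho ->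
  wiener rho c F -> wiener rho c (fun z (h : 'rV[R]_(m1 + m2)) => F z (lsubmx h)).
Proof.
move=> rho0 W; apply: (wiener_ext (wiener_subvars (@lshift m1 m2) rho0 W)) => z h _.
by congr (F z _); apply/rowP => i; rewrite !mxE.
Qed.

Lemma wiener_rsubmx (rho : R) (c : Z -> R) (F : Z -> 'rV[R]_m2 -> R) : 0 < rho ->
  wiener rho c F -> wiener rho c (fun z (h : 'rV[R]_(m1 + m2)) => F z (rsubmx h)).
Proof.
move=> rho0 W; apply: (wiener_ext (wiener_subvars (@rshift m1 m2) rho0 W)) => z h _.
by congr (F z _); apply/rowP => i; rewrite !mxE.
Qed.

Lemma box_lsubmx (r : R) (h : 'rV[R]_(m1 + m2)) : box r h -> box r (lsubmx h).
Proof. by move=> hb i; rewrite mxE. Qed.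

Lemma box_rsubmx (r : R) (h : 'rV[R]_(m1 + m2)) : box r h -> box r (rsubmx h).
Proof. by move=> hb i; rewrite mxE. Qed.

End product_parameters.

Lemma complex_ball_box (R : realType) (m : nat) (x : 'rV[R]_m) (e : R) : 0 < e ->
  \forall r \near 0^'+, forall h, box r h -> complex_ball x e (to_complex (x + h)).
Proof.
move=> e0; have m0 : 0 < m.+1%:R :> R by rewrite ltr0n.
have r00 : 0 < e / m.+1%:R by rewrite divr_gt0.
apply: near_small r00 _ => r /andP[r0 re] h hb; rewrite /complex_ball /=.
rewrite -[ltRHS]ger0_norm ?(ltW e0) // -sqrtr_sqr ltr_sqrt ?exprn_gt0 //.
have hj j : normc (to_complex (x + h) 0 j - (x 0 j)%:C) ^+ 2 <= (e / m.+1%:R) ^+ 2.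
  have -> : to_complex (x + h) 0 j - (x 0 j)%:C = (h 0 j)%:C.
    by rewrite !mxE rmorphD /= addrAC subrr add0r.
  have e1 : `|h 0 j| <= e / m.+1%:R := le_trans (hb j) re.
  have e2 : 0 <= e / m.+1%:R := ltW (lt_le_trans r0 re).
  by rewrite nc_real lerXn2r // nnegrE.
apply: (@le_lt_trans _ _ (\sum_(j < m) (e / m.+1%:R) ^+ 2)); first exact: ler_sum.
have -> : \sum_(j < m) (e / m.+1%:R) ^+ 2 = e ^+ 2 * (m%:R / m.+1%:R ^+ 2).
  rewrite sumr_const card_ord -[LHS]mulr_natr expr_div_n -mulrA.
  by rewrite [X in _ * X]mulrC.
have m1 : m%:R / m.+1%:R ^+ 2 < 1 :> R.
  rewrite ltr_pdivrMr ?exprn_gt0 // mul1r -natrX ltr_nat -mulnn.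
  exact: leq_pmulr.
by rewrite -[ltRHS]mulr1 ltr_pM2l // exprn_gt0.
Qed.

Lemma complex_ball_center (R : realType) (m : nat) (x : 'rV[R]_m) (e : R) : 0 < e ->
  complex_ball x e (to_complex x).
Proof.
move=> e0; rewrite /complex_ball /= big1 ?sqrtr0 // => j _.
by rewrite !mxE subrr nc_real normr0 expr0n.
Qed.

(** * Verification of the perturbative setting near the given parameters *)

Section nearby_chains.
Variables (R : realType) (l m1 m2 : nat).
Variables (Omega1 : set 'rV[R]_m1) (Omega2 : set 'rV[R]_m2)
  (Pi : 'rV[R]_m1 -> 'M[R]_l) (pi : 'rV[R]_m1 -> 'rV[R]_l)
  (q : 'rV[R]_m2 -> 'I_l -> R -> R) (qC : 'rV[R[i]]_m2 -> 'I_l -> R -> R[i])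
  (eps0 : 'rV[R]_m1) (theta0 : 'rV[R]_m2).
Hypothesis open1 : open Omega1.
Hypothesis open2 : open Omega2.
Hypothesis Pi_stochastic : forall eps, Omega1 eps -> stochastic_matrix (Pi eps).
Hypothesis Pi_analytic : forall i j, analytic_on Omega1 (fun eps => Pi eps i j).
Hypothesis pi_stationary : forall eps, Omega1 eps -> stationary_vector (Pi eps) (pi eps).
Hypothesis q_density : forall theta, Omega2 theta -> forall y, probability_density (q theta y).
Hypothesis eps0_in : Omega1 eps0.
Hypothesis theta0_in : Omega2 theta0.
Hypothesis Pi_gt0 : forall i j, 0 < Pi eps0 i j.
Hypothesis q_gt0 : forall y z, 0 < q theta0 y z.
Variables r1 r2 : R.
Hypothesis r10 : 0 < r1.
Hypothesis r20 : 0 < r2.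
Hypothesis qR : forall theta, Omega2 theta -> complex_ball theta0 r2 (to_complex theta) ->
  forall y z, qC (to_complex theta) y z = (q theta y z)%:C.
Hypothesis qA : forall y z, analytic_on (complex_ball theta0 r2) (fun theta => qC theta y z).
Hypothesis qcont : forall y,
  {within [set: R] `*` (complex_ball theta0 r2 : set 'rV[R[i]^o]_m2),
     continuous ((fun zt => qC zt.2 y zt.1) : R * 'rV[R[i]^o]_m2 -> R[i]^o)}.
Hypothesis int1 : (@lebesgue_measure R).-integrable setT
  (fun z => q_breve qC theta0 r2 z * lne (q_hat qC theta0 r2 z))%E.
Hypothesis int2 : (@lebesgue_measure R).-integrable setT
  (fun z => q_breve qC theta0 r2 z * lne (q_breve qC theta0 r2 z))%E.
Hypothesis close : forall y z theta, complex_ball theta0 r1 theta ->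
  normc (clog (qC theta y z / (q theta0 y z)%:C)) <= 1.

Let x0 : 'rV[R]_(m1 + m2) := row_mx eps0 theta0.
Let P h i j := Pi (lsubmx (x0 + h)) i j.
Let w h j := pi (lsubmx (x0 + h)) 0 j.
Let Q h y z := q (rsubmx (x0 + h)) y z.

Lemma lsub_shift h : lsubmx (x0 + h) = eps0 + lsubmx h.
Proof. by rewrite linearD /= row_mxKl. Qed.

Lemma rsub_shift h : rsubmx (x0 + h) = theta0 + rsubmx h.
Proof. by rewrite linearD /= row_mxKr. Qed.

Let P0E i j : P 0 i j = Pi eps0 i j.
Proof. by rewrite /P addr0 row_mxKl. Qed.

Let Q0E y z : Q 0 y z = q theta0 y z.
Proof. by rewrite /Q addr0 row_mxKr. Qed.

Lemma near_domain : \forall r \near 0^'+, forall h, box r h ->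
  Omega1 (lsubmx (x0 + h)) /\ Omega2 (rsubmx (x0 + h)).
Proof.
have N1 := near_small_box open1 eps0_in; have N2 := near_small_box open2 theta0_in.
near=> r => h hb; rewrite lsub_shift rsub_shift; split.
- have H : forall h1, box r h1 -> Omega1 (eps0 + h1) by near: r.
  by apply: H; exact: box_lsubmx.
- have H : forall h1, box r h1 -> Omega2 (theta0 + h1) by near: r.
  by apply: H; exact: box_rsubmx.
Unshelve. all: by end_near.
Qed.

Lemma near_transition (del : R) : 0 < del -> \forall r \near 0^'+, forall i j,
  wiener r (fun _ : unit => del) (fun _ h => P h i j / P 0 i j - 1).
Proof.
move=> d0; apply: filter_forall => i; apply: filter_forall => j.
have [r [C [r0 W]]] := analytic_at_wiener (@Pi_analytic i j _ eps0_in).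
have {}W := wiener_lsubmx m2 r0 W.
have {}W : wiener r (fun _ : unit => C) (fun _ h => P h i j).
  by apply: (wiener_ext W) => z h hb; rewrite /P lsub_shift.
apply: (wiener_relative (K := C / P 0 i j) r0 d0 W) => _ /=; first by rewrite P0E.
by rewrite divfK // P0E gt_eqF.
Qed.

Lemma near_stationary (del : R) : 0 < del -> \forall r \near 0^'+, forall j,
  0 < w 0 j /\ wiener r (fun _ : unit => del) (fun _ h => w h j / w 0 j - 1).
Proof.
move=> d0; apply: filter_forall => j.
have [c [/andP[c0 c1] cP]] := pos_lower_bound (fun p : 'I_l * 'I_l => Pi_gt0 p.1 p.2).
(* By stationarity the component is a mean of entries of [Pi eps0], hence at least [c]. *)
have wj : 0 < w 0 j.
  rewrite /w addr0 row_mxKl; have [pi0 pi1 piP] := pi_stationary eps0_in.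
  apply: lt_le_trans c0 _; rewrite -piP mxE -[c]mul1r -pi1 mulr_suml.
  by apply: ler_sum => i _; rewrite ler_wpM2l // (cP (i, j)).
have c20 : 0 < c / 2 by lra.
have [r0 [[r00 dom] relP]] : exists r0, (0 < r0 /\ forall h, box r0 h ->
    Omega1 (lsubmx (x0 + h)) /\ Omega2 (rsubmx (x0 + h))) /\
    forall i j, wiener r0 (fun _ : unit => c / 2) (fun _ h => P h i j / P 0 i j - 1).
  have N1 := near_domain; have N2 := near_transition c20.
  apply: (@filter_ex _ (0 : R)^'+); near=> r; split; first split.
  - by near: r; exact: nbhs_right_gt.
  - by near: r.
  - by near: r.
have P1 i k : P 0 i k <= 1.
  rewrite P0E; have [st0 st1] := Pi_stochastic eps0_in.
  by rewrite -(st1 i) (bigD1 k) //= lerDl sumr_ge0.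
have WP i k : wiener r0 (fun _ : unit => P 0 i k - c + P 0 i k * (c / 2))
    (fun _ h => P h i k - c).
  have W1 := wiener_cst (m1 + m2) r00 (@measurable_cst _ _ unit R setT (P 0 i k - c)).
  have W2 := wiener_scale r00 (@measurable_cst _ _ unit R setT (P 0 i k)) (relP i k).
  apply: (wiener_ext (wiener_le (wiener_add r00 W1 W2) _)) => [_|_ h hb] /=.
    by rewrite !ger0_norm ?subr_ge0 ?P0E ?(cP (i, k)) // ltW.
  by field; rewrite P0E gt_eqF.
have [C W] : exists C : R, wiener r0 (fun _ : unit => C) (fun _ h => w h j).
  (* The row sums of the majorants are 1 - l * c + c / 2, at most 1 - c / 2 because there is at
     least one state. *)
  have th : 0 <= 1 - c / 2 < 1 by apply/andP; split; lra.
  apply: (wiener_stationary r00 (ltW c0) th WP) => [i|h hb].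
    rewrite big_split /= sumrB -mulr_suml sumr_const card_ord.
    have -> : \sum_k P 0 i k = 1.
      by under eq_bigr => k _ do rewrite P0E; case: (Pi_stochastic eps0_in).
    have : c <= c *+ l.
      rewrite -[_ *+ l]mulr_natr ler_peMr ?(ltW c0) // ler1n.
      exact: leq_ltn_trans (ltn_ord i).
    by lra.
  have [dom1 _] := dom h hb; have [pi0 pi1 piP] := pi_stationary dom1.
  by split => // k; rewrite /w -[in RHS]piP mxE.
have N := wiener_relative (K := C / w 0 j) r00 d0 W (fun=> wj) _.
have {}N : \forall r \near 0^'+,
    wiener r (fun _ : unit => del) (fun _ h => w h j / w 0 j - 1).
  by apply: N => _; rewrite divfK // gt_eqF.
by apply: filterS N => r.
Unshelve. all: by end_near.
Qed.

(** The bound on the logarithm gives |q^theta| <= e q^theta0, a majorant proportional to the value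
    at the centre; [wiener_relative] then finds one radius for all observations [z]. On real points
    the real part of the extension is [q]. *)
Lemma near_channel (del : R) : 0 < del ->
  \forall r \near 0^'+, forall y,
    wiener r (fun _ : R => del) (fun z h => Q h y z / Q 0 y z - 1).
Proof.
move=> d0; apply: filter_forall => y.
have r120 : 0 < Num.min r1 r2 by rewrite lt_min r10.
have sub1 t : complex_ball theta0 (Num.min r1 r2) t -> complex_ball theta0 r1 t.
  by rewrite /complex_ball /= lt_min => /andP[].
have sub2 t : complex_ball theta0 (Num.min r1 r2) t -> complex_ball theta0 r2 t.
  by rewrite /complex_ball /= lt_min => /andP[].
have bound z t : complex_ball theta0 (Num.min r1 r2) t ->
    normc (qC t y z) <= expR 1 * q theta0 y z.
  move=> Bt; have := normc_le_of_clog (@close y z t (sub1 t Bt)).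
  have E : normc (qC t y z) = normc (qC t y z / (q theta0 y z)%:C) * q theta0 y z.
    rewrite -[X in _ = _ * X]gtr0_norm // -nc_real -normcM divfK //.
    by rewrite -(rmorph0 (real_complex R)) (inj_eq (fmorph_inj _)) gt_eqF.
  by rewrite E ler_pM2r.
have [rho [rho0 W]] := @wiener_of_complex R m2 _ R (fun z t => qC t y z) theta0
  (Num.min r1 r2) (fun z => expR 1 * q theta0 y z) r120
  (fun z t Bt => @qA y z t (sub2 t Bt)) bound
  (fun t Bt => complex_measurable_section (f := fun t z => qC t y z) (@qcont y) (sub2 t Bt)).
have {}W := wiener_rsubmx m1 rho0 W.
pose F z (h : 'rV[R]_(m1 + m2)) := complex.Re (qC (to_complex (theta0 + rsubmx h)) y z).
have F0 z : F z 0 = q theta0 y z.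
  rewrite /F linear0 addr0 qR //.
  exact: complex_ball_center.
have N1 := @complex_ball_box R m2 theta0 _ r20.
have N2 : \forall r \near 0^'+, wiener r (fun _ : R => del) (fun z h => F z h / F z 0 - 1).
  apply: (wiener_relative (K := expR 1 * 2 ^+ m2) rho0 d0 W) => z; first by rewrite -/(F z 0) F0.
  by rewrite -/(F z 0) F0 mulrAC.
have N3 := near_domain.
near=> r.
have H1 : forall h, box r h -> complex_ball theta0 r2 (to_complex (theta0 + h)) by near: r.
have H2 : forall h, box r h -> Omega1 (lsubmx (x0 + h)) /\ Omega2 (rsubmx (x0 + h)).
  by near: r.
have H3 : wiener r (fun _ : R => del) (fun z h => F z h / F z 0 - 1) by near: r.
apply: (wiener_ext H3) => z h hb; rewrite Q0E F0 /Q /F; congr (_ / _ - _).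
have [_ dom] := H2 h hb; rewrite rsub_shift in dom *.
by rewrite qR //; apply: H1; exact: box_rsubmx.
Unshelve. all: by end_near.
Qed.

Lemma entropy_rate_near :
  exists (r C : R) (H : 'rV[R]_(m1 + m2) -> R), [/\ 0 < r,
    forall h, box r h -> Omega1 (lsubmx (x0 + h)) /\ Omega2 (rsubmx (x0 + h)),
    wiener r (fun _ : unit => C) (fun _ => H) &
    forall h, box r h -> normalized_block_entropy (Pi (lsubmx (x0 + h)))
      (pi (lsubmx (x0 + h))) (q (rsubmx (x0 + h))) @ \oo --> (H h)%:E].
Proof.
have [c [/andP[c0 c1] cP]] := pos_lower_bound (fun p : 'I_l * 'I_l => Pi_gt0 p.1 p.2).
(* Without states, the components of a stationary vector could not sum to 1. *)
have [i0 _] : exists i : 'I_l, True.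
  apply: contrapT => /forallNP H; have [_ + _] := pi_stationary eps0_in.
  rewrite big1 => [|i _]; last by have := H i.
  by move/eqP; rewrite eq_sym oner_eq0.
(* The [del] of the perturbed chain, for kap = c. *)
pose del : R := c * (c / 256) / 4.
have d0 : 0 < del.
  by have : 0 < c * c by [rewrite mulr_gt0]; rewrite /del; lra.
have N1 := near_transition d0; have N2 := near_stationary d0.
have N3 := near_channel d0; have N4 := near_domain.
have [r [[r0 dom] [WP [Ww WQ]]]] : exists r : R, (0 < r /\ forall h, box r h ->
    Omega1 (lsubmx (x0 + h)) /\ Omega2 (rsubmx (x0 + h))) /\
  (forall i j, wiener r (fun _ : unit => del) (fun _ h => P h i j / P 0 i j - 1)) /\
  (forall j, 0 < w 0 j /\ wiener r (fun _ : unit => del) (fun _ h => w h j / w 0 j - 1)) /\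
  forall y, wiener r (fun _ : R => del) (fun z h => Q h y z / Q 0 y z - 1).
  apply: (@filter_ex _ (0 : R)^'+); near=> r; split; [split|split; [|split]].
  - by near: r; exact: nbhs_right_gt.
  - by near: r.
  - by near: r.
  - by near: r.
  - by near: r.
have st h : box r h -> stochastic_matrix (Pi (lsubmx (x0 + h))).
  by move=> hb; apply: Pi_stochastic; case: (dom h hb).
have qd h : box r h -> forall y, probability_density (q (rsubmx (x0 + h)) y).
  by move=> hb; apply: q_density; case: (dom h hb).
have b0 : box r (0 : 'rV[R]_(m1 + m2)) by move=> i; rewrite mxE normr0 ltW.
have P0_sum i : \sum_j P 0 i j = 1 by case: (st 0 b0) => _ /(_ i).
have q0m y : measurable_fun setT (Q 0 y) by case: (qd 0 b0 y).
have Qg y z : 0 < Q 0 y z by rewrite Q0E.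
have P1 i k : P 0 i k <= 1.
  rewrite -(P0_sum i) (bigD1 k) //= lerDl sumr_ge0 // => j _.
  by rewrite P0E ltW.
have comparable i j i' j' : c * P 0 i' j' <= P 0 i j.
  apply: (@le_trans _ _ c); first by rewrite ler_piMr // ltW.
  by rewrite P0E (cP (i, j)).
have q0C y z : qC (to_complex theta0) y z = (Q 0 y z)%:C.
  rewrite Q0E; apply: qR => //; exact: complex_ball_center.
have logq i j : (\int[@lebesgue_measure R]_z (Q 0 j z * `|ln (Q 0 i z)|)%:E < +oo)%E.
  apply: (log_envelope_integrable (w := to_complex theta0) i j _ Qg q0m q0C int1 int2).
  exact: complex_ball_center.
have c01 : 0 < c <= 1 by rewrite c0 c1.
have Pg i j : 0 < P 0 i j by rewrite P0E.
have w_sum h : box r h -> \sum_i w h i = 1.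
  by move=> hb; case: (pi_stationary (proj1 (dom h hb))).
have w_st h : box r h -> forall j, \sum_i w h i * P h i j = w h j.
  move=> hb j; have [_ _ E] := pi_stationary (proj1 (dom h hb)).
  by rewrite /w -[in RHS]E mxE.
have q_mass h : box r h -> forall y, (\int[@lebesgue_measure R]_z (Q h y z)%:E = 1)%E.
  by move=> hb y; case: (qd h hb y).
have [C [H [WH cH]]] := @entropy_rate_wiener R (m1 + m2) l r r0 P w Q i0 c c01
  comparable Pg P0_sum (fun i => proj1 (Ww i)) Qg q0m WP (fun i => proj2 (Ww i)) WQ
  (fun h hb => proj2 (st h hb)) w_sum w_st q_mass logq.
exists r, C, H; split => // h hb; have := cH h hb; apply: cvg_trans.
apply: near_eq_cvg; near=> n; rewrite /normalized_block_entropy /block_entropy.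
congr (_ * - _)%E; apply: eq_integral => z _.
by rewrite (@hmc_density_pd R (m1 + m2) l P w Q h) //; case: (st h hb).
Unshelve. all: by end_near.
Qed.

End nearby_chains.

Theorem theorem1p4 (R : realType) (l m1 m2 : nat)
  (Omega1 : set 'rV[R]_m1) (Omega2 : set 'rV[R]_m2)
  (Pi : 'rV[R]_m1 -> 'M[R]_l) (pi : 'rV[R]_m1 -> 'rV[R]_l)
  (q : 'rV[R]_m2 -> 'I_l -> R -> R)
  (* complex analytic extension of q around theta0 *)
  (qC : 'rV[R[i]]_m2 -> 'I_l -> R -> R[i])
  (eps0 : 'rV[R]_m1) (theta0 : 'rV[R]_m2)
  (* standing assumptions *)
  (domain1 : bounded_domain Omega1) (domain2 : bounded_domain Omega2)
  (Pi_stochastic : forall eps, Omega1 eps -> stochastic_matrix (Pi eps))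
  (Pi_analytic : forall i j, analytic_on Omega1 (fun eps => Pi eps i j))
  (pi_stationary : forall eps, Omega1 eps ->
     stationary_vector (Pi eps) (pi eps))
  (q_density : forall theta, Omega2 theta ->
     forall y, probability_density (q theta y))
  (q_analytic : forall y z, analytic_on Omega2 (fun theta => q theta y z))
  (eps0_in : Omega1 eps0) (theta0_in : Omega2 theta0)
  (* (a) *)
  (Pi_gt0 : forall i j, 0 < Pi eps0 i j)
  (* (b) *)
  (q_gt0 : forall y z, 0 < q theta0 y z)
  (* (c) *)
  (q_regular : exists r2 : R, 0 < r2 /\
     [/\ forall theta, Omega2 theta ->
           complex_ball theta0 r2 (to_complex theta) ->
           forall y z, qC (to_complex theta) y z = (q theta y z)%:C,
         forall y z,
           analytic_on (complex_ball theta0 r2) (fun theta => qC theta y z),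
         forall y,
           {within [set: R] `*` (complex_ball theta0 r2 : set 'rV[R[i]^o]_m2),
             continuous ((fun zt => qC zt.2 y zt.1) :
                           R * 'rV[R[i]^o]_m2 -> R[i]^o)} &
         [/\ (@lebesgue_measure R).-integrable setT (q_breve qC theta0 r2),
             (@lebesgue_measure R).-integrable setT
               (fun z => q_breve qC theta0 r2 z * lne (q_hat qC theta0 r2 z))%E &
             (@lebesgue_measure R).-integrable setT
               (fun z =>
                  q_breve qC theta0 r2 z * lne (q_breve qC theta0 r2 z))%E]])
  (* additional assumption *)
  (q_close : forall delta : R, 0 < delta ->
     exists r2 : R, 0 < r2 /\
       forall y z theta, complex_ball theta0 r2 theta ->
         `|complex.Im (qC theta y z)| < delta * `|complex.Re (qC theta y z)| /\
         normc (clog (qC theta y z / (q theta0 y z)%:C)) <= delta) :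
  exists U : set 'rV[R]_(m1 + m2),
    [/\ open U, U (row_mx eps0 theta0),
        forall x, U x -> Omega1 (lsubmx x) /\ Omega2 (rsubmx x),
        forall x, U x ->
          let eps := lsubmx x in let theta := rsubmx x in
          cvgn (normalized_block_entropy (Pi eps) (pi eps) (q theta)) /\
          entropy_rate (Pi eps) (pi eps) (q theta) \is a fin_num &
        analytic_on U (fun x =>
          fine (entropy_rate (Pi (lsubmx x)) (pi (lsubmx x)) (q (rsubmx x))))].
Proof.
case: domain1 => open1 _ _; case: domain2 => open2 _ _.
have [r2 [r20 [qR qA qcont [_ int1 int2]]]] := q_regular.
(* Any fixed delta bounds |q^theta| by a multiple of q^theta0; the small relative errors come from
   shrinking the box afterwards. *)
have [r1 [r10 close]] := q_close 1 ltr01.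
have [r [C [H [r0 dom WH cH]]]] := @entropy_rate_near R l m1 m2 Omega1 Omega2 Pi pi q qC
  eps0 theta0 open1 open2 Pi_stochastic Pi_analytic pi_stationary q_density
  eps0_in theta0_in Pi_gt0 q_gt0 r1 r2 r10 r20 qR qA qcont int1 int2
  (fun y z theta B => proj2 (close y z theta B)).
set x0 := row_mx eps0 theta0 in dom WH cH *.
pose rate x := entropy_rate (Pi (lsubmx x)) (pi (lsubmx x)) (q (rsubmx x)).
have rateE h : box r h -> rate (x0 + h) = (H h)%:E.
  by move=> hb; apply/cvg_lim => //; exact: cH.
have r20' : 0 < r / 2 by rewrite divr_gt0.
have sub x : box (r / 2) (x - x0) -> box r (x - x0).
  by move=> hb i; apply: le_trans (hb i) _; lra.
(* Half the radius leaves room to recentre the series: a box of radius r / 2 about any point of this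
   set stays inside the box of radius r about [x0]. *)
exists ((fun x : 'rV[R]_(m1 + m2) => box (r / 2) (x - x0))°).
have inU x : ((fun x : 'rV[R]_(m1 + m2) => box (r / 2) (x - x0))°) x -> box (r / 2) (x - x0).
  exact: interior_subset.
split.
- exact: open_interior.
- exact: near_box.
- by move=> x /inU/sub/dom; rewrite addrC subrK.
- move=> x /inU/sub hb; have := cH _ hb; have := rateE _ hb.
  rewrite [x0 + _]addrC subrK => E cHx; split; first by apply/cvg_ex; exists (H (x - x0))%:E.
  by rewrite -/(rate x) E.
- move=> x /inU hb; apply: (@wiener_analytic_at _ _ (r / 2) C) => //.
  have le_r i : `|(x - x0) 0 i| + r / 2 <= r by have := hb i; lra.
  apply: (wiener_ext (wiener_recenter r0 r20' le_r WH)) => z h hh.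
  have hbr : box r (x - x0 + h).
    move=> i; rewrite mxE; apply: le_trans (ler_normD _ _) _.
    by apply: le_trans (le_r i); rewrite lerD2l.
  by have := rateE _ hbr; rewrite addrA [x0 + _]addrC subrK /rate => ->.
Qed.
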